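(* Let $0<p\le1$, let $\omega$ be an almost monotone weight on $\mathbb N^2$, and let $\widetilde a:\mathbb H^2\to\mathbb C$ have a $p$-th power $\omega$-absolutely convergent Dirichlet series. (I) If $\widetilde a$ is bounded away from zero on $\mathbb H^2$, then there is an almost monotone weight $\nu$ on $\mathbb N^2$ such that: $\nu$ is constant iff $\omega$ is constant; $\nu$ is admissible iff $\omega$ is admissible; $1\le\nu\le\omega$; and $1/\widetilde a$ has a $p$-th power $\nu$-absolutely convergent Dirichlet series. (II) If $\varphi$ is holomorphic on an open neighbourhood of the closure of the range of $\widetilde a$, then there is an almost monotone weight $\xi$ on $\mathbb N^2$ such that: $\xi$ is constant iff $\omega$ is constant; $\xi$ is admissible iff $\omega$ is admissible; $1\le\xi\le\omega$; and $\varphi\circ\widetilde a$ has a $p$-th power $\xi$-absolutely convergent Dirichlet series.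
   Context: $\mathbb H=\{\operatorname{Re}z\ge0\}$. A weight on $\mathbb N^2$ (coordinatewise multiplication) is $\omega:\mathbb N^2\to[1,\infty)$ with $\omega(xy)\le\omega(x)\omega(y)$; admissible if $\lim_n\omega(l^n,k^n)^{1/n}=1$ for all $(l,k)$; almost monotone if either it is admissible, or there is $K>0$ such that $\omega(m_1,n_1)\le K\omega(m_2,n_2)$ whenever either $m_1\mid m_2$ or $n_1\mid n_2$. For $0<p\le1$, $\widetilde a:\mathbb H^2\to\mathbb C$ has a $p$-th power $\omega$-absolutely convergent Dirichlet series if there is $a:\mathbb N^2\to\mathbb C$ with $\sum_{(m,n)}|a(m,n)|^p\omega(m,n)<\infty$ and $\widetilde a(s_1,s_2)=\sum_{(m,n)}a(m,n)m^{-s_1}n^{-s_2}$ for all $(s_1,s_2)\in\mathbb H^2$. Bounded away from zero means $|\widetilde a|\ge k$ on $\mathbb H^2$ for some $k>0$. *)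

(* Defs.v *)
From Stdlib Require Import Reals Lra Lia Arith.
From Coquelicot Require Import Coquelicot.
Open Scope R_scope.

(** Indices range over N = {1,2,3,...}; functions on N^2 are modelled as
    [nat -> nat -> _] and all conditions are imposed only for indices >= 1. *)

Definition is_weight (w : nat -> nat -> R) : Prop :=
  (forall m n, (1 <= m)%nat -> (1 <= n)%nat -> 1 <= w m n) /\
  (forall m1 n1 m2 n2, (1 <= m1)%nat -> (1 <= n1)%nat -> (1 <= m2)%nat -> (1 <= n2)%nat ->
     w (m1 * m2)%nat (n1 * n2)%nat <= w m1 n1 * w m2 n2).

Definition admissible (w : nat -> nat -> R) : Prop :=
  forall l k, (1 <= l)%nat -> (1 <= k)%nat ->
    is_lim_seq (fun j => Rpower (w (l ^ S j)%nat (k ^ S j)%nat) (/ INR (S j))) 1.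

Definition almost_monotone (w : nat -> nat -> R) : Prop :=
  is_weight w /\
  (admissible w \/
   exists K, 0 < K /\
     forall m1 n1 m2 n2, (1 <= m1)%nat -> (1 <= n1)%nat -> (1 <= m2)%nat -> (1 <= n2)%nat ->
       (Nat.divide m1 m2 \/ Nat.divide n1 n2) -> w m1 n1 <= K * w m2 n2).

Definition const_weight (w : nat -> nat -> R) : Prop :=
  exists c, forall m n, (1 <= m)%nat -> (1 <= n)%nat -> w m n = c.

(** x^p for x >= 0, with the convention 0^p = 0 (p > 0). *)
Definition rpow (x p : R) : R := if Rle_dec x 0 then 0 else Rpower x p.

(** m^{-s} for m >= 1 and s in C: exp(-s log m). *)
Definition npow_neg (m : nat) (s : C) : C :=
  let L := ln (INR m) in
  (exp (- fst s * L) * cos (snd s * L), - (exp (- fst s * L) * sin (snd s * L))).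

Fixpoint csum (f : nat -> C) (N : nat) : C :=
  match N with O => 0%C | S N' => Cplus (csum f N') (f N') end.

Fixpoint rsum (f : nat -> R) (N : nat) : R :=
  match N with O => 0 | S N' => rsum f N' + f N' end.

Definition sq_csum (F : nat -> nat -> C) (N : nat) : C :=
  csum (fun i => csum (fun j => F (S i) (S j)) N) N.
Definition sq_rsum (F : nat -> nat -> R) (N : nat) : R :=
  rsum (fun i => rsum (fun j => F (S i) (S j)) N) N.

Definition inH (s : C) : Prop := 0 <= fst s.

(** f : H^2 -> C has a p-th power w-absolutely convergent Dirichlet series:
    there is a : N^2 -> C with sum |a(m,n)|^p w(m,n) < oo (nonnegative terms, so
    bounded partial sums) and f(s1,s2) = sum a(m,n) m^{-s1} n^{-s2} on H^2
    (the series is then absolutely convergent; its value is the limit of the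
    square partial sums). *)
Definition has_pDS (p : R) (w : nat -> nat -> R) (f : C -> C -> C) : Prop :=
  exists a : nat -> nat -> C,
    (exists M, forall N, sq_rsum (fun m n => rpow (Cmod (a m n)) p * w m n) N <= M) /\
    (forall s1 s2, inH s1 -> inH s2 ->
       filterlim (fun N => sq_csum (fun m n => Cmult (a m n) (Cmult (npow_neg m s1) (npow_neg n s2))) N)
         eventually (locally (f s1 s2))).

Definition bounded_away_from_zero (f : C -> C -> C) : Prop :=
  exists k, 0 < k /\ forall s1 s2, inH s1 -> inH s2 -> k <= Cmod (f s1 s2).

Definition closure_range (f : C -> C -> C) (z : C) : Prop :=
  forall eps, 0 < eps -> exists s1 s2, inH s1 /\ inH s2 /\ Cmod (Cminus (f s1 s2) z) < eps.

Definition holomorphic_near_closure_range (phi : C -> C) (f : C -> C -> C) : Prop :=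
  exists U : C -> Prop, open U /\ (forall z, closure_range f z -> U z) /\
    (forall z, U z -> ex_derive (K := C_AbsRing) (V := C_NormedModule) phi z).

(* Main.v *)
Require Import Defs.
From Stdlib Require Import Reals Lra Lia Psatz Arith PArith List.
From Stdlib Require Import Classical ClassicalEpsilon IndefiniteDescription.
From Coquelicot Require Import Coquelicot.
Import ListNotations.
Open Scope R_scope.

(** An almost monotone weight is always admissible: as 1 divides everything, the divisibility
    alternative bounds it.  Moreover min(w, B) is a bounded weight below w, and for B large it is
    constant only if w is.  Hence one may take nu = xi = min(w, B), and only the unweighted
    p-normed algebra A of Dirichlet series with sum |a(m,n)|^p < oo matters.

    The spectral radius in A equals the sup norm on H^2: for a Dirichlet polynomial P the
    coefficients of P^j are at most sup |P|^j and their number grows polynomially in j, and a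
    general f is a small perturbation of a polynomial.  If |f| >= k > 0 on H^2, consider the
    translates f(s + tau): for tau large they are close to a nonzero constant, hence invertible
    in A, and invertibility passes from tau to tau' as soon as sup |f(s + tau) - f(s + tau')| is
    at most k/2, because the Neumann series then converges by the spectral radius formula.  By
    uniform continuity, finitely many steps lead to tau = 0.

    For phi holomorphic near the closure K of the range of f, Cauchy's formula over the boundary
    of the union of the cells of a fine grid that are close to K represents phi on K.  Along an
    edge with midpoint c, the expansion of 1 / (lam - f) in powers of 1 / (c - f), which belongs
    to A, converges again by the spectral radius formula.  This replaces an A-valued integral,
    which would not be available for p < 1. *)

(** For [p < 1] the gauge sum |a(m,n)|^p is subadditive and submultiplicative, but A is not locally
    convex. Hence all estimates bound p-th powers of moduli, and a series in A is summed by adding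
    up the gauges of its terms. Functions are represented by lists of atoms whose like terms are not
    merged: sums, products and series are then rearrangements of lists, and merging, which can only
    lower the gauge, is left to the places where true coefficients matter.

    The sup norm on H^2 bounds coefficients because on the imaginary axes the characters become pure
    oscillations, whose frequencies (log m, log n) differ for different indices. Translates are the
    right path for inversion: they inherit the bound |f| >= k, and the character of (m,n) acquires
    the factor (mn)^(-tau), which leaves only the constant term in the limit. In the contour
    argument the mesh d is also the distance kept from K: a surviving edge has length d and lies at
    distance at least d from K, which makes the expansion at its midpoint geometric with ratio
    1/2. *)

(** * Powers with exponent in (0, 1] *)

Lemma rpow_0 (p : R) : rpow 0 p = 0.
Proof. unfold rpow; destruct (Rle_dec 0 0); lra. Qed.

Lemma rpow_ge_0 (x p : R) : 0 <= rpow x p.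
Proof.
  unfold rpow; destruct (Rle_dec x 0); [lra|].
  left; apply exp_pos.
Qed.

Lemma rpow_pos (x p : R) : 0 < x -> 0 < rpow x p.
Proof.
  intros Hx; unfold rpow; destruct (Rle_dec x 0); [lra|]. apply exp_pos.
Qed.

Lemma rpow_1 (p : R) : rpow 1 p = 1.
Proof.
  unfold rpow; destruct (Rle_dec 1 0); [lra|].
  unfold Rpower; rewrite ln_1, Rmult_0_r; apply exp_0.
Qed.

Lemma rpow_mult (x y p : R) : 0 <= x -> 0 <= y -> rpow (x * y) p = rpow x p * rpow y p.
Proof.
  intros Hx Hy.
  destruct (Req_dec x 0) as [->|Hx0]; [rewrite Rmult_0_l, rpow_0; ring|].
  destruct (Req_dec y 0) as [->|Hy0]; [rewrite Rmult_0_r, rpow_0; ring|].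
  assert (Hxy : 0 < x * y) by (apply Rmult_lt_0_compat; lra).
  unfold rpow; destruct (Rle_dec x 0), (Rle_dec y 0), (Rle_dec (x * y) 0); try lra.
  rewrite Rpower_mult_distr; lra.
Qed.

Lemma rpow_le (x y p : R) : 0 < p -> x <= y -> rpow x p <= rpow y p.
Proof.
  intros Hp Hxy; unfold rpow; destruct (Rle_dec x 0), (Rle_dec y 0); try lra.
  - left; apply exp_pos.
  - apply Rle_Rpower_l; lra.
Qed.

Lemma rpow_lt (x y p : R) : 0 < p -> 0 <= x -> x < y -> rpow x p < rpow y p.
Proof.
  intros Hp Hx Hxy; unfold rpow; destruct (Rle_dec x 0), (Rle_dec y 0); try lra.
  - apply exp_pos.
  - apply exp_increasing, Rmult_lt_compat_l; [lra|]. apply ln_increasing; lra.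
Qed.

Lemma rpow_le_inv (x y p : R) : 0 < p -> 0 <= y -> rpow x p <= rpow y p -> x <= y.
Proof.
  intros Hp Hy H; apply Rnot_lt_le; intros Hlt.
  generalize (rpow_lt y x p Hp Hy Hlt); lra.
Qed.

Lemma rpow_ge_id (x p : R) : 0 < p <= 1 -> 0 <= x <= 1 -> x <= rpow x p.
Proof.
  intros Hp Hx; unfold rpow; destruct (Rle_dec x 0); [lra|].
  rewrite <- (Rpower_1 x) at 1 by lra.
  unfold Rpower. assert (ln x <= 0) by (rewrite <- ln_1; apply ln_le; lra).
  assert (1 * ln x <= p * ln x) by nra.
  destruct H0 as [H0|H0]; [left; now apply exp_increasing|rewrite H0; lra].
Qed.

(** After division by [x + y] both arguments lie in [0, 1], where u <= u^p; the two resulting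
    inequalities add up to the claim. *)
Lemma rpow_plus_le (x y p : R) :
  0 < p <= 1 -> 0 <= x -> 0 <= y -> rpow (x + y) p <= rpow x p + rpow y p.
Proof.
  intros Hp Hx Hy.
  destruct (Req_dec (x + y) 0) as [H0|H0].
  { rewrite H0, rpow_0. generalize (rpow_ge_0 x p) (rpow_ge_0 y p); lra. }
  assert (Hs : 0 < x + y) by lra.
  assert (E : forall u, 0 <= u <= x + y -> u / (x + y) * rpow (x + y) p <= rpow u p).
  { intros u Hu.
    replace u with (u / (x + y) * (x + y)) at 2 by (field; lra).
    assert (0 <= u / (x + y) <= 1).
    { split; [apply Rdiv_le_0_compat; lra|].
      apply (Rmult_le_reg_r (x + y)); [lra|]. unfold Rdiv; rewrite Rmult_assoc, Rinv_l; lra. }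
    rewrite rpow_mult by lra.
    apply Rmult_le_compat_r; [apply rpow_ge_0|]. now apply rpow_ge_id. }
  generalize (E x ltac:(lra)) (E y ltac:(lra)); intros E1 E2.
  replace (rpow (x + y) p) with (x / (x + y) * rpow (x + y) p + y / (x + y) * rpow (x + y) p)
    by (field; lra).
  lra.
Qed.

Lemma rpow_pow (x p : R) (n : nat) : 0 <= x -> rpow (x ^ n) p = rpow x p ^ n.
Proof.
  intros Hx; induction n as [|n IH]; simpl; [apply rpow_1|].
  rewrite rpow_mult, IH; auto. now apply pow_le.
Qed.

Lemma rpow_small (p eps : R) : 0 < p -> 0 < eps ->
  exists d, 0 < d /\ forall x, x <= d -> rpow x p <= eps.
Proof.
  intros Hp He; exists (Rpower eps (/ p)); split; [apply exp_pos|].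
  intros x Hx. apply Rle_trans with (rpow (Rpower eps (/ p)) p); [now apply rpow_le|].
  unfold rpow; destruct (Rle_dec _ 0); [lra|].
  rewrite Rpower_mult, Rinv_l, Rpower_1; lra.
Qed.

(** * Characters of the semigroup *)

(* Indexing by [positive] rather than [nat] makes [chi] multiplicative without side conditions. *)
Definition pidx : Type := (positive * positive)%type.

Definition pidx_eq_dec (x y : pidx) : {x = y} + {x <> y}.
Proof. decide equality; apply Pos.eq_dec. Defined.

Definition pidx_mul (x y : pidx) : pidx := (Pos.mul (fst x) (fst y), Pos.mul (snd x) (snd y)).

Definition pnat (m : positive) : nat := Pos.to_nat m.

Definition chi (x : pidx) (s1 s2 : C) : C :=
  Cmult (npow_neg (pnat (fst x)) s1) (npow_neg (pnat (snd x)) s2).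

Lemma INR_pnat_ge_1 (m : positive) : 1 <= INR (pnat m).
Proof. apply (le_INR 1). unfold pnat; lia. Qed.

Lemma ln_pnat_ge_0 (m : positive) : 0 <= ln (INR (pnat m)).
Proof. rewrite <- ln_1; apply ln_le; [lra|apply INR_pnat_ge_1]. Qed.

Lemma ln_pnat_mul (m n : positive) :
  ln (INR (pnat (m * n))) = ln (INR (pnat m)) + ln (INR (pnat n)).
Proof.
  unfold pnat; rewrite Pos2Nat.inj_mul, mult_INR, ln_mult; auto;
  generalize (INR_pnat_ge_1 m) (INR_pnat_ge_1 n); unfold pnat; lra.
Qed.

Lemma ln_pnat_inj (m n : positive) : ln (INR (pnat m)) = ln (INR (pnat n)) -> m = n.
Proof.
  intros H; apply ln_inv in H;
    [|generalize (INR_pnat_ge_1 m); lra|generalize (INR_pnat_ge_1 n); lra].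
  apply INR_eq in H. now apply Pos2Nat.inj.
Qed.

Lemma npow_neg_mul (m n : positive) (s : C) :
  npow_neg (pnat (m * n)) s = Cmult (npow_neg (pnat m) s) (npow_neg (pnat n) s).
Proof.
  unfold npow_neg; rewrite ln_pnat_mul, !Rmult_plus_distr_l, exp_plus, cos_plus, sin_plus.
  unfold Cmult; simpl; f_equal; ring.
Qed.

Lemma npow_neg_plus (m : nat) (s t : C) :
  npow_neg m (Cplus s t) = Cmult (npow_neg m s) (npow_neg m t).
Proof.
  unfold npow_neg; simpl.
  rewrite Ropp_plus_distr, !Rmult_plus_distr_r, exp_plus, cos_plus, sin_plus.
  unfold Cmult; simpl; f_equal; ring.
Qed.

Lemma Cmod_npow_neg (m : nat) (s : C) : Cmod (npow_neg m s) = exp (- fst s * ln (INR m)).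
Proof.
  unfold npow_neg, Cmod; simpl.
  set (e := exp _). set (t := snd s * ln (INR m)).
  replace (e * cos t * (e * cos t * 1) + - (e * sin t) * (- (e * sin t) * 1))
    with (e * e * ((sin t)² + (cos t)²)) by (unfold Rsqr; ring).
  rewrite sin2_cos2, Rmult_1_r. apply sqrt_square. left; apply exp_pos.
Qed.

Lemma exp_le_1 (x : R) : x <= 0 -> exp x <= 1.
Proof.
  intros [H| ->]; rewrite <- exp_0; [left; now apply exp_increasing|lra].
Qed.

Lemma Cmod_chi_le_1 (x : pidx) (s1 s2 : C) : inH s1 -> inH s2 -> Cmod (chi x s1 s2) <= 1.
Proof.
  unfold inH; intros H1 H2; unfold chi; rewrite Cmod_mult, !Cmod_npow_neg, <- exp_plus.
  apply exp_le_1.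
  generalize (ln_pnat_ge_0 (fst x)) (ln_pnat_ge_0 (snd x)); nra.
Qed.

Lemma chi_1 (s1 s2 : C) : chi (1, 1)%positive s1 s2 = 1%C.
Proof.
  unfold chi, npow_neg; simpl. change (INR (pnat 1)) with 1.
  rewrite ln_1, !Rmult_0_r, exp_0, cos_0, sin_0.
  unfold Cmult; simpl; apply injective_projections; simpl; ring.
Qed.

Lemma chi_mul (x y : pidx) (s1 s2 : C) :
  chi (pidx_mul x y) s1 s2 = Cmult (chi x s1 s2) (chi y s1 s2).
Proof. unfold chi; simpl; rewrite !npow_neg_mul; ring. Qed.

Lemma chi_plus (x : pidx) (s1 s2 t1 t2 : C) :
  chi x (Cplus s1 t1) (Cplus s2 t2) = Cmult (chi x s1 s2) (chi x t1 t2).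
Proof. unfold chi; rewrite !npow_neg_plus; ring. Qed.

(** * Finite atomic sums *)

Definition atom : Type := (C * pidx)%type.

Fixpoint evl (L : list atom) (s1 s2 : C) : C :=
  match L with
  | [] => 0%C
  | a :: L' => Cplus (Cmult (fst a) (chi (snd a) s1 s2)) (evl L' s1 s2)
  end.

Fixpoint cost (p : R) (L : list atom) : R :=
  match L with [] => 0 | a :: L' => rpow (Cmod (fst a)) p + cost p L' end.

Fixpoint l1 (L : list atom) : R :=
  match L with [] => 0 | a :: L' => Cmod (fst a) + l1 L' end.

(** All pairs are kept, so the cost of the product is exactly the product of the costs; merging
    equal indices here would leave only an inequality. *)
Definition lmul (L L' : list atom) : list atom :=
  flat_map (fun a => map (fun b => (Cmult (fst a) (fst b), pidx_mul (snd a) (snd b))) L') L.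

Lemma evl_app (L L' : list atom) s1 s2 : evl (L ++ L') s1 s2 = Cplus (evl L s1 s2) (evl L' s1 s2).
Proof. induction L as [|a L IH]; simpl; [ring|rewrite IH; ring]. Qed.

Lemma cost_app p (L L' : list atom) : cost p (L ++ L') = cost p L + cost p L'.
Proof. induction L as [|a L IH]; simpl; [ring|rewrite IH; ring]. Qed.

Lemma cost_ge_0 p L : 0 <= cost p L.
Proof.
  induction L as [|a L IH]; simpl; [lra|]. generalize (rpow_ge_0 (Cmod (fst a)) p); lra.
Qed.

Lemma l1_ge_0 L : 0 <= l1 L.
Proof.
  induction L as [|a L IH]; simpl; [lra|]. generalize (Cmod_ge_0 (fst a)); lra.
Qed.

Lemma evl_lmul (L L' : list atom) s1 s2 :
  evl (lmul L L') s1 s2 = Cmult (evl L s1 s2) (evl L' s1 s2).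
Proof.
  unfold lmul; induction L as [|a L IH]; simpl; [ring|].
  rewrite evl_app, IH, Cmult_plus_distr_r; f_equal.
  clear IH; induction L' as [|b L' IH]; simpl; [ring|].
  rewrite IH, chi_mul; ring.
Qed.

Lemma cost_lmul p (L L' : list atom) : cost p (lmul L L') = cost p L * cost p L'.
Proof.
  unfold lmul; induction L as [|a L IH]; simpl; [ring|].
  rewrite cost_app, IH, Rmult_plus_distr_r; f_equal.
  clear IH; induction L' as [|b L' IH]; simpl; [ring|].
  rewrite IH, Cmod_mult, rpow_mult by apply Cmod_ge_0; ring.
Qed.

Lemma Cmod_evl_le (L : list atom) s1 s2 : inH s1 -> inH s2 -> Cmod (evl L s1 s2) <= l1 L.
Proof.
  intros H1 H2; induction L as [|a L IH]; simpl; [rewrite Cmod_0; lra|].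
  eapply Rle_trans; [apply Cmod_triangle|].
  rewrite Cmod_mult. generalize (Cmod_chi_le_1 (snd a) s1 s2 H1 H2) (Cmod_ge_0 (fst a)); nra.
Qed.

(** Subadditivity of x^p, iterated. It turns control of the p-cost into control of absolute sums,
    hence of values on H^2 and of coefficients. *)
Lemma rpow_l1_le p (L : list atom) : 0 < p <= 1 -> rpow (l1 L) p <= cost p L.
Proof.
  intros Hp; induction L as [|a L IH]; simpl; [rewrite rpow_0; lra|].
  eapply Rle_trans; [apply rpow_plus_le; auto using Cmod_ge_0, l1_ge_0|]. lra.
Qed.

(** * The p-normed algebra *)

Definition Ccvg (u : nat -> C) (l : C) : Prop :=
  forall eps, 0 < eps -> exists N, forall n, (N <= n)%nat -> Cmod (Cminus (u n) l) <= eps.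

Fixpoint cat (D : nat -> list atom) (n : nat) : list atom :=
  match n with O => [] | S n' => cat D n' ++ D n' end.

(* [inA p M f]: on H^2, [f] is the sum of a sequence of atoms (with repetitions allowed, grouped
   in finite blocks) whose total p-cost is at most [M]; allowing repetitions makes products and
   series of such functions mere rearrangements. *)
Definition inA (p M : R) (f : C -> C -> C) : Prop :=
  exists D : nat -> list atom,
    (forall n, cost p (cat D n) <= M) /\
    (forall s1 s2, inH s1 -> inH s2 -> Ccvg (fun n => evl (cat D n) s1 s2) (f s1 s2)).

Lemma Ccvg_const c : Ccvg (fun _ => c) c.
Proof.
  intros e He; exists 0%nat; intros n _. replace (Cminus c c) with (RtoC 0) by ring.
  rewrite Cmod_0; lra.
Qed.

Lemma Ccvg_ext u v l : (forall n, u n = v n) -> Ccvg u l -> Ccvg v l.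
Proof. intros H Hu e He; destruct (Hu e He) as [N HN]; exists N; intros; rewrite <- H; auto. Qed.

Lemma Ccvg_plus u v l m : Ccvg u l -> Ccvg v m -> Ccvg (fun n => Cplus (u n) (v n)) (Cplus l m).
Proof.
  intros Hu Hv e He.
  destruct (Hu (e / 2)) as [N HN]; [lra|]. destruct (Hv (e / 2)) as [N' HN']; [lra|].
  exists (N + N')%nat; intros n Hn.
  replace (Cminus (Cplus (u n) (v n)) (Cplus l m)) with (Cplus (Cminus (u n) l) (Cminus (v n) m))
    by ring.
  eapply Rle_trans; [apply Cmod_triangle|].
  generalize (HN n ltac:(lia)) (HN' n ltac:(lia)); lra.
Qed.

Lemma Ccvg_bound u l B : Ccvg u l -> (forall n, Cmod (u n) <= B) -> Cmod l <= B.
Proof.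
  intros Hu HB; apply le_epsilon; intros e He.
  destruct (Hu e He) as [N HN].
  replace l with (Cplus (u N) (Copp (Cminus (u N) l))) by ring.
  eapply Rle_trans; [apply Cmod_triangle|]. rewrite Cmod_opp.
  generalize (HN N ltac:(lia)) (HB N); lra.
Qed.

Lemma Ccvg_scal c u l : Ccvg u l -> Ccvg (fun n => Cmult c (u n)) (Cmult c l).
Proof.
  intros Hu e He. generalize (Cmod_ge_0 c); intros Hc.
  destruct (Hu (e / (Cmod c + 1))) as [N HN]; [apply Rdiv_lt_0_compat; lra|].
  exists N; intros n Hn.
  replace (Cminus (Cmult c (u n)) (Cmult c l)) with (Cmult c (Cminus (u n) l)) by ring.
  rewrite Cmod_mult. specialize (HN n Hn).
  apply Rle_trans with ((Cmod c + 1) * (e / (Cmod c + 1))).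
  - apply Rmult_le_compat; auto using Cmod_ge_0; lra.
  - right; field; lra.
Qed.

(** The difference u v - l m is split as (u - l)(v - m) + m (u - l) + l (v - m). *)
Lemma Ccvg_mult u v l m : Ccvg u l -> Ccvg v m -> Ccvg (fun n => Cmult (u n) (v n)) (Cmult l m).
Proof.
  intros Hu Hv.
  assert (H0 : Ccvg (fun n => Cmult (Cminus (u n) l) (Cminus (v n) m)) 0%C).
  { intros e He. destruct (Hu (Rmin e 1)) as [N HN]; [apply Rmin_pos; lra|].
    destruct (Hv 1) as [N' HN']; [lra|].
    exists (N + N')%nat; intros n Hn.
    replace (Cminus _ 0) with (Cmult (Cminus (u n) l) (Cminus (v n) m)) by ring.
    rewrite Cmod_mult. generalize (HN n ltac:(lia)) (HN' n ltac:(lia)) (Rmin_l e 1); intros.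
    generalize (Cmod_ge_0 (Cminus (u n) l)) (Cmod_ge_0 (Cminus (v n) m)); nra. }
  assert (H1 := Ccvg_plus _ _ _ _ H0 (Ccvg_plus _ _ _ _ (Ccvg_scal m _ _ Hu)
              (Ccvg_plus _ _ _ _ (Ccvg_scal l _ _ Hv) (Ccvg_const (Copp (Cmult l m)))))).
  replace (Cmult l m) with (0 + (m * l + (l * m + - (l * m))))%C by ring.
  revert H1; apply Ccvg_ext; intros n; ring.
Qed.

Lemma inA_ext p M f g : (forall s1 s2, inH s1 -> inH s2 -> f s1 s2 = g s1 s2) ->
  inA p M f -> inA p M g.
Proof.
  intros H [D [H1 H2]]; exists D; split; auto.
  intros s1 s2 Hs1 Hs2; rewrite <- H; auto.
Qed.

Lemma inA_weaken p M M' f : M <= M' -> inA p M f -> inA p M' f.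
Proof. intros H [D [H1 H2]]; exists D; split; auto. intros n; specialize (H1 n); lra. Qed.

Lemma inA_M_ge_0 p M f : inA p M f -> 0 <= M.
Proof. intros [D [H _]]; exact (H 0%nat). Qed.

Lemma inA_evl p L : inA p (cost p L) (evl L).
Proof.
  exists (fun n => match n with O => L | _ => [] end).
  assert (E : forall n, cat (fun n => match n with O => L | _ => [] end) (S n) = L).
  { induction n as [|n IH]; [reflexivity|].
    change (cat (fun n => match n with O => L | _ => [] end) (S n) ++ [] = L).
    rewrite IH; apply app_nil_r. }
  split.
  - intros [|n]; [apply cost_ge_0|]. rewrite E; lra.
  - intros s1 s2 _ _ e He; exists 1%nat; intros [|n] Hn; [lia|]. rewrite E.
    replace (Cminus _ _) with (RtoC 0) by ring. rewrite Cmod_0; lra.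
Qed.

Lemma inA_plus p M M' f g : inA p M f -> inA p M' g ->
  inA p (M + M') (fun s1 s2 => Cplus (f s1 s2) (g s1 s2)).
Proof.
  intros [D [HD1 HD2]] [E [HE1 HE2]]; exists (fun n => D n ++ E n).
  assert (Hc : forall n, cost p (cat (fun n => D n ++ E n) n) = cost p (cat D n) + cost p (cat E n)).
  { induction n as [|n IH]; simpl; [lra|]. rewrite !cost_app, IH; lra. }
  assert (He : forall n s1 s2, evl (cat (fun n => D n ++ E n) n) s1 s2 =
             Cplus (evl (cat D n) s1 s2) (evl (cat E n) s1 s2)).
  { intros n s1 s2; induction n as [|n IH]; simpl; [ring|]. rewrite !evl_app, IH; ring. }
  split.
  - intros n; rewrite Hc; specialize (HD1 n); specialize (HE1 n); lra.
  - intros s1 s2 H1 H2. eapply Ccvg_ext; [intros n; symmetry; apply He|].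
    apply Ccvg_plus; auto.
Qed.

(* The n-th block of the product collects the pairs (k, j) with max (k, j) = n. *)
Lemma inA_mult p M M' f g : inA p M f -> inA p M' g ->
  inA p (M * M') (fun s1 s2 => Cmult (f s1 s2) (g s1 s2)).
Proof.
  intros [D [HD1 HD2]] [E [HE1 HE2]].
  set (B := fun n => lmul (cat D n) (E n) ++ lmul (D n) (cat E (S n))).
  exists B.
  assert (Hc : forall n, cost p (cat B n) = cost p (cat D n) * cost p (cat E n)).
  { induction n as [|n IH]; simpl; [lra|]. unfold B at 2.
    rewrite !cost_app, IH, !cost_lmul; simpl; rewrite cost_app; ring. }
  assert (He : forall n s1 s2, evl (cat B n) s1 s2 =
             Cmult (evl (cat D n) s1 s2) (evl (cat E n) s1 s2)).
  { intros n s1 s2; induction n as [|n IH]; simpl; [ring|]. unfold B at 2.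
    rewrite !evl_app, IH, !evl_lmul; simpl; rewrite evl_app; ring. }
  split.
  - intros n; rewrite Hc. apply Rmult_le_compat; auto using cost_ge_0.
  - intros s1 s2 H1 H2. eapply Ccvg_ext; [intros n; symmetry; apply He|].
    apply Ccvg_mult; auto.
Qed.

Lemma inA_const p c : inA p (rpow (Cmod c) p) (fun _ _ => c).
Proof.
  apply inA_ext with (evl [(c, (1, 1)%positive)]).
  - intros; simpl. rewrite chi_1; ring.
  - apply inA_weaken with (cost p [(c, (1, 1)%positive)]); [simpl; lra|apply inA_evl].
Qed.

Lemma inA_scal p M c f : inA p M f ->
  inA p (rpow (Cmod c) p * M) (fun s1 s2 => Cmult c (f s1 s2)).
Proof. intros H; exact (inA_mult _ _ _ _ _ (inA_const p c) H). Qed.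

(** Characters have modulus at most 1 on H^2, so the partial sums obey the bound; the error of the
    passage to the limit is split off by subadditivity of x^p. *)
Lemma inA_sup p M f s1 s2 : 0 < p <= 1 -> inA p M f -> inH s1 -> inH s2 ->
  rpow (Cmod (f s1 s2)) p <= M.
Proof.
  intros Hp Hf H1 H2. destruct Hf as [D [HD1 HD2]].
  apply le_epsilon; intros e He.
  destruct (rpow_small p e ltac:(lra) He) as [d [Hd Hd']].
  destruct (HD2 s1 s2 H1 H2 d Hd) as [N HN]. specialize (HN N (le_n _)).
  set (u := evl (cat D N) s1 s2) in *.
  apply Rle_trans with (rpow (Cmod u + Cmod (Cminus u (f s1 s2))) p).
  { apply rpow_le; [lra|].
    replace (f s1 s2) with (Cplus u (Copp (Cminus u (f s1 s2)))) at 1 by ring.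
    eapply Rle_trans; [apply Cmod_triangle|]. rewrite Cmod_opp; lra. }
  eapply Rle_trans; [apply rpow_plus_le; auto using Cmod_ge_0|].
  apply Rplus_le_compat; [|auto].
  apply Rle_trans with (cost p (cat D N)); [|auto].
  eapply Rle_trans; [|now apply rpow_l1_le].
  apply rpow_le; [lra|]. now apply Cmod_evl_le.
Qed.

Lemma cat_shift D n k : cat D (n + k) = cat D n ++ cat (fun i => D (n + i)%nat) k.
Proof.
  induction k as [|k IH]; simpl; [now rewrite Nat.add_0_r, app_nil_r|].
  rewrite Nat.add_succ_r; simpl. rewrite IH, app_assoc; reflexivity.
Qed.

(** Any index at which [u] comes within [eps] of its supremum will do. *)
Lemma incr_bounded_tail (u : nat -> R) (M eps : R) :
  (forall n, u n <= M) -> 0 < eps -> exists N, forall n, u n <= u N + eps.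
Proof.
  intros HM He.
  destruct (completeness (fun x => exists n, x = u n)) as [l [Hl1 Hl2]].
  - exists M; intros x [n ->]; auto.
  - exists (u 0%nat); now exists 0%nat.
  - apply NNPP; intros Hno.
    assert (l <= l - eps); [|lra].
    apply Hl2; intros x [n ->].
    apply Rnot_lt_le; intros Hlt. apply Hno; exists n; intros k.
    assert (u k <= l) by (apply Hl1; now exists k). lra.
Qed.

Lemma blocks_tail p M D eps : (forall n, cost p (cat D n) <= M) -> 0 < eps ->
  exists N, forall k, cost p (cat (fun i => D (N + i)%nat) k) <= eps.
Proof.
  intros HD He.
  destruct (incr_bounded_tail (fun n => cost p (cat D n)) M eps HD He) as [N HN].
  exists N; intros k. specialize (HN (N + k)%nat). rewrite cat_shift, cost_app in HN. lra.
Qed.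

(** [L] is a long initial segment of the blocks, and the remaining blocks represent the difference.
    Dirichlet polynomials are thus dense in the algebra. *)
Lemma inA_approx p M f eps : inA p M f -> 0 < eps ->
  exists L, inA p eps (fun s1 s2 => Cminus (f s1 s2) (evl L s1 s2)).
Proof.
  intros [D [HD1 HD2]] He.
  destruct (blocks_tail p M D eps HD1 He) as [N HN].
  exists (cat D N), (fun i => D (N + i)%nat); split; auto.
  intros s1 s2 H1 H2 e He'. destruct (HD2 s1 s2 H1 H2 e He') as [K HK].
  exists K; intros n Hn. specialize (HK (N + n)%nat ltac:(lia)).
  rewrite cat_shift, evl_app in HK.
  replace (Cminus _ _) with (Cminus (Cplus (evl (cat D N) s1 s2)
     (evl (cat (fun i => D (N + i)%nat) n) s1 s2)) (f s1 s2)) by ring. exact HK.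
Qed.

(** * Finite sums, and convergent series in the algebra *)

Lemma csum_ext u v n : (forall k, (k < n)%nat -> u k = v k) -> csum u n = csum v n.
Proof. induction n as [|n IH]; intros H; simpl; [auto|]. rewrite IH, H; auto. Qed.

Lemma rsum_ext u v n : (forall k, (k < n)%nat -> u k = v k) -> rsum u n = rsum v n.
Proof. induction n as [|n IH]; intros H; simpl; [auto|]. rewrite IH, H; auto. Qed.

Lemma csum_plus u v n : csum (fun k => Cplus (u k) (v k)) n = Cplus (csum u n) (csum v n).
Proof. induction n as [|n IH]; simpl; [ring|]. rewrite IH; ring. Qed.

Lemma rsum_plus u v n : rsum (fun k => u k + v k) n = rsum u n + rsum v n.
Proof. induction n as [|n IH]; simpl; [ring|]. rewrite IH; ring. Qed.

Lemma csum_scal c u n : csum (fun k => Cmult c (u k)) n = Cmult c (csum u n).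
Proof. induction n as [|n IH]; simpl; [ring|]. rewrite IH; ring. Qed.

Lemma rsum_scal c u n : rsum (fun k => c * u k) n = c * rsum u n.
Proof. induction n as [|n IH]; simpl; [ring|]. rewrite IH; ring. Qed.

Lemma rsum_le u v n : (forall k, (k < n)%nat -> u k <= v k) -> rsum u n <= rsum v n.
Proof. induction n as [|n IH]; intros H; simpl; [lra|]. apply Rplus_le_compat; auto. Qed.

Lemma Cmod_csum_le u n : Cmod (csum u n) <= rsum (fun k => Cmod (u k)) n.
Proof.
  induction n as [|n IH]; simpl; [rewrite Cmod_0; lra|].
  eapply Rle_trans; [apply Cmod_triangle|]. lra.
Qed.

Lemma csum_split u n k : csum u (n + k) = Cplus (csum u n) (csum (fun i => u (n + i)%nat) k).
Proof.
  induction k as [|k IH]; simpl; [rewrite Nat.add_0_r; ring|].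
  rewrite Nat.add_succ_r; simpl; rewrite IH; ring.
Qed.

Lemma rsum_split u n k : rsum u (n + k) = rsum u n + rsum (fun i => u (n + i)%nat) k.
Proof.
  induction k as [|k IH]; simpl; [rewrite Nat.add_0_r; ring|].
  rewrite Nat.add_succ_r; simpl; rewrite IH; ring.
Qed.

Lemma rpow_csum_le p u n : 0 < p <= 1 ->
  rpow (Cmod (csum u n)) p <= rsum (fun k => rpow (Cmod (u k)) p) n.
Proof.
  intros Hp; induction n as [|n IH]; simpl; [rewrite Cmod_0, rpow_0; lra|].
  eapply Rle_trans; [apply rpow_le; [lra|apply Cmod_triangle]|].
  eapply Rle_trans; [apply rpow_plus_le; auto using Cmod_ge_0|]. lra.
Qed.

Lemma Ccvg_csum (d : nat -> nat -> C) (l : nat -> C) J : (forall j, (j < J)%nat -> Ccvg (d j) (l j)) ->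
  Ccvg (fun n => csum (fun j => d j n) J) (csum l J).
Proof.
  induction J as [|J IH]; intros H; simpl; [apply Ccvg_const|].
  apply Ccvg_plus; [apply IH|]; auto.
Qed.

(** Tannery's theorem along the diagonal: the first [J] sequences are jointly small for large [n],
    and the others are controlled by a tail of [Ms], their p-th powers being added by
    subadditivity. *)
Lemma Ccvg_dominated_diagonal p (d : nat -> nat -> C) (Ms : nat -> R) M :
  0 < p <= 1 -> (forall j, Ccvg (d j) 0%C) -> (forall j n, rpow (Cmod (d j n)) p <= Ms j) ->
  (forall n, rsum Ms n <= M) -> Ccvg (fun n => csum (fun j => d j n) n) 0%C.
Proof.
  intros Hp Hd Hb HM e He.
  assert (He' : 0 < rpow (e / 2) p) by (apply rpow_pos; lra).
  destruct (incr_bounded_tail (rsum Ms) M _ HM He') as [J HJ].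
  destruct (Ccvg_csum d (fun _ => 0%C) J (fun j _ => Hd j) (e / 2)) as [N HN]; [lra|].
  exists (N + J)%nat; intros n Hn.
  assert (E : csum (fun j => d j n) n = Cplus (csum (fun j => d j n) J)
              (csum (fun i => d (J + i)%nat n) (n - J))).
  { rewrite <- csum_split. f_equal; lia. }
  rewrite E; clear E. specialize (HN n ltac:(lia)).
  assert (E0 : csum (fun _ => 0%C) J = 0%C).
  { clear; induction J as [|J IH]; simpl; [auto|rewrite IH; ring]. }
  rewrite E0 in HN.
  match goal with |- Cmod (Cminus (Cplus ?x ?y) ?z) <= _ =>
    replace (Cminus (Cplus x y) z) with (Cplus (Cminus x z) y) by ring end.
  eapply Rle_trans; [apply Cmod_triangle|].
  assert (Cmod (csum (fun i => d (J + i)%nat n) (n - J)) <= e / 2); [|lra].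
  apply rpow_le_inv with p; [lra|lra|].
  eapply Rle_trans; [now apply rpow_csum_le|].
  apply Rle_trans with (rsum (fun i => Ms (J + i)%nat) (n - J)); [apply rsum_le; auto|].
  generalize (HJ (J + (n - J))%nat); rewrite rsum_split; lra.
Qed.

Lemma cost_cat p D n : cost p (cat D n) = rsum (fun j => cost p (D j)) n.
Proof. induction n as [|n IH]; simpl; [auto|]. rewrite cost_app, IH; auto. Qed.

Lemma evl_cat D n s1 s2 : evl (cat D n) s1 s2 = csum (fun j => evl (D j) s1 s2) n.
Proof. induction n as [|n IH]; simpl; [auto|]. rewrite evl_app, IH; auto. Qed.

(** Completeness of the algebra: the blocks of all terms are interleaved along squares, so that the
    total cost at each stage is a double partial sum. *)
Lemma inA_series p (fs : nat -> C -> C -> C) (Ms : nat -> R) M F :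
  0 < p <= 1 -> (forall j, inA p (Ms j) (fs j)) -> (forall n, rsum Ms n <= M) ->
  (forall s1 s2, inH s1 -> inH s2 -> Ccvg (csum (fun j => fs j s1 s2)) (F s1 s2)) ->
  inA p M F.
Proof.
  intros Hp Hf HM HF.
  destruct (functional_choice _ Hf) as [D HD].
  (* after block n, exactly the first n blocks of the first n functions have been used *)
  set (E := fun n => cat (fun j => D j n) n ++ cat (D n) (S n)).
  assert (Hc : forall n, cost p (cat E n) = rsum (fun j => cost p (cat (D j) n)) n).
  { induction n as [|n IH]; simpl; [auto|].
    rewrite cost_app, IH. unfold E. rewrite cost_app, cost_cat.
    rewrite (rsum_ext (fun j => cost p (cat (D j) n ++ D j n))
      (fun j => cost p (cat (D j) n) + cost p (D j n)))
      by (intros; apply cost_app).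
    rewrite rsum_plus; simpl; rewrite cost_app; ring. }
  assert (Hev : forall n s1 s2, evl (cat E n) s1 s2 = csum (fun j => evl (cat (D j) n) s1 s2) n).
  { intros n s1 s2; induction n as [|n IH]; simpl; [auto|].
    rewrite evl_app, IH. unfold E. rewrite evl_app, evl_cat.
    rewrite (csum_ext (fun j => evl (cat (D j) n ++ D j n) s1 s2)
      (fun j => Cplus (evl (cat (D j) n) s1 s2) (evl (D j n) s1 s2)))
      by (intros; apply evl_app).
    rewrite csum_plus; simpl; rewrite evl_app; ring. }
  exists E; split.
  - intros n; rewrite Hc. eapply Rle_trans; [|apply (HM n)].
    apply rsum_le; intros j _; apply (HD j).
  - intros s1 s2 H1 H2.
    (* Stage [n] differs from the n-th partial sum of the series by the truncation errors of the
       first [n] terms. Each error tends to 0 and is dominated by [Ms j]. *)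
    assert (H0 : Ccvg (fun n => csum (fun j => Cminus (evl (cat (D j) n) s1 s2) (fs j s1 s2)) n) 0%C).
    { apply (Ccvg_dominated_diagonal p (fun j n => Cminus (evl (cat (D j) n) s1 s2) (fs j s1 s2)) Ms M);
        auto.
      - intros j. destruct (HD j) as [_ Hj].
        assert (Hx := Ccvg_plus _ _ _ _ (Hj s1 s2 H1 H2) (Ccvg_const (Copp (fs j s1 s2)))).
        replace (RtoC 0) with (Cplus (fs j s1 s2) (Copp (fs j s1 s2))) by ring. exact Hx.
      (* Up to sign the error is itself the sum of the tail blocks of [D j], so [inA_sup] bounds
         it. *)
      - intros j n. destruct (HD j) as [Hj1 Hj2].
        rewrite <- Cmod_opp.
        apply (inA_sup p (Ms j) (fun s1 s2 => Copp (Cminus (evl (cat (D j) n) s1 s2) (fs j s1 s2))));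
          auto.
        exists (fun i => D j (n + i)%nat); split.
        + intros k. generalize (Hj1 (n + k)%nat); rewrite cat_shift, cost_app.
          generalize (cost_ge_0 p (cat (D j) n)); lra.
        + intros t1 t2 T1 T2 e He. destruct (Hj2 t1 t2 T1 T2 e He) as [N HN].
          exists N; intros k Hk. specialize (HN (n + k)%nat ltac:(lia)).
          rewrite cat_shift, evl_app in HN.
          match goal with |- Cmod ?x <= _ =>
            replace x with (Cminus (Cplus (evl (cat (D j) n) t1 t2)
              (evl (cat (fun i => D j (n + i)%nat) k) t1 t2)) (fs j t1 t2)) by ring end.
          exact HN. }
    assert (Hx := Ccvg_plus _ _ _ _ H0 (HF s1 s2 H1 H2)).
    replace (F s1 s2) with (Cplus 0%C (F s1 s2)) by ring.
    revert Hx; apply Ccvg_ext; intros n. rewrite Hev, <- csum_plus.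
    apply csum_ext; intros; ring.
Qed.

(** * Coefficients of Dirichlet polynomials *)

(** This is exp(-i t); the sign agrees with m^(-s) at s = i t. *)
Definition cis (t : R) : C := (cos t, - sin t).

Lemma cis_plus a b : cis (a + b) = Cmult (cis a) (cis b).
Proof. unfold cis, Cmult; simpl; rewrite cos_plus, sin_plus; f_equal; ring. Qed.

Lemma cis_0 : cis 0 = 1%C.
Proof. unfold cis; rewrite cos_0, sin_0, Ropp_0; reflexivity. Qed.

Lemma cis_PI : cis PI = Copp 1%C.
Proof.
  unfold cis; rewrite cos_PI, sin_PI. apply injective_projections; simpl; ring.
Qed.

Lemma Cmod_cis t : Cmod (cis t) = 1.
Proof.
  unfold cis, Cmod; simpl.
  replace (cos t * (cos t * 1) + - sin t * (- sin t * 1)) with ((sin t)² + (cos t)²)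
    by (unfold Rsqr; ring).
  rewrite sin2_cos2; apply sqrt_1.
Qed.

Fixpoint trig (L : list (C * (R * R))) (t1 t2 : R) : C :=
  match L with
  | [] => 0%C
  | a :: L' => Cplus (Cmult (fst a) (cis (fst (snd a) * t1 + snd (snd a) * t2))) (trig L' t1 t2)
  end.

(* Averaging with the translate by (h1, h2), where the frequency (a, b) satisfies
   a h1 + b h2 = pi, kills that frequency and does not increase the sup norm. *)
Lemma trig_constant_term_le n : forall (L : list (C * (R * R))) (c0 : C) (B : R),
  length L = n -> (forall x, In x L -> snd x <> (0, 0)) ->
  (forall t1 t2, Cmod (Cplus c0 (trig L t1 t2)) <= B) -> Cmod c0 <= B.
Proof.
  induction n as [|n IH]; intros L c0 B HL Hnz HB.
  - destruct L; [|discriminate]. specialize (HB 0 0). simpl in HB.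
    replace c0 with (Cplus c0 0) by ring. exact HB.
  - destruct L as [|[c [a b]] L]; [discriminate|].
    assert (Hh : exists h1 h2, a * h1 + b * h2 = PI).
    { destruct (Req_dec a 0) as [Ha|Ha].
      - exists 0, (PI / b). field. intros Hb.
        apply (Hnz (c, (a, b))); [now left|]. simpl; congruence.
      - exists (PI / a), 0. field; auto. }
    destruct Hh as [h1 [h2 Hh]].
    set (g := fun x : C * (R * R) =>
      (Cmult (fst x) (Cdiv (Cplus 1 (cis (fst (snd x) * h1 + snd (snd x) * h2))) 2), snd x)).
    assert (Hg : forall L t1 t2, trig (map g L) t1 t2 =
       Cdiv (Cplus (trig L t1 t2) (trig L (t1 + h1) (t2 + h2))) 2).
    { clear; intros L t1 t2; induction L as [|[c [a b]] L IH]; simpl; [field|].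
      rewrite IH.
      replace (a * (t1 + h1) + b * (t2 + h2)) with ((a * t1 + b * t2) + (a * h1 + b * h2)) by ring.
      rewrite (cis_plus (a * t1 + b * t2)). field. }
    (* The head term has been averaged to zero, so only the images of the tail remain and the length
       drops by one. *)
    apply (IH (map g L) c0 B).
    + rewrite length_map; simpl in HL; lia.
    + intros x Hx. apply in_map_iff in Hx. destruct Hx as [y [<- Hy]]. simpl.
      apply Hnz; now right.
    + intros t1 t2. rewrite Hg.
      generalize (HB t1 t2) (HB (t1 + h1) (t2 + h2)); simpl.
      replace (a * (t1 + h1) + b * (t2 + h2)) with ((a * t1 + b * t2) + PI) by (rewrite <- Hh; ring).
      rewrite (cis_plus _ PI), cis_PI. set (e := cis (a * t1 + b * t2)).
      intros B1 B2.
      match goal with |- Cmod ?x <= _ => replace x with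
        (Cmult (RtoC (/ 2)) (Cplus (Cplus c0 (Cplus (Cmult c e) (trig L t1 t2)))
          (Cplus c0 (Cplus (Cmult c (Cmult e (Copp 1))) (trig L (t1 + h1) (t2 + h2)))))) end.
      2:{ rewrite RtoC_inv by lra. field. }
      rewrite Cmod_mult, Cmod_R, Rabs_right by lra.
      generalize (Cmod_triangle (Cplus c0 (Cplus (Cmult c e) (trig L t1 t2)))
          (Cplus c0 (Cplus (Cmult c (Cmult e (Copp 1))) (trig L (t1 + h1) (t2 + h2))))).
      lra.
Qed.

Fixpoint coef (L : list atom) (y : pidx) : C :=
  match L with
  | [] => 0%C
  | a :: L' => Cplus (if pidx_eq_dec (snd a) y then fst a else 0%C) (coef L' y)
  end.

Definition plog (m : positive) : R := ln (INR (pnat m)).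

Lemma chi_imag x t1 t2 :
  chi x (0, t1) (0, t2) = cis (plog (fst x) * t1 + plog (snd x) * t2).
Proof.
  rewrite cis_plus. unfold chi, npow_neg, cis, plog; simpl.
  rewrite Ropp_0, !Rmult_0_l, exp_0, !Rmult_1_l, (Rmult_comm t1), (Rmult_comm t2). reflexivity.
Qed.

(** On the imaginary axes, multiplication by the conjugate of the character of [y] makes [coef L y]
    the constant term of a trigonometric polynomial. Its other frequencies are nonzero because the
    logarithm is injective. *)
Lemma coef_le_sup L y B :
  (forall s1 s2, inH s1 -> inH s2 -> Cmod (evl L s1 s2) <= B) -> Cmod (coef L y) <= B.
Proof.
  intros HB.
  set (T := map (fun a : atom => (fst a, (plog (fst (snd a)) - plog (fst y),
                                      plog (snd (snd a)) - plog (snd y))))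
               (filter (fun a => if pidx_eq_dec (snd a) y then false else true) L)).
  apply (trig_constant_term_le (length T) T); auto.
  - intros x Hx. unfold T in Hx. apply in_map_iff in Hx. destruct Hx as [a [<- Ha]].
    apply filter_In in Ha. destruct Ha as [_ Ha]. simpl.
    destruct (pidx_eq_dec (snd a) y) as [|Hne]; [discriminate|].
    intros [= E1 E2]. apply Hne. destruct (snd a) as [m n], y as [m' n']; simpl in *.
    f_equal; apply ln_pnat_inj; unfold plog in *; lra.
  - intros t1 t2.
    assert (E : Cplus (coef L y) (trig T t1 t2) =
       Cmult (evl L (0, t1) (0, t2)) (cis (- (plog (fst y) * t1 + plog (snd y) * t2)))).
    { subst T; clear HB; induction L as [|a L IH]; simpl; [ring|].
      rewrite Cmult_plus_distr_r, <- IH, chi_imag, <- Cmult_assoc, <- cis_plus; clear IH.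
      destruct (pidx_eq_dec (snd a) y) as [->|Hne]; simpl.
      - rewrite Rplus_opp_r, cis_0; ring.
      - match goal with |- Cplus (Cplus _ _) (Cplus (Cmult _ ?u) _) = Cplus (Cmult _ ?v) _ =>
          replace u with v by (f_equal; ring) end. ring. }
    rewrite E, Cmod_mult, Cmod_cis, Rmult_1_r. apply HB; unfold inH; simpl; lra.
Qed.

Definition collect (L : list atom) (X : list pidx) : list atom :=
  map (fun x => (coef L x, x)) X.

(** Adding one atom to [L] changes the collected list at a single index, which [X] contains exactly
    once. *)
Lemma evl_collect L X s1 s2 : NoDup X -> (forall a, In a L -> In (snd a) X) ->
  evl (collect L X) s1 s2 = evl L s1 s2.
Proof.
  intros HX; unfold collect; induction L as [|a L IH]; intros HL; simpl.
  - clear; induction X as [|x X IH]; simpl; [auto|]. rewrite IH; ring.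
  - rewrite <- IH by (intros; apply HL; now right). clear IH.
    assert (Ha : In (snd a) X) by (apply HL; now left). clear HL.
    assert (Hno : forall Y, ~ In (snd a) Y ->
      evl (map (fun x => (Cplus (if pidx_eq_dec (snd a) x then fst a else 0%C) (coef L x), x)) Y) s1 s2
      = evl (map (fun x => (coef L x, x)) Y) s1 s2).
    { induction Y as [|x Y IH]; intros HY; simpl; [auto|].
      destruct (pidx_eq_dec (snd a) x) as [E|E]; [exfalso; apply HY; left; congruence|].
      rewrite IH by (intros H; apply HY; now right). ring. }
    induction X as [|x X IH]; simpl; [destruct Ha|].
    inversion HX as [|? ? Hx HX']; subst.
    destruct (pidx_eq_dec (snd a) x) as [E|E].
    + rewrite Hno by now rewrite E. rewrite E; ring.
    + destruct Ha as [Ha|Ha]; [congruence|]. rewrite IH by auto. ring.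
Qed.

Lemma cost_collect_le p L X b : (forall x, rpow (Cmod (coef L x)) p <= b) ->
  cost p (collect L X) <= INR (length X) * b.
Proof.
  intros H; induction X as [|x X IH]; [simpl; lra|].
  change (length (x :: X)) with (S (length X)); rewrite S_INR; simpl.
  specialize (H x); lra.
Qed.

(** * Powers of a Dirichlet polynomial, and the spectral radius *)

Fixpoint pidx_pow (x : pidx) (e : nat) : pidx :=
  match e with O => (1, 1)%positive | S e' => pidx_mul x (pidx_pow x e') end.

Lemma pidx_mul_assoc x y z : pidx_mul x (pidx_mul y z) = pidx_mul (pidx_mul x y) z.
Proof. unfold pidx_mul; simpl; f_equal; apply Pos.mul_assoc. Qed.

Lemma pidx_mul_comm x y : pidx_mul x y = pidx_mul y x.
Proof. unfold pidx_mul; f_equal; apply Pos.mul_comm. Qed.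

(** Every exponent is bounded by [j] separately. The list contains all products of [j] elements of
    [X], and its length (j + 1)^|X| is polynomial in [j] for fixed [X], which is all that the
    spectral radius requires. *)
Fixpoint monomials (j : nat) (X : list pidx) : list pidx :=
  match X with
  | [] => [(1, 1)%positive]
  | x :: X' => flat_map (fun e => map (pidx_mul (pidx_pow x e)) (monomials j X')) (seq 0 (S j))
  end.

Lemma length_monomials j X : length (monomials j X) = (S j ^ length X)%nat.
Proof.
  induction X as [|x X IH]; [reflexivity|].
  cbn [monomials length Nat.pow].
  rewrite (flat_map_constant_length (c := (S j ^ length X)%nat)).
  - now rewrite length_seq.
  - intros e _. now rewrite length_map.
Qed.

Lemma In_monomials_cons j x X y :
  In y (monomials j (x :: X)) <->
  exists e z, (e <= j)%nat /\ In z (monomials j X) /\ y = pidx_mul (pidx_pow x e) z.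
Proof.
  cbn [monomials]. rewrite in_flat_map. split.
  - intros [e [He Hy]]. apply in_seq in He. apply in_map_iff in Hy.
    destruct Hy as [z [<- Hz]]. exists e, z; repeat split; auto; lia.
  - intros [e [z [He [Hz ->]]]]. exists e; split; [apply in_seq; lia|]. now apply in_map.
Qed.

Lemma monomials_succ j X y : In y (monomials j X) -> In y (monomials (S j) X).
Proof.
  revert y; induction X as [|x X IH]; intros y; [auto|].
  rewrite !In_monomials_cons. intros [e [z [He [Hz ->]]]]. exists e, z; repeat split; auto; lia.
Qed.

Lemma monomials_mul j X x y : In x X -> In y (monomials j X) -> In (pidx_mul x y) (monomials (S j) X).
Proof.
  revert y; induction X as [|x' X IH]; intros y Hx Hy; [destruct Hx|].
  rewrite In_monomials_cons in *. destruct Hy as [e [z [He [Hz ->]]]].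
  destruct Hx as [->|Hx].
  - exists (S e), z; split; [lia|split; [now apply monomials_succ|]].
    simpl. apply pidx_mul_assoc.
  - exists e, (pidx_mul x z); split; [lia|split; [now apply IH|]].
    rewrite !pidx_mul_assoc. f_equal. apply pidx_mul_comm.
Qed.

Lemma monomials_one j X : In (1, 1)%positive (monomials j X).
Proof.
  induction X as [|x X IH]; [now left|]. apply In_monomials_cons.
  exists 0%nat, (1, 1)%positive; repeat split; auto; lia.
Qed.

Fixpoint lpow (L : list atom) (j : nat) : list atom :=
  match j with O => [(RtoC 1, (1, 1)%positive)] | S j' => lmul L (lpow L j') end.

Lemma evl_lpow L j s1 s2 : evl (lpow L j) s1 s2 = Cpow (evl L s1 s2) j.
Proof.
  induction j as [|j IH]; simpl; [rewrite chi_1; ring|]. rewrite evl_lmul, IH; ring.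
Qed.

Lemma lpow_monomials L j a : In a (lpow L j) -> In (snd a) (monomials j (map snd L)).
Proof.
  revert a; induction j as [|j IH]; intros a Ha.
  - destruct Ha as [<-|[]]. apply monomials_one.
  - cbn [lpow] in Ha. unfold lmul in Ha. apply in_flat_map in Ha.
    destruct Ha as [x [Hx Ha]]. apply in_map_iff in Ha. destruct Ha as [y [<- Hy]]. simpl.
    apply monomials_mul; [now apply in_map|now apply IH].
Qed.

Lemma rpow_inv_r b p : 0 < p -> 0 <= b -> rpow (rpow b (/ p)) p = b.
Proof.
  intros Hp Hb. destruct (Req_dec b 0) as [->|Hb0]; [now rewrite !rpow_0|].
  unfold rpow at 2. destruct (Rle_dec b 0); [lra|].
  unfold rpow. destruct (Rle_dec (Rpower b (/ p)) 0) as [H|H].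
  - generalize (exp_pos (/ p * ln b)); unfold Rpower in H; lra.
  - rewrite Rpower_mult, Rinv_l, Rpower_1; lra.
Qed.

Lemma INR_pow_nat m n : INR (m ^ n) = INR m ^ n.
Proof. induction n as [|n IH]; [reflexivity|]. cbn [Nat.pow]. rewrite mult_INR, IH; reflexivity. Qed.

(* The coefficients of P^j are bounded by sup |P|^j, and P^j has at most (j + 1)^N monomials. *)
Lemma inA_poly_pow p L b : 0 < p <= 1 -> 0 <= b ->
  (forall s1 s2, inH s1 -> inH s2 -> rpow (Cmod (evl L s1 s2)) p <= b) ->
  forall j, inA p (INR (S j) ^ length L * b ^ j) (fun s1 s2 => Cpow (evl L s1 s2) j).
Proof.
  intros Hp Hb H j.
  set (X := nodup pidx_eq_dec (monomials j (map snd L))).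
  apply inA_ext with (evl (collect (lpow L j) X)).
  { intros s1 s2 _ _. rewrite evl_collect, evl_lpow; auto; [apply NoDup_nodup|].
    intros a Ha. apply nodup_In. now apply lpow_monomials. }
  eapply inA_weaken; [|apply inA_evl].
  eapply Rle_trans; [apply (cost_collect_le p _ _ (b ^ j))|].
  (* [b ^ j] is written as the p-th power of its p-th root, since [coef_le_sup] compares moduli and
     not their p-th powers. *)
  - intros x. rewrite <- (rpow_inv_r (b ^ j) p) by (try lra; now apply pow_le).
    apply rpow_le; [lra|]. apply coef_le_sup. intros s1 s2 H1 H2.
    apply rpow_le_inv with p; [lra|apply rpow_ge_0|].
    rewrite rpow_inv_r by (try lra; now apply pow_le).
    rewrite evl_lpow, Cmod_pow, rpow_pow by apply Cmod_ge_0.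
    apply pow_incr; split; [apply rpow_ge_0|auto].
  - apply Rmult_le_compat_r; [now apply pow_le|].
    rewrite <- INR_pow_nat. apply le_INR.
    replace (length L) with (length (map snd L)) by apply length_map. rewrite <- length_monomials.
    apply NoDup_incl_length; [apply NoDup_nodup|]. intros x Hx; now apply nodup_In in Hx.
Qed.

(** By induction, [N] factors j + 1 are absorbed between [x] and the midpoint [z], and the last one
    between [z] and [y]. *)
Lemma poly_mul_geom_le N : forall x y, 0 <= x < y ->
  exists K, 0 <= K /\ forall j, INR (S j) ^ N * x ^ j <= K * y ^ j.
Proof.
  induction N as [|N IH]; intros x y Hxy.
  - exists 1; split; [lra|]; intros j; simpl (_ ^ 0).
    generalize (pow_incr x y j ltac:(lra)); lra.
  - set (z := (x + y) / 2). destruct (IH x z) as [K [HK H]]; [unfold z; lra|].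
    set (q := y / z).
    assert (Hz : 0 < z) by (unfold z; lra).
    assert (Hq : 1 < q).
    { unfold q; apply (Rmult_lt_reg_r z); [lra|]. unfold Rdiv.
      rewrite Rmult_assoc, Rinv_l by lra. unfold z; lra. }
    (* Bernoulli gives q^j >= 1 + j (q - 1), which is at least m (j + 1) as soon as m <= 1 and m <=
       q - 1. *)
    set (m := Rmin 1 (q - 1)).
    assert (Hm : 0 < m) by (apply Rmin_pos; lra).
    exists (K / m); split; [apply Rdiv_le_0_compat; lra|]. intros j.
    assert (Hj : m * INR (S j) <= q ^ j).
    { generalize (poly j (q - 1) ltac:(lra)); replace (1 + (q - 1)) with q by ring.
      rewrite S_INR. generalize (Rmin_l 1 (q - 1)) (Rmin_r 1 (q - 1)) (pos_INR j).
      fold m. nra. }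
    replace (y ^ j) with (q ^ j * z ^ j) by (rewrite <- Rpow_mult_distr; f_equal; unfold q; field; lra).
    apply Rle_trans with (INR (S j) * (K * z ^ j)).
    { change (INR (S j) ^ S N) with (INR (S j) * INR (S j) ^ N).
      rewrite Rmult_assoc. apply Rmult_le_compat_l; [apply pos_INR|auto]. }
    replace (INR (S j) * (K * z ^ j)) with (K / m * (m * INR (S j) * z ^ j)) by (field; lra).
    apply Rmult_le_compat_l; [apply Rdiv_le_0_compat; lra|].
    apply Rmult_le_compat_r; [apply pow_le; lra|auto].
Qed.

(* Spectral radius formula.  With f = P + h and h small, f^(k+1) P^j = f^k P^(j+1) + h f^k P^j. *)
Lemma inA_spectral_radius p M f b r : 0 < p <= 1 -> inA p M f -> 0 <= b < r ->
  (forall s1 s2, inH s1 -> inH s2 -> rpow (Cmod (f s1 s2)) p <= b) ->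
  exists K, 0 <= K /\ forall k, inA p (K * r ^ k) (fun s1 s2 => Cpow (f s1 s2) k).
Proof.
  intros Hp Hf Hbr Hb.
  (* The gap from [b] to [r] is cut into four: one [e] for replacing f by [P], one to absorb the
     polynomial factor, one for the remainder f - P, and one as slack. *)
  set (e := (r - b) / 4). assert (He : 0 < e) by (unfold e; lra).
  destruct (inA_approx p M f e Hf He) as [P HP].
  assert (HPb : forall s1 s2, inH s1 -> inH s2 -> rpow (Cmod (evl P s1 s2)) p <= b + e).
  { intros s1 s2 H1 H2.
    replace (evl P s1 s2) with (Cplus (f s1 s2) (Copp (Cminus (f s1 s2) (evl P s1 s2)))) by ring.
    eapply Rle_trans; [apply rpow_le; [lra|apply Cmod_triangle]|]. rewrite Cmod_opp.
    eapply Rle_trans; [apply rpow_plus_le; auto using Cmod_ge_0|].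
    apply Rplus_le_compat; [auto|].
    apply (inA_sup p e (fun s1 s2 => Cminus (f s1 s2) (evl P s1 s2))); auto. }
  destruct (poly_mul_geom_le (length P) (b + e) (b + 2 * e)) as [K [HK HKj]]; [lra|].
  set (q := b + 2 * e) in *.
  (* The induction on [k] needs all [j] at once, because lowering [k] by one may raise [j] by
     one. *)
  assert (Hmain : forall k j, inA p (K * q ^ j * (q + e) ^ k)
     (fun s1 s2 => Cmult (Cpow (f s1 s2) k) (Cpow (evl P s1 s2) j))).
  { induction k as [|k IH]; intros j.
    - apply inA_ext with (fun s1 s2 => Cpow (evl P s1 s2) j); [intros; simpl; ring|].
      eapply inA_weaken; [|apply inA_poly_pow with (b := b + e); auto; lra].
      simpl. rewrite Rmult_1_r. apply HKj.
    - assert (Hx := inA_plus _ _ _ _ _ (IH (S j)) (inA_mult _ _ _ _ _ HP (IH j))).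
      revert Hx. intros Hx. eapply inA_weaken; [|eapply inA_ext; [|exact Hx]].
      + simpl; right; ring.
      + intros; simpl; ring. }
  exists K; split; auto. intros k.
  eapply inA_weaken; [|eapply inA_ext; [|apply (Hmain k 0%nat)]].
  - simpl. rewrite Rmult_1_r. apply Rmult_le_compat_l; auto. apply pow_incr; unfold q, e; lra.
  - intros; simpl; ring.
Qed.

Lemma rsum_geom_le x n : 0 <= x < 1 -> rsum (fun j => x ^ j) n <= / (1 - x).
Proof.
  intros Hx. assert (E : (1 - x) * rsum (fun j => x ^ j) n = 1 - x ^ n).
  { induction n as [|n IH]; simpl; [ring|]. rewrite Rmult_plus_distr_l, IH; ring. }
  apply (Rmult_le_reg_l (1 - x)); [lra|]. rewrite E, Rinv_r by lra.
  generalize (pow_le x n ltac:(lra)); lra.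
Qed.

(** By the spectral radius bound the j-th term costs at most A t^j K (b + d)^j, a convergent
    geometric series once t (b + d) < 1. *)
Lemma inA_power_series p M h (al : nat -> C) F A t b :
  0 < p <= 1 -> inA p M h -> 0 <= t -> 0 <= b -> t * b < 1 ->
  (forall s1 s2, inH s1 -> inH s2 -> rpow (Cmod (h s1 s2)) p <= b) ->
  (forall j, rpow (Cmod (al j)) p <= A * t ^ j) ->
  (forall s1 s2, inH s1 -> inH s2 ->
     Ccvg (csum (fun j => Cmult (al j) (Cpow (h s1 s2) j))) (F s1 s2)) ->
  exists M', inA p M' F.
Proof.
  intros Hp Hh Ht Hb Htb Hhb Hal HF.
  (* Chosen so that t d <= (1 - t b) / 2; the denominator contains t + 1 to allow t = 0. *)
  set (d := (1 - t * b) / (2 * (t + 1))).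
  assert (Hd : 0 < d) by (apply Rdiv_lt_0_compat; lra).
  assert (Htd : t * d < 1 - t * b).
  { apply Rlt_trans with ((t + 1) * d); [nra|]. unfold d.
    replace ((t + 1) * ((1 - t * b) / (2 * (t + 1)))) with ((1 - t * b) / 2) by (field; lra). lra. }
  destruct (inA_spectral_radius p M h b (b + d)) as [K [HK Hk]]; auto; [lra|].
  assert (HA : 0 <= A) by (generalize (Hal 0%nat) (rpow_ge_0 (Cmod (al 0%nat)) p); simpl; lra).
  exists (A * K * / (1 - t * (b + d))).
  apply inA_series with (fs := fun j s1 s2 => Cmult (al j) (Cpow (h s1 s2) j))
     (Ms := fun j => A * K * (t * (b + d)) ^ j); auto.
  - intros j. eapply inA_weaken; [|apply inA_scal, Hk].
    rewrite Rpow_mult_distr.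
    replace (A * K * (t ^ j * (b + d) ^ j)) with ((A * t ^ j) * (K * (b + d) ^ j)) by ring.
    apply Rmult_le_compat_r; auto. apply Rmult_le_pos; auto. apply pow_le; lra.
  - intros n. rewrite rsum_scal. apply Rmult_le_compat_l; [now apply Rmult_le_pos|].
    apply rsum_geom_le. split; [apply Rmult_le_pos; lra|]. rewrite Rmult_plus_distr_l; lra.
Qed.

(** * Membership in the algebra, and the Neumann series *)

Definition memA (p : R) (f : C -> C -> C) : Prop := exists M, inA p M f.

Lemma memA_ext p f g : (forall s1 s2, inH s1 -> inH s2 -> f s1 s2 = g s1 s2) ->
  memA p f -> memA p g.
Proof. intros H [M HM]; exists M; eapply inA_ext; eauto. Qed.

Lemma memA_const p c : memA p (fun _ _ => c).
Proof. eexists; apply inA_const. Qed.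

Lemma memA_plus p f g : memA p f -> memA p g -> memA p (fun s1 s2 => Cplus (f s1 s2) (g s1 s2)).
Proof. intros [M H] [M' H']; eexists; eapply inA_plus; eauto. Qed.

Lemma memA_mult p f g : memA p f -> memA p g -> memA p (fun s1 s2 => Cmult (f s1 s2) (g s1 s2)).
Proof. intros [M H] [M' H']; eexists; eapply inA_mult; eauto. Qed.

Lemma memA_scal p c f : memA p f -> memA p (fun s1 s2 => Cmult c (f s1 s2)).
Proof. intros [M H]; eexists; eapply inA_scal; eauto. Qed.

Lemma memA_minus p f g : memA p f -> memA p g -> memA p (fun s1 s2 => Cminus (f s1 s2) (g s1 s2)).
Proof.
  intros H H'.
  apply memA_ext with (fun s1 s2 => Cplus (f s1 s2) (Cmult (Copp 1%C) (g s1 s2)));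
    [intros; ring|]. apply memA_plus; [|apply memA_scal]; auto.
Qed.

Lemma memA_csum p (fs : nat -> C -> C -> C) n : (forall j, (j < n)%nat -> memA p (fs j)) ->
  memA p (fun s1 s2 => csum (fun j => fs j s1 s2) n).
Proof.
  induction n as [|n IH]; intros H; simpl; [apply memA_const|].
  apply (memA_plus p (fun s1 s2 => csum (fun j => fs j s1 s2) n) (fs n)); auto.
Qed.

Lemma Ccvg_pow_0 h : Cmod h < 1 -> Ccvg (Cpow h) 0%C.
Proof.
  intros Hh e He.
  destruct (pow_lt_1_zero (Cmod h)) with (y := e) as [N HN]; auto.
  { rewrite Rabs_right; auto. apply Rle_ge, Cmod_ge_0. }
  exists N; intros n Hn. replace (Cminus (Cpow h n) 0) with (Cpow h n) by ring.
  rewrite Cmod_pow. specialize (HN n Hn). apply Rabs_def2 in HN. lra.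
Qed.

Lemma C1_minus_neq_0 h : Cmod h < 1 -> Cminus 1%C h <> 0%C.
Proof.
  intros Hh E. assert (h = 1%C) by (replace h with (Cminus 1 (Cminus 1 h)) by ring; rewrite E; ring).
  subst; rewrite Cmod_1 in Hh; lra.
Qed.

Lemma csum_geom h n : Cmult (Cminus 1%C h) (csum (Cpow h) n) = Cminus 1%C (Cpow h n).
Proof. induction n as [|n IH]; simpl; [ring|]. rewrite Cmult_plus_distr_l, IH; ring. Qed.

Lemma Ccvg_geom h : Cmod h < 1 -> Ccvg (csum (Cpow h)) (Cinv (Cminus 1%C h)).
Proof.
  intros Hh. generalize (C1_minus_neq_0 h Hh); intros Hn.
  assert (H := Ccvg_plus _ _ _ _ (Ccvg_const (Cinv (Cminus 1 h)))
                (Ccvg_scal (Copp (Cinv (Cminus 1 h))) _ _ (Ccvg_pow_0 h Hh))).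
  replace (Cplus (Cinv (Cminus 1 h)) _) with (Cinv (Cminus 1 h)) in H by ring.
  revert H; apply Ccvg_ext; intros n.
  replace (csum (Cpow h) n) with (Cmult (Cinv (Cminus 1 h)) (Cmult (Cminus 1 h) (csum (Cpow h) n))).
  - rewrite csum_geom; ring.
  - field; auto.
Qed.

Lemma Cmod_pos_neq_0 z k : 0 < k -> k <= Cmod z -> z <> 0%C.
Proof. intros Hk H ->; rewrite Cmod_0 in H; lra. Qed.

(** Here g' = g (1 - h) with h = (g - g') / g and |h| <= 1/2 on H^2. As [h] is small only in the sup
    norm, convergence of the Neumann series of 1 / (1 - h) in the algebra rests on the spectral
    radius bound. *)
Lemma memA_inv_step p k g g' : 0 < p <= 1 -> 0 < k ->
  memA p g -> memA p g' -> memA p (fun s1 s2 => Cinv (g s1 s2)) ->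
  (forall s1 s2, inH s1 -> inH s2 -> k <= Cmod (g s1 s2)) ->
  (forall s1 s2, inH s1 -> inH s2 -> Cmod (Cminus (g s1 s2) (g' s1 s2)) <= k / 2) ->
  memA p (fun s1 s2 => Cinv (g' s1 s2)).
Proof.
  intros Hp Hk Hg Hg' Hinv Hb Hd.
  set (h := fun s1 s2 => Cmult (Cinv (g s1 s2)) (Cminus (g s1 s2) (g' s1 s2))).
  assert (Hh : memA p h) by (apply memA_mult; auto; apply memA_minus; auto).
  assert (Hhb : forall s1 s2, inH s1 -> inH s2 -> Cmod (h s1 s2) <= 1 / 2).
  { intros s1 s2 H1 H2; unfold h. rewrite Cmod_mult, Cmod_inv.
    - specialize (Hb s1 s2 H1 H2); specialize (Hd s1 s2 H1 H2).
      apply (Rmult_le_reg_l (Cmod (g s1 s2))); [lra|].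
      rewrite <- Rmult_assoc, Rinv_r by lra. lra.
    - apply Cmod_pos_neq_0 with k; auto. }
  assert (Hs : memA p (fun s1 s2 => Cinv (Cminus 1 (h s1 s2)))).
  { destruct Hh as [M Hh].
    apply (inA_power_series p M h (fun _ => 1%C) _ 1 1 (rpow (1 / 2) p)); auto; try lra.
    - apply rpow_ge_0.
    - rewrite Rmult_1_l. apply Rlt_le_trans with (rpow 1 p); [apply rpow_lt; lra|rewrite rpow_1; lra].
    - intros; apply rpow_le; auto; lra.
    - intros j. rewrite Cmod_1, rpow_1, pow1; lra.
    - intros s1 s2 H1 H2. specialize (Hhb s1 s2 H1 H2).
      eapply Ccvg_ext; [|apply Ccvg_geom; lra].
      intros n; apply csum_ext; intros; ring. }
  eapply memA_ext; [|exact (memA_mult _ _ _ Hinv Hs)].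
  intros s1 s2 H1 H2; cbv beta.
  specialize (Hhb s1 s2 H1 H2). specialize (Hb s1 s2 H1 H2).
  assert (Hn := C1_minus_neq_0 (h s1 s2) ltac:(lra)).
  assert (Hg0 : g s1 s2 <> 0%C) by (apply Cmod_pos_neq_0 with k; auto).
  assert (E : g' s1 s2 = Cmult (g s1 s2) (Cminus 1 (h s1 s2))) by (unfold h; field; auto).
  rewrite E. field; auto.
Qed.

(** * Inverses *)

Lemma chi_real x tau : chi x (RtoC tau) (RtoC tau) = RtoC (exp (- (tau * (plog (fst x) + plog (snd x))))).
Proof.
  unfold chi, npow_neg, RtoC, Cmult, plog; simpl.
  rewrite !Rmult_0_l, cos_0, sin_0, !Rmult_0_r, !Rmult_1_r.
  rewrite <- exp_plus. apply injective_projections; simpl; [|ring].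
  ring_simplify. f_equal; ring.
Qed.

Lemma plog_ge_0 m : 0 <= plog m.
Proof. apply ln_pnat_ge_0. Qed.

Lemma plog_sum_pos (x : pidx) : x <> (1, 1)%positive -> 0 < plog (fst x) + plog (snd x).
Proof.
  intros Hx. generalize (plog_ge_0 (fst x)) (plog_ge_0 (snd x)); intros H1 H2.
  apply Rnot_le_lt; intros H. apply Hx.
  assert (E1 : plog 1 = 0) by (unfold plog, pnat; simpl; apply ln_1).
  destruct x as [m n]; simpl in *.
  f_equal; apply ln_pnat_inj; unfold plog in *; lra.
Qed.

(** In these variables this is a translation; it damps the coefficient at (m, n) by the factor (m
    n)^(-tau). *)
Definition dilate (tau : R) (f : C -> C -> C) : C -> C -> C :=
  fun s1 s2 => f (Cplus s1 (RtoC tau)) (Cplus s2 (RtoC tau)).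

Lemma inH_plus s tau : inH s -> 0 <= tau -> inH (Cplus s (RtoC tau)).
Proof. unfold inH; simpl; lra. Qed.

Definition ldilate (tau : R) (L : list atom) : list atom :=
  map (fun a => (Cmult (fst a) (chi (snd a) (RtoC tau) (RtoC tau)), snd a)) L.

Lemma evl_ldilate tau L s1 s2 : evl (ldilate tau L) s1 s2 = dilate tau (evl L) s1 s2.
Proof.
  unfold ldilate, dilate; induction L as [|a L IH]; simpl; [auto|].
  rewrite IH, chi_plus; ring.
Qed.

Lemma cost_ldilate p tau L : 0 < p -> 0 <= tau -> cost p (ldilate tau L) <= cost p L.
Proof.
  intros Hp Ht; unfold ldilate; induction L as [|a L IH]; simpl; [lra|].
  apply Rplus_le_compat; auto. apply rpow_le; [lra|]. rewrite Cmod_mult.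
  assert (Cmod (chi (snd a) tau tau) <= 1) by (apply Cmod_chi_le_1; unfold inH; simpl; lra).
  generalize (Cmod_ge_0 (fst a)); nra.
Qed.

Lemma memA_dilate p tau f : 0 < p -> 0 <= tau -> memA p f -> memA p (dilate tau f).
Proof.
  intros Hp Ht [M [D [H1 H2]]]. exists M, (fun n => ldilate tau (D n)).
  assert (E : forall n, cat (fun n => ldilate tau (D n)) n = ldilate tau (cat D n)).
  { induction n as [|n IH]; simpl; [auto|]. rewrite IH. symmetry; apply map_app. }
  split.
  - intros n; rewrite E. eapply Rle_trans; [apply cost_ldilate; auto|auto].
  - intros s1 s2 S1 S2. eapply Ccvg_ext; [|apply H2; apply inH_plus; eauto].
    intros n; rewrite E, evl_ldilate; reflexivity.
Qed.

Lemma exp_neg_lipschitz a b : 0 <= a -> 0 <= b -> Rabs (exp (- a) - exp (- b)) <= Rabs (a - b).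
Proof.
  assert (W : forall a b, 0 <= a -> a <= b -> Rabs (exp (- a) - exp (- b)) <= Rabs (a - b)).
  { clear; intros a b Ha Hab.
    assert (exp (- b) <= exp (- a)).
    { destruct Hab as [Hab| ->]; [left; apply exp_increasing; lra|lra]. }
    rewrite Rabs_right by lra. rewrite Rabs_left1 by lra.
    replace (- b) with (- a + (a - b)) by ring. rewrite exp_plus.
    generalize (exp_ineq1_le (a - b)) (exp_pos (- a)) (exp_le_1 (- a) ltac:(lra)); nra. }
  intros Ha Hb. destruct (Rle_dec a b); [now apply W|].
  rewrite Rabs_minus_sym, (Rabs_minus_sym a). apply W; lra.
Qed.

(** The constant is the sum of |c| log(m n) over the atoms: [exp] is 1-Lipschitz on the negative
    half-line, and characters have modulus at most 1. *)
Lemma evl_dilate_lipschitz L : exists K, 0 <= K /\ forall tau tau' s1 s2,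
  0 <= tau -> 0 <= tau' -> inH s1 -> inH s2 ->
  Cmod (Cminus (dilate tau (evl L) s1 s2) (dilate tau' (evl L) s1 s2)) <= K * Rabs (tau - tau').
Proof.
  unfold dilate; induction L as [|a L [K [HK IH]]].
  - exists 0; split; [lra|]; intros; simpl.
    replace (Cminus 0 0) with (RtoC 0) by ring. rewrite Cmod_0; lra.
  - set (w := plog (fst (snd a)) + plog (snd (snd a))).
    assert (Hw : 0 <= w) by (generalize (plog_ge_0 (fst (snd a))) (plog_ge_0 (snd (snd a))); unfold w; lra).
    exists (Cmod (fst a) * w + K); split.
    { generalize (Cmod_ge_0 (fst a)); nra. }
    intros tau tau' s1 s2 Ht Ht' H1 H2; simpl.
    rewrite !chi_plus, !chi_real. fold w.
    set (u := evl L (s1 + tau) (s2 + tau)). set (v := evl L (s1 + tau') (s2 + tau')).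
    replace (Cminus _ _) with (Cplus (Cmult (fst a) (Cmult (chi (snd a) s1 s2)
       (RtoC (exp (- (tau * w)) - exp (- (tau' * w)))))) (Cminus u v))
      by (rewrite RtoC_minus; ring).
    eapply Rle_trans; [apply Cmod_triangle|].
    rewrite Rmult_plus_distr_r. apply Rplus_le_compat; [|now apply IH].
    rewrite !Cmod_mult, Cmod_R, Rmult_assoc.
    apply Rmult_le_compat_l; [apply Cmod_ge_0|].
    apply Rle_trans with (1 * Rabs (tau * w - tau' * w)).
    + apply Rmult_le_compat; auto using Cmod_ge_0, Rabs_pos, Cmod_chi_le_1.
      apply exp_neg_lipschitz; nra.
    + rewrite <- Rmult_minus_distr_r, Rabs_mult, (Rabs_right w) by lra. lra.
Qed.

(** The limit is the total coefficient at (1, 1); at every other index log(m n) is positive, so the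
    atom decays, uniformly on H^2. *)
Lemma evl_dilate_limit L : exists al, forall eta, 0 < eta -> exists T0, 0 <= T0 /\
  forall T s1 s2, T0 <= T -> inH s1 -> inH s2 -> Cmod (Cminus (dilate T (evl L) s1 s2) al) <= eta.
Proof.
  unfold dilate; induction L as [|a L [al IH]].
  - exists 0%C; intros eta He; exists 0; split; [lra|]; intros; simpl.
    replace (Cminus 0 0) with (RtoC 0) by ring. rewrite Cmod_0; lra.
  - destruct (pidx_eq_dec (snd a) (1, 1)%positive) as [E|E].
    + exists (Cplus (fst a) al); intros eta He. destruct (IH eta He) as [T0 [HT0 HT]].
      exists T0; split; auto; intros T s1 s2 H H1 H2; simpl. rewrite E, chi_1.
      match goal with |- Cmod ?x <= _ => replace x with
        (Cminus (evl L (Cplus s1 (RtoC T)) (Cplus s2 (RtoC T))) al) by ring end. auto.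
    + exists al; intros eta He. destruct (IH (eta / 2)) as [T0 [HT0 HT]]; [lra|].
      generalize (plog_sum_pos _ E); set (w := plog (fst (snd a)) + plog (snd (snd a))); intros Hw.
      generalize (Cmod_ge_0 (fst a)); intros Hc.
      (* Since exp(T w) >= T w, this makes |c| exp(-T w) at most eta / 2 for T >= T1. *)
      set (T1 := Cmod (fst a) / (eta / 2 * w)).
      assert (HT1 : 0 <= T1) by (apply Rdiv_le_0_compat; [lra|apply Rmult_lt_0_compat; lra]).
      exists (T0 + T1); split; [lra|]. intros T s1 s2 HTT H1 H2; simpl.
      rewrite chi_plus, chi_real; fold w.
      match goal with |- Cmod (Cminus (Cplus ?x ?y) ?z) <= _ =>
        replace (Cminus (Cplus x y) z) with (Cplus x (Cminus y z)) by ring end.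
      eapply Rle_trans; [apply Cmod_triangle|].
      assert (B2 := HT T s1 s2 ltac:(lra) H1 H2).
      match goal with |- ?x + _ <= _ => assert (B1 : x <= eta / 2); [|lra] end.
      rewrite !Cmod_mult, Cmod_R, Rabs_right by (left; apply exp_pos).
      assert (B3 : Cmod (fst a) <= eta / 2 * exp (T * w)).
      { apply Rle_trans with (eta / 2 * (T1 * w)).
        - right; unfold T1; field; split; lra.
        - apply Rmult_le_compat_l; [lra|].
          apply Rle_trans with (1 + T * w); [nra|]. apply exp_ineq1_le. }
      assert (B4 := Cmod_chi_le_1 (snd a) s1 s2 H1 H2).
      assert (Hce := Cmod_ge_0 (chi (snd a) s1 s2)).
      rewrite exp_Ropp. assert (He' := exp_pos (T * w)).
      apply (Rmult_le_reg_r (exp (T * w))); auto.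
      replace (Cmod (fst a) * (Cmod (chi (snd a) s1 s2) * / exp (T * w)) * exp (T * w))
        with (Cmod (fst a) * Cmod (chi (snd a) s1 s2)) by (field; lra).
      nra.
Qed.

Lemma memA_approx p f eta : 0 < p <= 1 -> memA p f -> 0 < eta ->
  exists L, forall s1 s2, inH s1 -> inH s2 -> Cmod (Cminus (f s1 s2) (evl L s1 s2)) <= eta.
Proof.
  intros Hp [M HM] He.
  destruct (inA_approx p M f (rpow eta p) HM) as [L HL]; [now apply rpow_pos|].
  exists L; intros s1 s2 H1 H2. apply rpow_le_inv with p; [lra|lra|].
  apply (inA_sup p _ (fun s1 s2 => Cminus (f s1 s2) (evl L s1 s2))); auto.
Qed.

(* For large tau, f(s + tau) is close to a nonzero constant, hence invertible; invertibility is
   then propagated down to tau = 0 by finitely many perturbation steps of uniform length. *)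
Lemma memA_inv p f k : 0 < p <= 1 -> memA p f -> 0 < k ->
  (forall s1 s2, inH s1 -> inH s2 -> k <= Cmod (f s1 s2)) ->
  memA p (fun s1 s2 => Cinv (f s1 s2)).
Proof.
  intros Hp Hf Hk Hb.
  (* Error budget: two approximations by [L] and one Lipschitz step, k/8 each, stay below the k/2
     that [memA_inv_step] tolerates. *)
  destruct (memA_approx p f (k / 8) Hp Hf) as [L HL]; [lra|].
  destruct (evl_dilate_lipschitz L) as [K [HK HLip]].
  destruct (evl_dilate_limit L) as [al Hal].
  destruct (Hal (k / 8)) as [T [HT HlimL]]; [lra|].
  assert (Hlow : forall tau s1 s2, 0 <= tau -> inH s1 -> inH s2 -> k <= Cmod (dilate tau f s1 s2)).
  { intros; apply Hb; apply inH_plus; auto. }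
  assert (HLd : forall tau s1 s2, 0 <= tau -> inH s1 -> inH s2 ->
     Cmod (Cminus (dilate tau f s1 s2) (dilate tau (evl L) s1 s2)) <= k / 8).
  { intros; apply HL; apply inH_plus; auto. }
  assert (Hlim : forall s1 s2, inH s1 -> inH s2 -> Cmod (Cminus al (dilate T f s1 s2)) <= k / 4).
  { intros s1 s2 H1 H2.
    replace (Cminus al (dilate T f s1 s2)) with
      (Copp (Cplus (Cminus (dilate T f s1 s2) (dilate T (evl L) s1 s2))
                   (Cminus (dilate T (evl L) s1 s2) al))) by ring.
    rewrite Cmod_opp. eapply Rle_trans; [apply Cmod_triangle|].
    generalize (HLd T s1 s2 HT H1 H2) (HlimL T s1 s2 (Rle_refl _) H1 H2); lra. }
  (* The constant [al] inherits from f the lower bound k - k/4. The first perturbation starts at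
     this constant, and its size k/4 is at most half of 3k/4. *)
  assert (Halb : k * 3 / 4 <= Cmod al).
  { assert (H0 : inH 0%C) by (unfold inH; simpl; lra).
    generalize (Hlim 0%C 0%C H0 H0) (Hlow T 0%C 0%C HT H0 H0); intros B1 B2.
    generalize (Cmod_triangle al (Copp (Cminus al (dilate T f 0 0)))).
    rewrite Cmod_opp. replace (Cplus al (Copp (Cminus al (dilate T f 0 0)))) with (dilate T f 0 0) by ring.
    lra. }
  set (d := k / 8 / (K + 1)).
  assert (Hd : 0 < d) by (apply Rdiv_lt_0_compat; lra).
  assert (Hunif : forall tau tau' s1 s2, 0 <= tau -> 0 <= tau' -> Rabs (tau - tau') <= d ->
     inH s1 -> inH s2 -> Cmod (Cminus (dilate tau f s1 s2) (dilate tau' f s1 s2)) <= k / 2).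
  { intros tau tau' s1 s2 H H' Htt H1 H2.
    assert (B : Cmod (Cminus (dilate tau (evl L) s1 s2) (dilate tau' (evl L) s1 s2)) <= k / 8).
    { eapply Rle_trans; [apply HLip; auto|].
      apply Rle_trans with ((K + 1) * d); [|right; unfold d; field; lra].
      apply Rmult_le_compat; auto using Rabs_pos; lra. }
    generalize (HLd tau s1 s2 H H1 H2) (HLd tau' s1 s2 H' H1 H2); intros B1 B2.
    replace (Cminus (dilate tau f s1 s2) (dilate tau' f s1 s2)) with
      (Cplus (Cminus (dilate tau f s1 s2) (dilate tau (evl L) s1 s2))
        (Cplus (Cminus (dilate tau (evl L) s1 s2) (dilate tau' (evl L) s1 s2))
          (Copp (Cminus (dilate tau' f s1 s2) (dilate tau' (evl L) s1 s2))))) by ring.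
    eapply Rle_trans; [apply Cmod_triangle|]. eapply Rle_trans;
      [apply Rplus_le_compat_l, Cmod_triangle|]. rewrite Cmod_opp. lra. }
  assert (HinvT : memA p (fun s1 s2 => Cinv (dilate T f s1 s2))).
  { apply (memA_inv_step p (k * 3 / 4) (fun _ _ => al)); auto; try lra.
    - apply memA_const.
    - apply memA_dilate; auto; lra.
    - apply memA_const.
    - intros; eapply Rle_trans; [apply Hlim; auto|lra]. }
  (* Cutting off at 0 keeps every translation nonnegative and makes the last step end exactly at tau
     = 0. *)
  assert (Hdown : forall n, memA p (fun s1 s2 => Cinv (dilate (Rmax 0 (T - INR n * d)) f s1 s2))).
  { induction n as [|n IH].
    - simpl. rewrite Rmult_0_l, Rminus_0_r, Rmax_right; auto.
    - eapply (memA_inv_step p k (dilate (Rmax 0 (T - INR n * d)) f)); auto.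
      + apply memA_dilate; auto; [lra|apply Rmax_l].
      + apply memA_dilate; auto; [lra|apply Rmax_l].
      + intros; apply Hlow; auto; apply Rmax_l.
      + intros; apply Hunif; auto using Rmax_l. rewrite S_INR.
        unfold Rmax; repeat destruct Rle_dec; unfold Rabs; destruct Rcase_abs; nra. }
  destruct (INR_unbounded (T / d)) as [n Hn].
  generalize (Hdown n). rewrite Rmax_left.
  - apply memA_ext. intros s1 s2 _ _. unfold dilate. f_equal; f_equal; ring.
  - assert (T <= INR n * d); [|lra].
    replace T with (T / d * d) by (field; lra). apply Rmult_le_compat_r; lra.
Qed.

(** * Atomic sums and Dirichlet series *)

(** The balls behind [locally] are those of the product R x R, hence the factor sqrt 2 <= 2 in the
    passage to the modulus. *)
Lemma filterlim_Ccvg (u : nat -> C) (l : C) :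
  filterlim u eventually (locally l) <-> Ccvg u l.
Proof.
  split.
  - intros H e He. rewrite filterlim_locally in H.
    assert (He2 : 0 < e / 2) by lra.
    destruct (H (mkposreal _ He2)) as [N HN]. exists N; intros n Hn.
    specialize (HN n Hn). apply C_NormedModule_mixin_compat2 in HN. simpl in HN.
    assert (sqrt 2 <= 2).
    { rewrite <- (sqrt_square 2) at 2 by lra. apply sqrt_le_1_alt; lra. }
    change (minus (u n) l) with (Cminus (u n) l) in HN. nra.
  - intros H. apply filterlim_locally. intros e.
    destruct (H (e / 2)) as [N HN]; [generalize (cond_pos e); lra|].
    exists N; intros n Hn. apply C_NormedModule_mixin_compat1.
    change (minus (u n) l) with (Cminus (u n) l).
    generalize (HN n Hn) (cond_pos e); lra.
Qed.

Definition pidx_of (m n : nat) : pidx := (Pos.of_nat m, Pos.of_nat n).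

Lemma chi_pidx_of i j s1 s2 :
  chi (pidx_of (S i) (S j)) s1 s2 = Cmult (npow_neg (S i) s1) (npow_neg (S j) s2).
Proof. unfold chi, pidx_of, pnat; cbn [fst snd]. now rewrite !Nat2Pos.id by lia. Qed.

(* [cat (shell a) N] enumerates the square [1, N]^2. *)
Definition shell (a : nat -> nat -> C) (N : nat) : list atom :=
  cat (fun i => [(a (S i) (S N), pidx_of (S i) (S N))]) N ++
  cat (fun j => [(a (S N) (S j), pidx_of (S N) (S j))]) (S N).

Lemma evl_shell a N s1 s2 : evl (cat (shell a) N) s1 s2 =
  sq_csum (fun m n => Cmult (a m n) (Cmult (npow_neg m s1) (npow_neg n s2))) N.
Proof.
  rewrite evl_cat. unfold sq_csum.
  set (F := fun m n => Cmult (a m n) (Cmult (npow_neg m s1) (npow_neg n s2))).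
  induction N as [|N IH]; [reflexivity|].
  cbn [csum]. rewrite IH, csum_plus. unfold shell at 1. rewrite evl_app, !evl_cat.
  rewrite (csum_ext (fun j => evl [(a (S j) (S N), pidx_of (S j) (S N))] s1 s2)
             (fun i => F (S i) (S N))).
  2:{ intros; cbn [evl fst snd]; rewrite chi_pidx_of; unfold F; ring. }
  rewrite (csum_ext (fun j => evl [(a (S N) (S j), pidx_of (S N) (S j))] s1 s2)
             (fun j => F (S N) (S j))).
  2:{ intros; cbn [evl fst snd]; rewrite chi_pidx_of; unfold F; ring. }
  unfold F; cbn [csum]. ring.
Qed.

Lemma cost_shell p a N : cost p (cat (shell a) N) = sq_rsum (fun m n => rpow (Cmod (a m n)) p) N.
Proof.
  rewrite cost_cat. unfold sq_rsum.
  set (F := fun m n => rpow (Cmod (a m n)) p).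
  induction N as [|N IH]; [reflexivity|].
  cbn [rsum]. rewrite IH, rsum_plus. unfold shell at 1. rewrite cost_app, !cost_cat.
  rewrite (rsum_ext (fun j => cost p [(a (S j) (S N), pidx_of (S j) (S N))])
             (fun i => F (S i) (S N))).
  2:{ intros; cbn [cost fst snd]; unfold F; ring. }
  rewrite (rsum_ext (fun j => cost p [(a (S N) (S j), pidx_of (S N) (S j))])
             (fun j => F (S N) (S j))).
  2:{ intros; cbn [cost fst snd]; unfold F; ring. }
  unfold F; cbn [rsum]. ring.
Qed.

Lemma sq_rsum_le F G N :
  (forall m n, (1 <= m)%nat -> (1 <= n)%nat -> F m n <= G m n) -> sq_rsum F N <= sq_rsum G N.
Proof.
  intros H; unfold sq_rsum. apply rsum_le; intros i _; apply rsum_le; intros j _. apply H; lia.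
Qed.

(** As w >= 1, dropping the weight only lowers the sum; the shells serve as blocks, so that their
    partial sums are the square sums. *)
Lemma has_pDS_memA p w f :
  (forall m n, (1 <= m)%nat -> (1 <= n)%nat -> 1 <= w m n) -> has_pDS p w f -> memA p f.
Proof.
  intros Hw [a [[M HM] Ha]]. exists M, (shell a); split.
  - intros N. rewrite cost_shell. eapply Rle_trans; [|apply (HM N)].
    apply sq_rsum_le; intros m n Hm Hn.
    generalize (Hw m n Hm Hn) (rpow_ge_0 (Cmod (a m n)) p); nra.
  - intros s1 s2 H1 H2. apply filterlim_Ccvg.
    eapply filterlim_ext; [intros N; symmetry; apply evl_shell|]. apply Ha; auto.
Qed.

Lemma coef_app L L' y : coef (L ++ L') y = Cplus (coef L y) (coef L' y).
Proof. induction L as [|a L IH]; simpl; [ring|rewrite IH; ring]. Qed.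

Lemma Cmod_coef_le L y : Cmod (coef L y) <= l1 L.
Proof.
  induction L as [|a L IH]; simpl; [rewrite Cmod_0; lra|].
  eapply Rle_trans; [apply Cmod_triangle|]. apply Rplus_le_compat; auto.
  destruct (pidx_eq_dec (snd a) y); [lra|]. rewrite Cmod_0; apply Cmod_ge_0.
Qed.

Lemma rsum_indicator (k : nat) (v : R) n :
  rsum (fun i => if Nat.eq_dec i k then v else 0) n = if lt_dec k n then v else 0.
Proof.
  induction n as [|n IH]; simpl; [auto|]. rewrite IH.
  destruct (Nat.eq_dec n k), (lt_dec k n), (lt_dec k (S n)); try lia; ring.
Qed.

Lemma csum_indicator (k : nat) (v : C) n :
  csum (fun i => if Nat.eq_dec i k then v else 0%C) n = if lt_dec k n then v else 0%C.
Proof.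
  induction n as [|n IH]; simpl; [auto|]. rewrite IH.
  destruct (Nat.eq_dec n k), (lt_dec k n), (lt_dec k (S n)); try lia; ring.
Qed.

Lemma pidx_of_eq (y : pidx) i j :
  y = pidx_of (S i) (S j) <-> i = pred (pnat (fst y)) /\ j = pred (pnat (snd y)).
Proof.
  destruct y as [m n]; unfold pidx_of, pnat; cbn [fst snd]; split.
  - intros E; split; [apply (f_equal fst) in E|apply (f_equal snd) in E]; cbn [fst snd] in E;
      rewrite E, Nat2Pos.id; lia.
  - intros [-> ->]. f_equal; symmetry; rewrite Nat.succ_pred by lia; apply Pos2Nat.id.
Qed.

Lemma sq_csum_plus F G N :
  sq_csum (fun m n => Cplus (F m n) (G m n)) N = Cplus (sq_csum F N) (sq_csum G N).
Proof.
  unfold sq_csum. rewrite <- csum_plus. apply csum_ext; intros; apply csum_plus.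
Qed.

Lemma sq_rsum_plus F G N :
  sq_rsum (fun m n => F m n + G m n) N = sq_rsum F N + sq_rsum G N.
Proof.
  unfold sq_rsum. rewrite <- rsum_plus. apply rsum_ext; intros; apply rsum_plus.
Qed.

Lemma sq_csum_ext F G N :
  (forall i j, F (S i) (S j) = G (S i) (S j)) -> sq_csum F N = sq_csum G N.
Proof. intros H; unfold sq_csum. apply csum_ext; intros; apply csum_ext; intros; auto. Qed.

Lemma sq_rsum_indicator_le (y : pidx) (v : R) N : 0 <= v ->
  sq_rsum (fun m n => if pidx_eq_dec y (pidx_of m n) then v else 0) N <= v.
Proof.
  intros Hv; unfold sq_rsum.
  set (i0 := pred (pnat (fst y))). set (j0 := pred (pnat (snd y))).
  rewrite (rsum_ext _ (fun i => if Nat.eq_dec i i0 then (if lt_dec j0 N then v else 0) else 0)).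
  - rewrite rsum_indicator. destruct (lt_dec i0 N), (lt_dec j0 N); lra.
  - intros i _. rewrite <- rsum_indicator.
    destruct (Nat.eq_dec i i0) as [Hi|Hi].
    + apply rsum_ext; intros j _.
      destruct (pidx_eq_dec y (pidx_of (S i) (S j))) as [E|E], (Nat.eq_dec j j0) as [Hj|Hj]; auto;
        rewrite pidx_of_eq in E; unfold i0, j0 in *; tauto.
    + rewrite (rsum_ext _ (fun j => 0 * 0)); [rewrite (rsum_scal 0 (fun _ => 0)); ring|].
      intros j _. destruct (pidx_eq_dec y (pidx_of (S i) (S j))) as [E|E]; [|ring].
      rewrite pidx_of_eq in E; unfold i0 in *; tauto.
Qed.

Lemma sq_csum_indicator (y : pidx) (v : C) N : (pnat (fst y) <= N)%nat -> (pnat (snd y) <= N)%nat ->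
  sq_csum (fun m n => if pidx_eq_dec y (pidx_of m n) then v else 0%C) N = v.
Proof.
  intros H1 H2; unfold sq_csum.
  set (i0 := pred (pnat (fst y))). set (j0 := pred (pnat (snd y))).
  assert (i0 < N)%nat by (unfold i0, pnat in *; lia).
  assert (j0 < N)%nat by (unfold j0, pnat in *; lia).
  rewrite (csum_ext _ (fun i => if Nat.eq_dec i i0 then v else 0%C)).
  - rewrite csum_indicator. destruct (lt_dec i0 N); [auto|lia].
  - intros i _. destruct (Nat.eq_dec i i0) as [Hi|Hi].
    + rewrite (csum_ext _ (fun j => if Nat.eq_dec j j0 then v else 0%C)).
      * rewrite csum_indicator. destruct (lt_dec j0 N); [auto|lia].
      * intros j _.
        destruct (pidx_eq_dec y (pidx_of (S i) (S j))) as [E|E], (Nat.eq_dec j j0) as [Hj|Hj]; auto;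
        rewrite pidx_of_eq in E; unfold i0, j0 in *; tauto.
    + rewrite (csum_ext _ (fun j => Cmult 0%C 0%C)); [rewrite (csum_scal 0%C (fun _ => 0%C)); ring|].
      intros j _. destruct (pidx_eq_dec y (pidx_of (S i) (S j))) as [E|E]; [|ring].
      rewrite pidx_of_eq in E; unfold i0 in *; tauto.
Qed.

(** Merging atoms of equal index does not raise the cost, again by subadditivity of x^p. *)
Lemma sq_rsum_coef_le p L N : 0 < p <= 1 ->
  sq_rsum (fun m n => rpow (Cmod (coef L (pidx_of m n))) p) N <= cost p L.
Proof.
  intros Hp; induction L as [|a L IH]; simpl.
  - unfold sq_rsum. right. rewrite (rsum_ext _ (fun _ => 0 * 0)).
    + rewrite (rsum_scal 0 (fun _ => 0)); ring.
    + intros; rewrite (rsum_ext _ (fun _ => 0 * 0)); [rewrite (rsum_scal 0 (fun _ => 0)); ring|].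
      intros; rewrite Cmod_0, rpow_0; ring.
  - eapply Rle_trans; [|apply Rplus_le_compat_l, IH].
    eapply Rle_trans; [|apply Rplus_le_compat_r].
    2:{ apply (sq_rsum_indicator_le (snd a) (rpow (Cmod (fst a)) p) N), rpow_ge_0. }
    rewrite <- sq_rsum_plus. apply sq_rsum_le; intros m n _ _.
    eapply Rle_trans; [apply rpow_le; [lra|apply Cmod_triangle]|].
    eapply Rle_trans; [apply rpow_plus_le; auto using Cmod_ge_0|].
    destruct (pidx_eq_dec (snd a) (pidx_of m n)); [lra|]. rewrite Cmod_0, rpow_0; lra.
Qed.

Definition coef_sum (L : list atom) (s1 s2 : C) (N : nat) : C :=
  sq_csum (fun m n => Cmult (coef L (pidx_of m n)) (chi (pidx_of m n) s1 s2)) N.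

(** A square large enough to contain all indices of [L] sees the whole polynomial. *)
Lemma coef_sum_eventually L s1 s2 : exists N0, forall N, (N0 <= N)%nat ->
  coef_sum L s1 s2 N = evl L s1 s2.
Proof.
  unfold coef_sum; induction L as [|a L [N0 IH]]; simpl.
  - exists 0%nat; intros N _. unfold sq_csum.
    rewrite (csum_ext _ (fun _ => Cmult 0%C 0%C)); [rewrite (csum_scal 0%C (fun _ => 0%C)); ring|].
    intros; rewrite (csum_ext _ (fun _ => Cmult 0%C 0%C));
      [rewrite (csum_scal 0%C (fun _ => 0%C)); ring|intros; ring].
  - exists (N0 + pnat (fst (snd a)) + pnat (snd (snd a)))%nat; intros N HN.
    rewrite <- (IH N) by lia.
    rewrite <- (sq_csum_indicator (snd a) (Cmult (fst a) (chi (snd a) s1 s2)) N) by lia.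
    rewrite <- sq_csum_plus. apply sq_csum_ext; intros i j.
    destruct (pidx_eq_dec (snd a) (pidx_of (S i) (S j))) as [->|]; ring.
Qed.

Lemma Cmod_sq_csum_le F N : Cmod (sq_csum F N) <= sq_rsum (fun m n => Cmod (F m n)) N.
Proof.
  unfold sq_csum, sq_rsum. eapply Rle_trans; [apply Cmod_csum_le|].
  apply rsum_le; intros; apply Cmod_csum_le.
Qed.

Lemma l1_cost_1 L : l1 L = cost 1 L.
Proof.
  induction L as [|a L IH]; simpl; [auto|]. rewrite IH. f_equal.
  unfold rpow. destruct (Rle_dec (Cmod (fst a)) 0) as [H|H].
  - generalize (Cmod_ge_0 (fst a)); lra.
  - rewrite Rpower_1; lra.
Qed.

Lemma Cmod_coef_sum_le L s1 s2 N : inH s1 -> inH s2 -> Cmod (coef_sum L s1 s2 N) <= l1 L.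
Proof.
  intros H1 H2. rewrite l1_cost_1. eapply Rle_trans; [apply Cmod_sq_csum_le|].
  eapply Rle_trans; [|apply (sq_rsum_coef_le 1 L N); lra].
  apply sq_rsum_le; intros m n _ _. rewrite Cmod_mult.
  apply Rle_trans with (Cmod (coef L (pidx_of m n))).
  - generalize (Cmod_ge_0 (coef L (pidx_of m n))) (Cmod_chi_le_1 (pidx_of m n) s1 s2 H1 H2); nra.
  - unfold rpow. destruct (Rle_dec _ 0); [auto|]. rewrite Rpower_1; lra.
Qed.

Lemma C_complete (u : nat -> C) :
  (forall eps, 0 < eps -> exists N, forall n, (N <= n)%nat -> Cmod (Cminus (u n) (u N)) <= eps) ->
  exists l, Ccvg u l.
Proof.
  intros H.
  assert (Hc : forall pr : C -> R, (forall z w, Rabs (pr z - pr w) <= Cmod (Cminus z w)) ->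
     { l | Un_cv (fun n => pr (u n)) l }).
  { intros pr Hpr. apply Rcomplete.R_complete. intros e He.
    destruct (H (e / 3)) as [N HN]; [lra|]. exists N; intros n m Hn Hm.
    unfold Rdist. replace (pr (u n) - pr (u m)) with
      ((pr (u n) - pr (u N)) - (pr (u m) - pr (u N))) by ring.
    eapply Rle_lt_trans; [apply Rabs_triang|]. rewrite Rabs_Ropp.
    generalize (Hpr (u n) (u N)) (Hpr (u m) (u N)) (HN n Hn) (HN m Hm); lra. }
  destruct (Hc fst) as [l1 Hl1].
  { intros z w. eapply Rle_trans; [|apply Rmax_Cmod]. apply Rmax_l. }
  destruct (Hc snd) as [l2 Hl2].
  { intros z w. eapply Rle_trans; [|apply Rmax_Cmod]. apply Rmax_r. }
  exists (l1, l2). intros e He.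
  destruct (Hl1 (e / 2)) as [N1 HN1]; [lra|]. destruct (Hl2 (e / 2)) as [N2 HN2]; [lra|].
  exists (N1 + N2)%nat; intros n Hn.
  specialize (HN1 n ltac:(lia)). specialize (HN2 n ltac:(lia)). unfold Rdist in *.
  eapply Rle_trans; [apply Cmod_2Rmax|]. simpl.
  assert (sqrt 2 <= 2).
  { rewrite <- (sqrt_square 2) at 2 by lra. apply sqrt_le_1_alt; lra. }
  assert (Rmax (Rabs (fst (u n) + - l1)) (Rabs (snd (u n) + - l2)) <= e / 2).
  { apply Rmax_lub; [left; exact HN1|left; exact HN2]. }
  assert (0 <= Rmax (Rabs (fst (u n) + - l1)) (Rabs (snd (u n) + - l2))).
  { eapply Rle_trans; [apply Rabs_pos|apply Rmax_l]. }
  generalize (sqrt_pos 2); nra.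
Qed.

Lemma sq_csum_cvg (F : nat -> nat -> nat -> C) (G : nat -> nat -> C) N :
  (forall m n, Ccvg (fun k => F k m n) (G m n)) ->
  Ccvg (fun k => sq_csum (F k) N) (sq_csum G N).
Proof.
  intros H; unfold sq_csum.
  apply (Ccvg_csum (fun i k => csum (fun j => F k (S i) (S j)) N)); intros i _.
  apply (Ccvg_csum (fun j k => F k (S i) (S j))); auto.
Qed.

(** This one-sided semicontinuity carries bounds on finite sums over to the limit coefficients. *)
Lemma rpow_Cmod_cvg_le p u l : 0 < p <= 1 -> Ccvg u l -> forall eps, 0 < eps ->
  exists N, forall n, (N <= n)%nat -> rpow (Cmod l) p <= rpow (Cmod (u n)) p + eps.
Proof.
  intros Hp Hu e He. destruct (rpow_small p e ltac:(lra) He) as [d [Hd Hd']].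
  destruct (Hu d Hd) as [N HN]. exists N; intros n Hn.
  apply Rle_trans with (rpow (Cmod (u n) + Cmod (Cminus (u n) l)) p).
  { apply rpow_le; [lra|].
    replace l with (Cplus (u n) (Copp (Cminus (u n) l))) at 1 by ring.
    eapply Rle_trans; [apply Cmod_triangle|]. rewrite Cmod_opp; lra. }
  eapply Rle_trans; [apply rpow_plus_le; auto using Cmod_ge_0|].
  apply Rplus_le_compat_l; auto.
Qed.

Lemma rsum_cvg_le (x : nat -> nat -> R) (y : nat -> R) n :
  (forall i eps, 0 < eps -> exists N, forall k, (N <= k)%nat -> y i <= x k i + eps) ->
  forall eps, 0 < eps -> exists N, forall k, (N <= k)%nat -> rsum y n <= rsum (x k) n + eps.
Proof.
  intros H; induction n as [|n IH]; intros e He; simpl; [exists 0%nat; intros; lra|].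
  destruct (IH (e / 2)) as [N HN]; [lra|]. destruct (H n (e / 2)) as [N' HN']; [lra|].
  exists (N + N')%nat; intros k Hk. generalize (HN k ltac:(lia)) (HN' k ltac:(lia)); lra.
Qed.

(** The coefficients are the limits of the merged coefficients of the finite stages, which are
    Cauchy because the l1 norms of the tails tend to 0. The p-sum bound passes to the limit on each
    square, in the manner of Fatou. For the values, [f] and a large square sum are both compared
    with one fixed stage [n0]. *)
Lemma memA_has_pDS p w B f : 0 < p <= 1 ->
  (forall m n, (1 <= m)%nat -> (1 <= n)%nat -> 0 <= w m n <= B) ->
  memA p f -> has_pDS p w f.
Proof.
  intros Hp Hw [M [D [HD1 HD2]]].
  assert (Htail : forall eps, 0 < eps -> exists N, forall k, l1 (cat (fun i => D (N + i)%nat) k) <= eps).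
  { intros e He. destruct (blocks_tail p M D (rpow e p) HD1) as [N HN]; [now apply rpow_pos|].
    exists N; intros k. apply rpow_le_inv with p; [lra|lra|].
    eapply Rle_trans; [now apply rpow_l1_le|auto]. }
  assert (Hlim : forall y, exists l, Ccvg (fun n => coef (cat D n) y) l).
  { intros y; apply C_complete. intros e He. destruct (Htail e He) as [N HN].
    exists N; intros n Hn. replace n with (N + (n - N))%nat by lia.
    rewrite cat_shift, coef_app.
    match goal with |- Cmod (Cminus (Cplus ?x ?y) ?x) <= _ =>
      replace (Cminus (Cplus x y) x) with y by ring end.
    eapply Rle_trans; [apply Cmod_coef_le|auto]. }
  destruct (functional_choice _ Hlim) as [A HA].
  exists (fun m n => A (pidx_of m n)); split.
  - exists (M * B). intros N.
    assert (HB : 0 <= B) by (generalize (Hw 1%nat 1%nat ltac:(lia) ltac:(lia)); lra).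
    apply Rle_trans with (sq_rsum (fun m n => B * rpow (Cmod (A (pidx_of m n))) p) N).
    { apply sq_rsum_le; intros m n Hm Hn.
      generalize (Hw m n Hm Hn) (rpow_ge_0 (Cmod (A (pidx_of m n))) p); nra. }
    replace (sq_rsum (fun m n => B * rpow (Cmod (A (pidx_of m n))) p) N)
      with (B * sq_rsum (fun m n => rpow (Cmod (A (pidx_of m n))) p) N).
    2:{ unfold sq_rsum. rewrite <- rsum_scal. apply rsum_ext; intros; symmetry; apply rsum_scal. }
    rewrite Rmult_comm. apply Rmult_le_compat_r; auto.
    apply le_epsilon; intros e He.
    destruct (rsum_cvg_le
       (fun k i => rsum (fun j => rpow (Cmod (coef (cat D k) (pidx_of (S i) (S j)))) p) N)
       (fun i => rsum (fun j => rpow (Cmod (A (pidx_of (S i) (S j)))) p) N) N) with (eps := e)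
       as [K HK]; auto.
    + intros i. apply (rsum_cvg_le
         (fun k j => rpow (Cmod (coef (cat D k) (pidx_of (S i) (S j)))) p)).
      intros j. now apply (rpow_Cmod_cvg_le p (fun k => coef (cat D k) (pidx_of (S i) (S j)))).
    + eapply Rle_trans; [apply (HK K (le_n _))|]. apply Rplus_le_compat_r.
      eapply Rle_trans; [apply (sq_rsum_coef_le p (cat D K) N Hp)|auto].
  - intros s1 s2 H1 H2. apply filterlim_Ccvg.
    assert (E : forall N, sq_csum (fun m n => Cmult (A (pidx_of m n)) (chi (pidx_of m n) s1 s2)) N =
      sq_csum (fun m n => Cmult (A (pidx_of m n)) (Cmult (npow_neg m s1) (npow_neg n s2))) N).
    { intros N; apply sq_csum_ext; intros i j; now rewrite chi_pidx_of. }
    eapply Ccvg_ext; [apply E|]. clear E.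
    intros e He. destruct (Htail (e / 2)) as [n0 Hn0]; [lra|].
    destruct (coef_sum_eventually (cat D n0) s1 s2) as [N0 HN0].
    exists N0; intros N HN. specialize (HN0 N HN).
    set (SA := sq_csum _ N).
    (* The bound does not depend on the size of the square: going beyond stage [n0] changes a square
       sum by at most the l1 norm of the added atoms. *)
    assert (B1 : Cmod (Cminus SA (evl (cat D n0) s1 s2)) <= e / 2).
    { rewrite <- HN0.
      apply (Ccvg_bound (fun k => Cminus (coef_sum (cat D (n0 + k)) s1 s2 N)
                                         (coef_sum (cat D n0) s1 s2 N))).
      - apply (Ccvg_plus (fun k => coef_sum (cat D (n0 + k)) s1 s2 N) (fun _ => Copp _) _ (Copp _));
          [|apply Ccvg_const].
        apply (sq_csum_cvg (fun k m n => Cmult (coef (cat D (n0 + k)) (pidx_of m n))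
                                            (chi (pidx_of m n) s1 s2))).
        intros m n. rewrite Cmult_comm.
        eapply Ccvg_ext; [intros k; apply Cmult_comm|]. apply Ccvg_scal.
        intros eta Heta. destruct (HA (pidx_of m n) eta Heta) as [K HK].
        exists K; intros k Hk; apply HK; lia.
      - intros k.
        replace (Cminus _ _) with (coef_sum (cat (fun i => D (n0 + i)%nat) k) s1 s2 N).
        + eapply Rle_trans; [now apply Cmod_coef_sum_le|auto].
        + assert (E : coef_sum (cat D (n0 + k)) s1 s2 N = Cplus (coef_sum (cat D n0) s1 s2 N)
            (coef_sum (cat (fun i => D (n0 + i)%nat) k) s1 s2 N)).
          { unfold coef_sum. rewrite <- sq_csum_plus. apply sq_csum_ext; intros i j.
            rewrite cat_shift, coef_app; ring. }
          rewrite E; ring. }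
    assert (B2 : Cmod (Cminus (f s1 s2) (evl (cat D n0) s1 s2)) <= e / 2).
    { apply (Ccvg_bound (fun k => Cminus (evl (cat D (n0 + k)) s1 s2) (evl (cat D n0) s1 s2))).
      - apply (Ccvg_plus (fun k => evl (cat D (n0 + k)) s1 s2) (fun _ => Copp _) _ (Copp _));
          [|apply Ccvg_const].
        intros eta Heta. destruct (HD2 s1 s2 H1 H2 eta Heta) as [K HK].
        exists K; intros k Hk; apply HK; lia.
      - intros k. rewrite cat_shift, evl_app.
        match goal with |- Cmod (Cminus (Cplus ?x ?y) ?x) <= _ =>
          replace (Cminus (Cplus x y) x) with y by ring end.
        eapply Rle_trans; [now apply Cmod_evl_le|auto]. }
    replace (Cminus SA (f s1 s2)) with (Cplus (Cminus SA (evl (cat D n0) s1 s2))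
      (Copp (Cminus (f s1 s2) (evl (cat D n0) s1 s2)))) by ring.
    eapply Rle_trans; [apply Cmod_triangle|]. rewrite Cmod_opp; lra.
Qed.

(** * Weights *)

(** The roots are squeezed between 1 and B^(1/(j+1)), which tends to 1. *)
Lemma bounded_weight_admissible w B :
  (forall m n, (1 <= m)%nat -> (1 <= n)%nat -> 1 <= w m n <= B) -> admissible w.
Proof.
  intros Hw l k Hl Hk.
  assert (HB : 1 <= B) by (generalize (Hw 1%nat 1%nat ltac:(lia) ltac:(lia)); lra).
  assert (Hp : forall a j, (1 <= a)%nat -> (1 <= a ^ j)%nat).
  { intros a j Ha. induction j as [|j IH]; simpl; [lia|]. nia. }
  apply is_lim_seq_le_le with (u := fun _ => 1) (w := fun j => exp (ln B * / INR (S j))).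
  - intros j. destruct (Hw (l ^ S j)%nat (k ^ S j)%nat) as [H1 H2]; auto.
    assert (Hj : 0 < / INR (S j)) by (apply Rinv_0_lt_compat, lt_0_INR; lia).
    assert (L1 : 0 <= ln (w (l ^ S j)%nat (k ^ S j)%nat)) by (rewrite <- ln_1; apply ln_le; lra).
    assert (L2 : ln (w (l ^ S j)%nat (k ^ S j)%nat) <= ln B) by (apply ln_le; lra).
    assert (Hexp : forall x y, x <= y -> exp x <= exp y).
    { intros x y [Hxy| ->]; [left; now apply exp_increasing|lra]. }
    unfold Rpower; split.
    + rewrite <- exp_0. apply Hexp. apply Rmult_le_pos; lra.
    + apply Hexp. rewrite Rmult_comm. apply Rmult_le_compat_r; lra.
  - apply is_lim_seq_const.
  - rewrite <- exp_0. apply is_lim_seq_continuous; [apply derivable_continuous_pt, derivable_pt_exp|].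
    replace (Finite 0) with (Rbar_mult (ln B) 0) by (simpl; f_equal; ring).
    apply is_lim_seq_scal_l.
    replace (Finite 0) with (Rbar_inv p_infty) by reflexivity.
    apply is_lim_seq_inv; [|discriminate].
    apply (is_lim_seq_incr_1 INR), is_lim_seq_INR.
Qed.

(** Divisibility is asked in one coordinate only, so 1 | 1 already compares w(m,1) and w(1,n) with
    w(1,1); submultiplicativity then gives w(m,n) <= (K w(1,1))^2. *)
Lemma almost_monotone_admissible w : almost_monotone w -> admissible w.
Proof.
  intros [[Hw1 Hw2] [H|[K [HK H]]]]; auto.
  set (A := K * w 1%nat 1%nat).
  apply bounded_weight_admissible with (A * A). intros m n Hm Hn.
  split; [auto|].
  assert (H1 : w m 1%nat <= A) by (apply H; auto; right; apply Nat.divide_1_l).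
  assert (H2 : w 1%nat n <= A) by (apply H; auto; left; apply Nat.divide_1_l).
  generalize (Hw2 m 1%nat 1%nat n Hm ltac:(lia) ltac:(lia) Hn).
  rewrite Nat.mul_1_r, Nat.mul_1_l. intros H3.
  generalize (Hw1 m 1%nat Hm ltac:(lia)) (Hw1 1%nat n ltac:(lia) Hn). nra.
Qed.

(** The minimum with a constant B >= 1 stays submultiplicative because all values are at least 1.
    Being bounded it is admissible, and so is [w]. *)
Lemma truncated_weight w : almost_monotone w -> exists nu B,
  almost_monotone nu /\ (const_weight nu <-> const_weight w) /\
  (admissible nu <-> admissible w) /\
  (forall m n, (1 <= m)%nat -> (1 <= n)%nat -> 1 <= nu m n <= w m n) /\
  (forall m n, (1 <= m)%nat -> (1 <= n)%nat -> 0 <= nu m n <= B).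
Proof.
  intros Hw. assert (Ha := almost_monotone_admissible w Hw).
  destruct Hw as [[Hw1 Hw2] _].
  assert (HB : exists B, 1 <= B /\ (const_weight (fun m n => Rmin (w m n) B) <-> const_weight w)).
  { destruct (classic (const_weight w)) as [Hc|Hc].
    - exists (w 1%nat 1%nat); split; [apply Hw1; lia|]. split; auto; intros _.
      destruct Hc as [c Hc]. exists (Rmin c (w 1%nat 1%nat)). intros m n Hm Hn. now rewrite Hc.
    - assert (Hne : exists m n, (1 <= m)%nat /\ (1 <= n)%nat /\ w m n <> w 1%nat 1%nat).
      { apply NNPP; intros Hno. apply Hc. exists (w 1%nat 1%nat); intros m n Hm Hn.
        apply NNPP; intros Hd. apply Hno; exists m, n; auto. }
      destruct Hne as [m0 [n0 [Hm0 [Hn0 Hd]]]].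
      (* [B] dominates two different values of [w], which the truncation therefore leaves
         distinct. *)
      exists (Rmax (w m0 n0) (w 1%nat 1%nat)); split.
      { eapply Rle_trans; [|apply Rmax_l]; auto. }
      split; [|tauto]. intros [c Hcc]. exfalso; apply Hd.
      rewrite <- (Rmin_left (w m0 n0) _ (Rmax_l (w m0 n0) (w 1%nat 1%nat))).
      rewrite <- (Rmin_left (w 1%nat 1%nat) _ (Rmax_r (w m0 n0) (w 1%nat 1%nat))) at 2.
      rewrite !Hcc; auto. }
  destruct HB as [B [HB1 HB2]].
  assert (Hb : forall m n, (1 <= m)%nat -> (1 <= n)%nat -> 1 <= Rmin (w m n) B <= B).
  { intros m n Hm Hn; split; [apply Rmin_glb; auto|apply Rmin_r]. }
  assert (Hadm := bounded_weight_admissible _ _ Hb).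
  exists (fun m n => Rmin (w m n) B), B; repeat split; auto; try tauto.
  - intros m n Hm Hn; apply Hb; auto.
  - intros m1 n1 m2 n2 Hm1 Hn1 Hm2 Hn2.
    generalize (Hw2 m1 n1 m2 n2 Hm1 Hn1 Hm2 Hn2) (Hw1 m1 n1 Hm1 Hn1) (Hw1 m2 n2 Hm2 Hn2).
    intros. unfold Rmin; repeat destruct Rle_dec; nra.
  - apply Hb; auto.
  - apply Rmin_l.
  - generalize (Hb m n H H0); lra.
  - apply Rmin_r.
Qed.

(** * Complex differentiability *)

Definition ccont (F : C -> C) (z : C) : Prop :=
  forall eps, 0 < eps -> exists d, 0 < d /\
    forall w, Cmod (Cminus w z) < d -> Cmod (Cminus (F w) (F z)) <= eps.

Definition cderiv (F : C -> C) (z l : C) : Prop :=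
  forall eps, 0 < eps -> exists d, 0 < d /\ forall w, Cmod (Cminus w z) < d ->
    Cmod (Cminus (Cminus (F w) (F z)) (Cmult l (Cminus w z))) <= eps * Cmod (Cminus w z).

Definition cdiff (F : C -> C) (z : C) : Prop := exists l, cderiv F z l.

Lemma cderiv_bound F z l : cderiv F z l -> exists d, 0 < d /\ forall w, Cmod (Cminus w z) < d ->
  Cmod (Cminus (F w) (F z)) <= (Cmod l + 1) * Cmod (Cminus w z).
Proof.
  intros H. destruct (H 1) as [d [Hd Hw]]; [lra|]. exists d; split; auto. intros w Hwd.
  specialize (Hw w Hwd).
  replace (Cminus (F w) (F z)) with (Cplus (Cminus (Cminus (F w) (F z)) (Cmult l (Cminus w z)))
    (Cmult l (Cminus w z))) by ring.
  eapply Rle_trans; [apply Cmod_triangle|]. rewrite Cmod_mult. lra.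
Qed.

Lemma cdiff_ccont F z : cdiff F z -> ccont F z.
Proof.
  intros [l Hl] e He. destruct (cderiv_bound F z l Hl) as [d [Hd Hw]].
  generalize (Cmod_ge_0 l); intros Hl0.
  exists (Rmin d (e / (Cmod l + 1))); split.
  { apply Rmin_pos; auto. apply Rdiv_lt_0_compat; lra. }
  intros w Hwz. eapply Rle_trans; [apply Hw; eapply Rlt_le_trans; [exact Hwz|apply Rmin_l]|].
  apply Rle_trans with ((Cmod l + 1) * (e / (Cmod l + 1))).
  - apply Rmult_le_compat_l; [lra|]. left; eapply Rlt_le_trans; [exact Hwz|apply Rmin_r].
  - right; field; lra.
Qed.

Lemma cdiff_const c z : cdiff (fun _ => c) z.
Proof.
  exists 0%C; intros e He; exists 1; split; [lra|]; intros w _.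
  replace (Cminus _ _) with (RtoC 0) by ring. rewrite Cmod_0.
  apply Rmult_le_pos; [lra|apply Cmod_ge_0].
Qed.

Lemma cdiff_id z : cdiff (fun w => w) z.
Proof.
  exists 1%C; intros e He; exists 1; split; [lra|]; intros w _.
  replace (Cminus _ _) with (RtoC 0) by ring. rewrite Cmod_0.
  apply Rmult_le_pos; [lra|apply Cmod_ge_0].
Qed.

Lemma cdiff_plus F G z : cdiff F z -> cdiff G z -> cdiff (fun w => Cplus (F w) (G w)) z.
Proof.
  intros [l Hl] [m Hm]; exists (Cplus l m); intros e He.
  destruct (Hl (e / 2)) as [d [Hd Hd']]; [lra|]. destruct (Hm (e / 2)) as [d2 [Hd2 Hd2']]; [lra|].
  exists (Rmin d d2); split; [apply Rmin_pos; auto|]. intros w Hw.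
  specialize (Hd' w ltac:(eapply Rlt_le_trans; [exact Hw|apply Rmin_l])).
  specialize (Hd2' w ltac:(eapply Rlt_le_trans; [exact Hw|apply Rmin_r])).
  match goal with |- Cmod ?x <= _ => replace x with
   (Cplus (Cminus (Cminus (F w) (F z)) (Cmult l (Cminus w z)))
          (Cminus (Cminus (G w) (G z)) (Cmult m (Cminus w z)))) by ring end.
  eapply Rle_trans; [apply Cmod_triangle|]. lra.
Qed.

(** The remainder of the product is (rem F) G(z) + F(z) (rem G) + (F(w) - F(z)) (G(w) - G(z)). *)
Lemma cdiff_mult F G z : cdiff F z -> cdiff G z -> cdiff (fun w => Cmult (F w) (G w)) z.
Proof.
  intros [l Hl] [m Hm]; exists (Cplus (Cmult l (G z)) (Cmult (F z) m)); intros e He.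
  destruct (cderiv_bound F z l Hl) as [d1 [Hd1 B1]].
  destruct (cderiv_bound G z m Hm) as [d2 [Hd2 B2]].
  set (A := Cmod (F z)) in *. set (B := Cmod (G z)) in *.
  assert (HA : 0 <= A) by apply Cmod_ge_0. assert (HB : 0 <= B) by apply Cmod_ge_0.
  set (p := Cmod l + 1) in *. set (q := Cmod m + 1) in *.
  assert (Hp : 0 < p) by (unfold p; generalize (Cmod_ge_0 l); lra).
  assert (Hq : 0 < q) by (unfold q; generalize (Cmod_ge_0 m); lra).
  assert (Hpq : 0 < p * q) by (apply Rmult_lt_0_compat; auto).
  (* Half of [e] goes to the two linear remainders, through [e1]; the other half to the product of
     the increments, of size p q h^2, through [d5]. *)
  set (e1 := e / (2 * (A + B + 1))).
  assert (He1 : 0 < e1) by (apply Rdiv_lt_0_compat; lra).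
  destruct (Hl e1 He1) as [d3 [Hd3 B3]]. destruct (Hm e1 He1) as [d4 [Hd4 B4]].
  set (d5 := e / (2 * (p * q))). assert (Hd5 : 0 < d5) by (apply Rdiv_lt_0_compat; lra).
  exists (Rmin (Rmin d1 d2) (Rmin (Rmin d3 d4) d5)); split; [repeat apply Rmin_pos; auto|].
  intros w Hw.
  assert (Hmins := conj (conj (Rmin_l (Rmin d1 d2) (Rmin (Rmin d3 d4) d5))
    (Rmin_r (Rmin d1 d2) (Rmin (Rmin d3 d4) d5)))
    (conj (conj (Rmin_l d1 d2) (Rmin_r d1 d2)) (conj (conj (Rmin_l d3 d4) (Rmin_r d3 d4))
      (conj (Rmin_l (Rmin d3 d4) d5) (Rmin_r (Rmin d3 d4) d5))))).
  set (h := Cmod (Cminus w z)) in *. assert (Hh : 0 <= h) by apply Cmod_ge_0.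
  specialize (B1 w ltac:(fold h; lra)). specialize (B2 w ltac:(fold h; lra)).
  specialize (B3 w ltac:(fold h; lra)). specialize (B4 w ltac:(fold h; lra)).
  fold h in B1, B2, B3, B4.
  match goal with |- Cmod ?x <= _ => replace x with
    (Cplus (Cmult (Cminus (Cminus (F w) (F z)) (Cmult l (Cminus w z))) (G z))
      (Cplus (Cmult (F z) (Cminus (Cminus (G w) (G z)) (Cmult m (Cminus w z))))
        (Cmult (Cminus (F w) (F z)) (Cminus (G w) (G z))))) by ring end.
  eapply Rle_trans; [apply Cmod_triangle|].
  eapply Rle_trans; [apply Rplus_le_compat_l, Cmod_triangle|].
  rewrite !Cmod_mult. fold A B.
  assert (T1 : Cmod (Cminus (F w) (F z)) * Cmod (Cminus (G w) (G z)) <= (p * h) * (q * h))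
    by (apply Rmult_le_compat; auto using Cmod_ge_0).
  assert (T2 : p * q * h <= e / 2).
  { apply Rle_trans with (p * q * d5); [apply Rmult_le_compat_l; lra|].
    right; unfold d5; field; split; lra. }
  assert (T3 : (A + B) * e1 <= e / 2).
  { apply Rle_trans with ((A + B + 1) * e1); [apply Rmult_le_compat_r; lra|].
    right; unfold e1; field; lra. }
  assert (T4 : (p * h) * (q * h) <= e / 2 * h) by nra.
  assert (T5 : (A + B) * e1 * h <= e / 2 * h) by nra.
  assert (T6 := Rmult_le_compat_r B _ _ HB B3). assert (T7 := Rmult_le_compat_l A _ _ HA B4).
  lra.
Qed.

(** With d = lam - z and increment h, the remainder of 1 / (d + h) is exactly h^2 / (d^2 (d + h)),
    and |d + h| >= |d| / 2 once |h| <= |d| / 2. *)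
Lemma cdiff_inv_minus z lam : lam <> z -> cdiff (fun w => Cinv (Cminus w z)) lam.
Proof.
  intros Hne. set (d := Cminus lam z).
  assert (Hd : d <> 0%C).
  { intros E; apply Hne. replace lam with (Cplus d z) by (unfold d; ring). rewrite E; ring. }
  assert (Hd0 : 0 < Cmod d) by now apply Cmod_gt_0.
  exists (Copp (Cinv (Cmult d d))); intros e He.
  set (r := Cmod d) in *.
  assert (Hr3 : 0 < e * (r * r * r) / 2).
  { apply Rdiv_lt_0_compat; [|lra]. repeat apply Rmult_lt_0_compat; auto. }
  exists (Rmin (r / 2) (e * (r * r * r) / 2)); split; [apply Rmin_pos; lra|].
  intros w Hw. set (h := Cminus w lam) in *.
  assert (H1 : Cmod h < r / 2) by (eapply Rlt_le_trans; [exact Hw|apply Rmin_l]).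
  assert (H2 : Cmod h < e * (r * r * r) / 2) by (eapply Rlt_le_trans; [exact Hw|apply Rmin_r]).
  assert (Hdh : r / 2 <= Cmod (Cplus d h)).
  { generalize (Cmod_triangle (Cplus d h) (Copp h)). rewrite Cmod_opp.
    replace (Cplus (Cplus d h) (Copp h)) with d by ring. fold r; lra. }
  assert (Hdh0 : Cplus d h <> 0%C) by (apply Cmod_pos_neq_0 with (r / 2); lra).
  cbv beta; fold d. replace (Cminus w z) with (Cplus d h) by (unfold d, h; ring).
  match goal with |- Cmod ?x <= _ => replace x with
    (Cmult h (Cmult h (Cinv (Cmult (Cmult d d) (Cplus d h))))) by (field; auto) end.
  assert (Hdd : Cmult (Cmult d d) (Cplus d h) <> 0%C) by (repeat apply Cmult_neq_0; auto).
  rewrite !Cmod_mult, (Rmult_comm e).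
  apply Rmult_le_compat_l; [apply Cmod_ge_0|].
  rewrite Cmod_inv by auto. rewrite !Cmod_mult. fold r.
  assert (Hp : 0 < r * r * Cmod (Cplus d h)) by (repeat apply Rmult_lt_0_compat; lra).
  apply (Rmult_le_reg_r (r * r * Cmod (Cplus d h))); auto.
  rewrite Rmult_assoc, Rinv_l by lra.
  apply Rle_trans with (e * (r * r * r) / 2); [lra|].
  assert (r * r * (r / 2) <= r * r * Cmod (Cplus d h)) by (apply Rmult_le_compat_l; nra). nra.
Qed.

Lemma cdiff_minus_l c z : cdiff (fun w => Cminus c w) z.
Proof.
  exists (Copp 1%C); intros e He; exists 1; split; [lra|]; intros w _.
  match goal with |- Cmod ?x <= _ => replace x with (RtoC 0) by ring end. rewrite Cmod_0.
  apply Rmult_le_pos; [lra|apply Cmod_ge_0].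
Qed.

Lemma cdiff_pow F z k : cdiff F z -> cdiff (fun w => Cpow (F w) k) z.
Proof.
  intros H; induction k as [|k IH]; simpl; [apply cdiff_const|]. now apply cdiff_mult.
Qed.

(** * Integrals over segments *)

(** Integration is with respect to the parameter, without the derivative of the path: it is 1 on
    horizontal edges, and on vertical ones the factor i is written out in [bd]. *)
Definition CInt (g : R -> C) (a b : R) : C :=
  (RInt (fun t => fst (g t)) a b, RInt (fun t => snd (g t)) a b).

Definition cont_on (g : R -> C) (a b : R) : Prop :=
  forall t, a <= t <= b -> continuous (fun t => fst (g t)) t /\ continuous (fun t => snd (g t)) t.

Lemma cont_on_ex g a b : a <= b -> cont_on g a b ->
  ex_RInt (fun t => fst (g t)) a b /\ ex_RInt (fun t => snd (g t)) a b.
Proof.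
  intros Hab H; split; apply (ex_RInt_continuous (V := R_CompleteNormedModule)); intros t;
    rewrite Rmin_left, Rmax_right by auto; apply H.
Qed.

Lemma cont_on_comp F (ga : R -> C) a b :
  (forall t u, Cmod (Cminus (ga u) (ga t)) <= Rabs (u - t)) ->
  (forall t, a <= t <= b -> ccont F (ga t)) -> cont_on (fun t => F (ga t)) a b.
Proof.
  intros Hga HF t Ht.
  assert (Hpr : forall pr : C -> R, (forall z w, Rabs (pr z - pr w) <= Cmod (Cminus z w)) ->
     continuous (fun t => pr (F (ga t))) t).
  { intros pr Hpr. apply filterlim_locally. intros e.
    destruct (HF t Ht (e / 2)) as [d [Hd Hw]]; [generalize (cond_pos e); lra|].
    exists (mkposreal d Hd). intros u Hu.
    unfold ball in *; simpl in *; unfold AbsRing_ball, abs, minus, plus, opp in *; simpl in *.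
    eapply Rle_lt_trans; [apply Hpr|]. eapply Rle_lt_trans; [apply Hw|generalize (cond_pos e); lra].
    eapply Rle_lt_trans; [apply Hga|exact Hu]. }
  split; apply Hpr; intros z w; (eapply Rle_trans; [|apply Rmax_Cmod]); [apply Rmax_l|apply Rmax_r].
Qed.

Lemma cont_on_sub g a b c d : cont_on g a b -> a <= c -> d <= b -> cont_on g c d.
Proof. intros H Hac Hdb t Ht; apply H; lra. Qed.

Lemma CInt_ext g h a b : a <= b -> (forall t, a <= t <= b -> g t = h t) -> CInt g a b = CInt h a b.
Proof.
  intros Hab H; unfold CInt; f_equal; apply RInt_ext; intros t;
    rewrite Rmin_left, Rmax_right by auto; intros Ht; rewrite H; auto; lra.
Qed.

Lemma CInt_Chasles g a b c : a <= b <= c -> cont_on g a c ->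
  CInt g a c = Cplus (CInt g a b) (CInt g b c).
Proof.
  intros H Hc.
  destruct (cont_on_ex g a b) as [E1 E2]; [lra|eapply cont_on_sub; eauto; lra|].
  destruct (cont_on_ex g b c) as [E3 E4]; [lra|eapply cont_on_sub; eauto; lra|].
  unfold CInt, Cplus; simpl; f_equal; symmetry; apply (RInt_Chasles (V := R_CompleteNormedModule)); auto.
Qed.

Lemma CInt_plus g h a b : a <= b -> cont_on g a b -> cont_on h a b ->
  CInt (fun t => Cplus (g t) (h t)) a b = Cplus (CInt g a b) (CInt h a b).
Proof.
  intros Hab Hg Hh.
  destruct (cont_on_ex g a b Hab Hg) as [E1 E2]. destruct (cont_on_ex h a b Hab Hh) as [E3 E4].
  unfold CInt, Cplus at 3; simpl; f_equal; apply (RInt_plus (V := R_CompleteNormedModule)); auto.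
Qed.

Lemma CInt_scal c g a b : a <= b -> cont_on g a b ->
  CInt (fun t => Cmult c (g t)) a b = Cmult c (CInt g a b).
Proof.
  intros Hab Hg. destruct (cont_on_ex g a b Hab Hg) as [E1 E2].
  assert (S1 := fun k => RInt_scal (V := R_CompleteNormedModule) _ a b k E1).
  assert (S2 := fun k => RInt_scal (V := R_CompleteNormedModule) _ a b k E2).
  assert (X1 := fun k => ex_RInt_scal (V := R_CompleteNormedModule) _ a b k E1).
  assert (X2 := fun k => ex_RInt_scal (V := R_CompleteNormedModule) _ a b k E2).
  unfold CInt, Cmult; simpl; f_equal.
  - rewrite (RInt_minus (V := R_CompleteNormedModule) (fun t => fst c * fst (g t)) (fun t => snd c * snd (g t)));
      [|apply X1|apply X2].
    unfold minus, plus, opp; simpl. unfold scal in *; simpl in *; unfold mult in *; simpl in *.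
    rewrite S1, S2; reflexivity.
  - rewrite (RInt_plus (V := R_CompleteNormedModule) (fun t => fst c * snd (g t)) (fun t => snd c * fst (g t)));
      [|apply X2|apply X1].
    unfold plus; simpl. unfold scal in *; simpl in *; unfold mult in *; simpl in *.
    rewrite S1, S2; reflexivity.
Qed.

Lemma Cmod_le_abs_sum z : Cmod z <= Rabs (fst z) + Rabs (snd z).
Proof.
  unfold Cmod. apply Rsqr_incr_0_var; [|generalize (Rabs_pos (fst z)) (Rabs_pos (snd z)); lra].
  rewrite Rsqr_sqrt by nra. unfold Rsqr.
  generalize (Rabs_pos (fst z)) (Rabs_pos (snd z)); intros.
  assert (E1 := Rsqr_abs (fst z)). assert (E2 := Rsqr_abs (snd z)). unfold Rsqr in *. nra.
Qed.

(* The constant 2 is not sharp: the two components are estimated separately. *)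
Lemma CInt_bound g a b M : a <= b -> cont_on g a b -> (forall t, a <= t <= b -> Cmod (g t) <= M) ->
  Cmod (CInt g a b) <= 2 * ((b - a) * M).
Proof.
  intros Hab Hg HM. destruct (cont_on_ex g a b Hab Hg) as [E1 E2].
  eapply Rle_trans; [apply Cmod_le_abs_sum|]. unfold CInt; simpl.
  assert (Rabs (RInt (fun t => fst (g t)) a b) <= (b - a) * M).
  { apply abs_RInt_le_const; auto. intros t Ht. eapply Rle_trans; [|apply (HM t Ht)].
    eapply Rle_trans; [|apply Rmax_Cmod]; apply Rmax_l. }
  assert (Rabs (RInt (fun t => snd (g t)) a b) <= (b - a) * M).
  { apply abs_RInt_le_const; auto. intros t Ht. eapply Rle_trans; [|apply (HM t Ht)].
    eapply Rle_trans; [|apply Rmax_Cmod]; apply Rmax_r. }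
  lra.
Qed.

(** * Goursat's theorem for rectangles *)

Definition hseg (y : R) : R -> C := fun t => (t, y).
Definition vseg (x : R) : R -> C := fun t => (x, t).

Lemma hseg_lip y t u : Cmod (Cminus (hseg y u) (hseg y t)) <= Rabs (u - t).
Proof.
  eapply Rle_trans; [apply Cmod_le_abs_sum|]. unfold hseg; simpl.
  rewrite Rplus_opp_r, Rabs_R0. unfold Rminus; lra.
Qed.

Lemma vseg_lip x t u : Cmod (Cminus (vseg x u) (vseg x t)) <= Rabs (u - t).
Proof.
  eapply Rle_trans; [apply Cmod_le_abs_sum|]. unfold vseg; simpl.
  rewrite Rplus_opp_r, Rabs_R0. unfold Rminus; lra.
Qed.

Definition HI (F : C -> C) (y a b : R) : C := CInt (fun t => F (hseg y t)) a b.
Definition VI (F : C -> C) (x a b : R) : C := CInt (fun t => F (vseg x t)) a b.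

(** The contour integral over the boundary of the rectangle, counterclockwise: bottom, right, top,
    left. *)
Definition bd (F : C -> C) (x0 x1 y0 y1 : R) : C :=
  Cminus (Cminus (Cplus (HI F y0 x0 x1) (Cmult Ci (VI F x1 y0 y1))) (HI F y1 x0 x1))
         (Cmult Ci (VI F x0 y0 y1)).

Definition onbd (x0 x1 y0 y1 : R) (P : C -> Prop) : Prop :=
  (forall x, x0 <= x <= x1 -> P (x, y0) /\ P (x, y1)) /\
  (forall y, y0 <= y <= y1 -> P (x0, y) /\ P (x1, y)).

Definition inrect (x0 x1 y0 y1 : R) (P : C -> Prop) : Prop :=
  forall x y, x0 <= x <= x1 -> y0 <= y <= y1 -> P (x, y).

Lemma inrect_onbd x0 x1 y0 y1 P : x0 <= x1 -> y0 <= y1 ->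
  inrect x0 x1 y0 y1 P -> onbd x0 x1 y0 y1 P.
Proof. intros Hx Hy H; split; intros t Ht; split; apply H; lra. Qed.

Lemma onbd_impl x0 x1 y0 y1 (P Q : C -> Prop) : (forall z, P z -> Q z) ->
  onbd x0 x1 y0 y1 P -> onbd x0 x1 y0 y1 Q.
Proof. intros H [H1 H2]; split; intros t Ht; split; apply H; [apply H1|apply H1|apply H2|apply H2]; auto. Qed.

Lemma cont_on_hseg F y a b : (forall x, a <= x <= b -> ccont F (x, y)) ->
  cont_on (fun t => F (hseg y t)) a b.
Proof. intros H; apply cont_on_comp; [apply hseg_lip|exact H]. Qed.

Lemma cont_on_vseg F x a b : (forall y, a <= y <= b -> ccont F (x, y)) ->
  cont_on (fun t => F (vseg x t)) a b.
Proof. intros H; apply cont_on_comp; [apply vseg_lip|exact H]. Qed.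

Lemma bd_conts F x0 x1 y0 y1 : onbd x0 x1 y0 y1 (ccont F) ->
  cont_on (fun t => F (hseg y0 t)) x0 x1 /\ cont_on (fun t => F (hseg y1 t)) x0 x1 /\
  cont_on (fun t => F (vseg x0 t)) y0 y1 /\ cont_on (fun t => F (vseg x1 t)) y0 y1.
Proof.
  intros [H1 H2]; split; [|split; [|split]]; (apply cont_on_hseg || apply cont_on_vseg); intros;
    (apply H1 || apply H2); auto.
Qed.

Lemma bd_split_x F x0 x1 x2 y0 y1 : x0 <= x1 <= x2 ->
  (forall x, x0 <= x <= x2 -> ccont F (x, y0) /\ ccont F (x, y1)) ->
  bd F x0 x2 y0 y1 = Cplus (bd F x0 x1 y0 y1) (bd F x1 x2 y0 y1).
Proof.
  intros Hx Hc; unfold bd, HI.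
  rewrite (CInt_Chasles (fun t => F (hseg y0 t)) x0 x1 x2), (CInt_Chasles (fun t => F (hseg y1 t)) x0 x1 x2);
    auto; [ring| |]; apply cont_on_hseg; intros; apply Hc; auto.
Qed.

Lemma bd_split_y F x0 x1 y0 y1 y2 : y0 <= y1 <= y2 ->
  (forall y, y0 <= y <= y2 -> ccont F (x0, y) /\ ccont F (x1, y)) ->
  bd F x0 x1 y0 y2 = Cplus (bd F x0 x1 y0 y1) (bd F x0 x1 y1 y2).
Proof.
  intros Hx Hc; unfold bd, VI.
  rewrite (CInt_Chasles (fun t => F (vseg x0 t)) y0 y1 y2), (CInt_Chasles (fun t => F (vseg x1 t)) y0 y1 y2);
    auto; [ring| |]; apply cont_on_vseg; intros; apply Hc; auto.
Qed.

Lemma bd_ext F G x0 x1 y0 y1 : x0 <= x1 -> y0 <= y1 ->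
  onbd x0 x1 y0 y1 (fun z => F z = G z) -> bd F x0 x1 y0 y1 = bd G x0 x1 y0 y1.
Proof.
  intros Hx Hy [H1 H2]; unfold bd, HI, VI.
  rewrite (CInt_ext (fun t => F (hseg y0 t)) (fun t => G (hseg y0 t)) x0 x1 Hx (fun t Ht => proj1 (H1 t Ht))),
    (CInt_ext (fun t => F (hseg y1 t)) (fun t => G (hseg y1 t)) x0 x1 Hx (fun t Ht => proj2 (H1 t Ht))),
    (CInt_ext (fun t => F (vseg x0 t)) (fun t => G (vseg x0 t)) y0 y1 Hy (fun t Ht => proj1 (H2 t Ht))),
    (CInt_ext (fun t => F (vseg x1 t)) (fun t => G (vseg x1 t)) y0 y1 Hy (fun t Ht => proj2 (H2 t Ht))).
  reflexivity.
Qed.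

Lemma bd_plus F G x0 x1 y0 y1 : x0 <= x1 -> y0 <= y1 ->
  onbd x0 x1 y0 y1 (ccont F) -> onbd x0 x1 y0 y1 (ccont G) ->
  bd (fun z => Cplus (F z) (G z)) x0 x1 y0 y1 = Cplus (bd F x0 x1 y0 y1) (bd G x0 x1 y0 y1).
Proof.
  intros Hx Hy HF HG. destruct (bd_conts F _ _ _ _ HF) as [F1 [F2 [F3 F4]]].
  destruct (bd_conts G _ _ _ _ HG) as [G1 [G2 [G3 G4]]].
  unfold bd, HI, VI.
  rewrite (CInt_plus (fun t => F (hseg y0 t)) (fun t => G (hseg y0 t))),
    (CInt_plus (fun t => F (hseg y1 t)) (fun t => G (hseg y1 t))),
    (CInt_plus (fun t => F (vseg x0 t)) (fun t => G (vseg x0 t))),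
    (CInt_plus (fun t => F (vseg x1 t)) (fun t => G (vseg x1 t))); auto. ring.
Qed.

Lemma bd_scal c F x0 x1 y0 y1 : x0 <= x1 -> y0 <= y1 -> onbd x0 x1 y0 y1 (ccont F) ->
  bd (fun z => Cmult c (F z)) x0 x1 y0 y1 = Cmult c (bd F x0 x1 y0 y1).
Proof.
  intros Hx Hy HF. destruct (bd_conts F _ _ _ _ HF) as [F1 [F2 [F3 F4]]].
  unfold bd, HI, VI.
  rewrite (CInt_scal c (fun t => F (hseg y0 t))), (CInt_scal c (fun t => F (hseg y1 t))),
    (CInt_scal c (fun t => F (vseg x0 t))), (CInt_scal c (fun t => F (vseg x1 t))); auto. ring.
Qed.

(** Twice the perimeter times [M]; the factor 2 is that of [CInt_bound]. *)
Lemma bd_bound F x0 x1 y0 y1 M : x0 <= x1 -> y0 <= y1 -> onbd x0 x1 y0 y1 (ccont F) ->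
  onbd x0 x1 y0 y1 (fun z => Cmod (F z) <= M) ->
  Cmod (bd F x0 x1 y0 y1) <= 4 * ((x1 - x0) + (y1 - y0)) * M.
Proof.
  intros Hx Hy HF [M1 M2]. destruct (bd_conts F _ _ _ _ HF) as [F1 [F2 [F3 F4]]].
  assert (B1 := CInt_bound _ _ _ M Hx F1 (fun t Ht => proj1 (M1 t Ht))).
  assert (B2 := CInt_bound _ _ _ M Hx F2 (fun t Ht => proj2 (M1 t Ht))).
  assert (B3 := CInt_bound _ _ _ M Hy F3 (fun t Ht => proj1 (M2 t Ht))).
  assert (B4 := CInt_bound _ _ _ M Hy F4 (fun t Ht => proj2 (M2 t Ht))).
  unfold bd, HI, VI, Cminus.
  eapply Rle_trans; [apply Cmod_triangle|]. eapply Rle_trans; [apply Rplus_le_compat_r, Cmod_triangle|].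
  eapply Rle_trans; [apply Rplus_le_compat_r, Rplus_le_compat_r, Cmod_triangle|].
  rewrite !Cmod_opp, !Cmod_mult, Cmod_Ci, !Rmult_1_l. lra.
Qed.

Lemma RInt_id a b : RInt (fun t => t) a b = (b * b - a * a) / 2.
Proof.
  apply is_RInt_unique.
  replace ((b * b - a * a) / 2) with (minus (b * b / 2) (a * a / 2))
    by (unfold minus, plus, opp; simpl; field).
  apply (is_RInt_derive (fun t => t * t / 2)); intros t _; [auto_derive; auto; field|apply continuous_id].
Qed.

Lemma bd_affine al be x0 x1 y0 y1 : x0 <= x1 -> y0 <= y1 ->
  bd (fun z => Cplus al (Cmult be z)) x0 x1 y0 y1 = 0%C.
Proof.
  intros Hx Hy.
  assert (Hc : forall F, (forall z, cdiff F z) -> onbd x0 x1 y0 y1 (ccont F)).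
  { intros F HF; split; intros; split; apply cdiff_ccont, HF. }
  rewrite (bd_plus (fun _ => al) (fun z => Cmult be z)), (bd_scal be (fun z => z)); auto.
  - assert (E1 : bd (fun _ => al) x0 x1 y0 y1 = 0%C).
    { unfold bd, HI, VI, CInt. rewrite !RInt_const. unfold scal; simpl; unfold mult; simpl.
      destruct al as [a1 a2]. apply injective_projections; simpl; ring. }
    assert (E2 : bd (fun z => z) x0 x1 y0 y1 = 0%C).
    { unfold bd, HI, VI, CInt, hseg, vseg; simpl. rewrite !RInt_const, !RInt_id.
      unfold scal; simpl; unfold mult; simpl. apply injective_projections; simpl; field. }
    rewrite E1, E2; ring.
  - apply Hc, cdiff_id.
  - apply Hc, cdiff_const.
  - apply Hc; intros z; apply cdiff_mult; [apply cdiff_const|apply cdiff_id].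
Qed.

Record rect := Rect { rx0 : R; rx1 : R; ry0 : R; ry1 : R }.

Definition bdr F (Q : rect) : C := bd F (rx0 Q) (rx1 Q) (ry0 Q) (ry1 Q).
Definition inr (Q : rect) : (C -> Prop) -> Prop := inrect (rx0 Q) (rx1 Q) (ry0 Q) (ry1 Q).
Definition subr (q Q : rect) : Prop :=
  rx0 Q <= rx0 q /\ rx0 q <= rx1 q /\ rx1 q <= rx1 Q /\
  ry0 Q <= ry0 q /\ ry0 q <= ry1 q /\ ry1 q <= ry1 Q.

Lemma inr_sub q Q P : subr q Q -> inr Q P -> inr q P.
Proof. unfold subr, inr, inrect; intros H HP x y Hx Hy; apply HP; lra. Qed.

Lemma Cmod_sum4_ge a b c d : exists z, (z = a \/ z = b \/ z = c \/ z = d) /\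
  Cmod (Cplus (Cplus a b) (Cplus c d)) <= 4 * Cmod z.
Proof.
  assert (H : Cmod (Cplus (Cplus a b) (Cplus c d)) <= Cmod a + Cmod b + (Cmod c + Cmod d)).
  { eapply Rle_trans; [apply Cmod_triangle|]. apply Rplus_le_compat; apply Cmod_triangle. }
  destruct (Rle_dec (Cmod a) (Cmod b)), (Rle_dec (Cmod c) (Cmod d)).
  - destruct (Rle_dec (Cmod b) (Cmod d)); [exists d|exists b]; split; auto; lra.
  - destruct (Rle_dec (Cmod b) (Cmod c)); [exists c|exists b]; split; auto; lra.
  - destruct (Rle_dec (Cmod a) (Cmod d)); [exists d|exists a]; split; auto; lra.
  - destruct (Rle_dec (Cmod a) (Cmod c)); [exists c|exists a]; split; auto; lra.
Qed.

Lemma quarter_rect F Q : rx0 Q <= rx1 Q -> ry0 Q <= ry1 Q -> inr Q (ccont F) ->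
  exists q, subr q Q /\ rx1 q - rx0 q = (rx1 Q - rx0 Q) / 2 /\ ry1 q - ry0 q = (ry1 Q - ry0 Q) / 2 /\
    Cmod (bdr F Q) <= 4 * Cmod (bdr F q).
Proof.
  destruct Q as [x0 x1 y0 y1]; unfold bdr, inr, subr; simpl; intros Hx Hy Hc.
  set (x := (x0 + x1) / 2). set (y := (y0 + y1) / 2).
  assert (E : bd F x0 x1 y0 y1 = Cplus (Cplus (bd F x0 x y0 y) (bd F x0 x y y1))
                                       (Cplus (bd F x x1 y0 y) (bd F x x1 y y1))).
  { rewrite (bd_split_x F x0 x x1); [|unfold x; lra|intros; split; apply Hc; lra].
    f_equal; apply bd_split_y; try (unfold y; lra); intros; split; apply Hc; unfold x in *; lra. }
  rewrite E.
  destruct (Cmod_sum4_ge (bd F x0 x y0 y) (bd F x0 x y y1) (bd F x x1 y0 y) (bd F x x1 y y1))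
    as [z [Hz Hm]].
  destruct Hz as [->|[->|[->| ->]]];
    [exists (Rect x0 x y0 y)|exists (Rect x0 x y y1)|exists (Rect x x1 y0 y)|exists (Rect x x1 y y1)];
    simpl; (split; [unfold x, y; lra|split; [unfold x; lra|split; [unfold y; lra|auto]]]).
Qed.

Lemma nested_point (a b : nat -> R) : (forall n, a n <= a (S n)) -> (forall n, b (S n) <= b n) ->
  (forall n, a n <= b n) -> exists x, forall n, a n <= x <= b n.
Proof.
  intros Ha Hb Hab.
  assert (Ha' : forall n k, a n <= a (n + k)%nat).
  { intros n k; induction k as [|k IH]; [rewrite Nat.add_0_r; lra|].
    rewrite Nat.add_succ_r. generalize (Ha (n + k)%nat); lra. }
  assert (Hb' : forall n k, b (n + k)%nat <= b n).
  { intros n k; induction k as [|k IH]; [rewrite Nat.add_0_r; lra|].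
    rewrite Nat.add_succ_r. generalize (Hb (n + k)%nat); lra. }
  assert (H : forall n m, a n <= b m).
  { intros n m. generalize (Ha' n m) (Hab (n + m)%nat) (Hb' m n). rewrite (Nat.add_comm m n). lra. }
  destruct (completeness (fun x => exists n, x = a n)) as [l [Hl1 Hl2]].
  - exists (b 0%nat); intros x [n ->]; auto.
  - exists (a 0%nat); now exists 0%nat.
  - exists l; intros n; split; [apply Hl1; now exists n|]. apply Hl2; intros x [m ->]; auto.
Qed.

(** Quartering argument: on the n-th rectangle F differs from its tangent affine map at the limit
    point by o(2^(-n)), and the boundary has length of order 2^(-n); together these beat the growth
    4^n. *)
Theorem goursat F x0 x1 y0 y1 : x0 <= x1 -> y0 <= y1 ->
  inrect x0 x1 y0 y1 (cdiff F) -> bd F x0 x1 y0 y1 = 0%C.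
Proof.
  intros Hx Hy HF.
  set (Q0 := Rect x0 x1 y0 y1).
  (* Choice needs a successor for every rectangle, so [Q] itself is the default where the conditions
     fail. *)
  assert (Hnext : forall Q, exists q, rx0 Q <= rx1 Q -> ry0 Q <= ry1 Q -> inr Q (ccont F) ->
    subr q Q /\ rx1 q - rx0 q = (rx1 Q - rx0 Q) / 2 /\ ry1 q - ry0 q = (ry1 Q - ry0 Q) / 2 /\
    Cmod (bdr F Q) <= 4 * Cmod (bdr F q)).
  { intros Q. destruct (classic (rx0 Q <= rx1 Q /\ ry0 Q <= ry1 Q /\ inr Q (ccont F))) as [[H1 [H2 H3]]|H].
    - destruct (quarter_rect F Q H1 H2 H3) as [q Hq]; exists q; auto.
    - exists Q; tauto. }
  destruct (functional_choice _ Hnext) as [next Hn].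
  set (Qs := fun n => Nat.iter n next Q0).
  assert (HC : inr Q0 (ccont F)) by (intros x y H1 H2; apply cdiff_ccont, HF; auto).
  assert (Inv : forall n, rx0 (Qs n) <= rx1 (Qs n) /\ ry0 (Qs n) <= ry1 (Qs n) /\ inr (Qs n) (ccont F)).
  { induction n as [|n [I1 [I2 I3]]]; [simpl; auto|].
    change (Qs (S n)) with (next (Qs n)). destruct (Hn (Qs n) I1 I2 I3) as [S _].
    repeat split; [apply S|apply S|now apply inr_sub with (Qs n)]. }
  assert (Step : forall n, subr (Qs (S n)) (Qs n) /\
     rx1 (Qs (S n)) - rx0 (Qs (S n)) = (rx1 (Qs n) - rx0 (Qs n)) / 2 /\
     ry1 (Qs (S n)) - ry0 (Qs (S n)) = (ry1 (Qs n) - ry0 (Qs n)) / 2 /\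
     Cmod (bdr F (Qs n)) <= 4 * Cmod (bdr F (Qs (S n)))).
  { intros n. destruct (Inv n) as [I1 [I2 I3]]. exact (Hn (Qs n) I1 I2 I3). }
  set (W := x1 - x0). set (H := y1 - y0).
  assert (Size : forall n, rx1 (Qs n) - rx0 (Qs n) = W * (/ 2) ^ n /\ ry1 (Qs n) - ry0 (Qs n) = H * (/ 2) ^ n
     /\ Cmod (bdr F Q0) <= 4 ^ n * Cmod (bdr F (Qs n))).
  { induction n as [|n [I1 [I2 I3]]]; [simpl; unfold W, H, bdr; simpl; lra|].
    destruct (Step n) as [_ [S1 [S2 S3]]]. rewrite S1, S2, I1, I2.
    cbn [pow]. repeat split; [field|field|].
    eapply Rle_trans; [exact I3|]. rewrite (Rmult_comm 4), Rmult_assoc.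
    apply Rmult_le_compat_l; [apply pow_le; lra|exact S3]. }
  destruct (nested_point (fun n => rx0 (Qs n)) (fun n => rx1 (Qs n))) as [X HX].
  1,2: intros n; destruct (Step n) as [S _]; unfold subr in S; lra.
  { intros n; apply Inv. }
  destruct (nested_point (fun n => ry0 (Qs n)) (fun n => ry1 (Qs n))) as [Y HY].
  1,2: intros n; destruct (Step n) as [S _]; unfold subr in S; lra.
  { intros n; apply Inv. }
  assert (HW : 0 <= W) by (unfold W; lra). assert (HH : 0 <= H) by (unfold H; lra).
  apply Cmod_eq_0. apply Rle_antisym; [|apply Cmod_ge_0].
  apply le_epsilon; intros eps Heps. rewrite Rplus_0_l.
  destruct (HF X Y (HX 0%nat) (HY 0%nat)) as [l Hl].
  (* Chosen so that the final bound 4 (W + H)^2 e is at most [eps]; the added 1 keeps the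
     denominator positive. *)
  set (e := eps / (4 * (W + H + 1) * (W + H + 1))).
  assert (He : 0 < e).
  { apply Rdiv_lt_0_compat; auto. repeat apply Rmult_lt_0_compat; lra. }
  destruct (Hl e He) as [d [Hd Hw]].
  destruct (pow_lt_1_zero (/ 2)) with (y := d / (W + H + 1)) as [n Hnn].
  { rewrite Rabs_right; lra. }
  { apply Rdiv_lt_0_compat; lra. }
  specialize (Hnn n (le_n _)). rewrite Rabs_right in Hnn by (apply Rle_ge, pow_le; lra).
  set (r := (/ 2) ^ n) in *. assert (Hr : 0 < r) by (apply pow_lt; lra).
  assert (Hrd : (W + H) * r < d).
  { apply Rle_lt_trans with ((W + H + 1) * r); [nra|].
    apply Rlt_le_trans with ((W + H + 1) * (d / (W + H + 1))); [apply Rmult_lt_compat_l; lra|].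
    right; field; lra. }
  destruct (Size n) as [S1 [S2 S3]]. fold r in S1, S2.
  destruct (Inv n) as [I1 [I2 I3]].
  set (Z := (X, Y) : C) in *.
  (* Tangent map of [F] at [Z]. Its boundary integral vanishes, so [F] may be replaced by the
     remainder [G]. *)
  set (A := fun z : C => Cplus (Cminus (F Z) (Cmult l Z)) (Cmult l z)).
  set (G := fun z : C => Cplus (F z) (Cmult (Copp 1%C) (A z))).
  assert (HA : forall z, cdiff A z).
  { intros z; apply cdiff_plus; [apply cdiff_const|]. apply cdiff_mult; [apply cdiff_const|apply cdiff_id]. }
  assert (Hsubn : subr (Qs n) Q0).
  { clear -Step Hx Hy; induction n as [|n IH]; [unfold subr; simpl; lra|].
    destruct (Step n) as [S _]; unfold subr in *; lra. }
  assert (HGd : inr (Qs n) (cdiff G)).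
  { intros x y Hxx Hyy. apply cdiff_plus.
    - apply (inr_sub _ _ _ Hsubn HF x y Hxx Hyy).
    - apply cdiff_mult; [apply cdiff_const|apply HA]. }
  assert (HGc : inr (Qs n) (ccont G)) by (intros x y Hxx Hyy; apply cdiff_ccont, HGd; auto).
  assert (HAc : inr (Qs n) (ccont A)) by (intros x y _ _; apply cdiff_ccont, HA).
  assert (E : bdr F (Qs n) = bdr G (Qs n)).
  { unfold bdr. rewrite (bd_ext F (fun z => Cplus (G z) (A z))); auto.
    - rewrite bd_plus; auto; try (apply inrect_onbd; auto).
      unfold A at 1. rewrite bd_affine by auto. ring.
    - apply inrect_onbd; auto. intros x y _ _. unfold G. ring. }
  assert (B : Cmod (bdr G (Qs n)) <= 4 * (W * r + H * r) * (e * ((W + H) * r))).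
  { unfold bdr. rewrite <- S1, <- S2. apply bd_bound; auto; try (apply inrect_onbd; auto).
    intros x y Hxx Hyy.
    assert (Hd1 : Cmod (Cminus (x, y) Z) <= (W + H) * r).
    { eapply Rle_trans; [apply Cmod_le_abs_sum|]. unfold Z; simpl.
      specialize (HX n); specialize (HY n).
      assert (Rabs (x + - X) <= W * r) by (apply Rabs_le; lra).
      assert (Rabs (y + - Y) <= H * r) by (apply Rabs_le; lra). lra. }
    replace (G (x, y)) with (Cminus (Cminus (F (x, y)) (F Z)) (Cmult l (Cminus (x, y) Z)))
      by (unfold G, A; ring).
    eapply Rle_trans; [apply Hw; lra|]. apply Rmult_le_compat_l; lra. }
  change (bd F x0 x1 y0 y1) with (bdr F Q0).
  eapply Rle_trans; [exact S3|]. rewrite E.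
  assert (E4 : 4 ^ n * (r * r) = 1).
  { unfold r. rewrite <- !Rpow_mult_distr. replace (4 * (/ 2 * / 2)) with 1 by field. apply pow1. }
  apply Rle_trans with (4 ^ n * (4 * (W * r + H * r) * (e * ((W + H) * r)))).
  { apply Rmult_le_compat_l; [apply pow_le; lra|exact B]. }
  replace (4 ^ n * (4 * (W * r + H * r) * (e * ((W + H) * r))))
    with (4 ^ n * (r * r) * (4 * (W + H) * (W + H) * e)) by ring.
  rewrite E4, Rmult_1_l.
  apply Rle_trans with (4 * (W + H + 1) * (W + H + 1) * e).
  - apply Rmult_le_compat_r; [lra|]. nra.
  - right; unfold e; field; lra.
Qed.

(** * Cauchy's integral formula *)

Definition cauchy_kernel (phi : C -> C) (z : C) : C -> C := fun lam => Cmult (phi lam) (Cinv (Cminus lam z)).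

Lemma cdiff_cauchy_kernel phi z lam : cdiff phi lam -> lam <> z -> cdiff (cauchy_kernel phi z) lam.
Proof. intros H Hne; apply cdiff_mult; auto. now apply cdiff_inv_minus. Qed.

Lemma cauchy_outside phi z x0 x1 y0 y1 : x0 <= x1 -> y0 <= y1 ->
  inrect x0 x1 y0 y1 (cdiff phi) -> inrect x0 x1 y0 y1 (fun w => w <> z) ->
  bd (cauchy_kernel phi z) x0 x1 y0 y1 = 0%C.
Proof.
  intros Hx Hy Hd Hne. apply goursat; auto. intros x y H1 H2.
  apply cdiff_cauchy_kernel; [now apply Hd|now apply Hne].
Qed.

Lemma sqr_plus_sqr_neq_0 u e : 0 < e -> u * u + e * e <> 0.
Proof. intros He; apply Rgt_not_eq; nra. Qed.

(** The primitive is s atan((t - c) / e), with atan running from -pi/4 to pi/4: a side of a square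
    is seen from its centre under a right angle. *)
Lemma RInt_atan_kernel s c e : 0 < e ->
  RInt (fun t => s * e / ((t - c) * (t - c) + e * e)) (c - e) (c + e) = s * (PI / 2).
Proof.
  intros He. apply is_RInt_unique.
  replace (s * (PI / 2)) with (minus (s * atan ((c + e - c) / e)) (s * atan ((c - e - c) / e))).
  2:{ replace ((c + e - c) / e) with 1 by (field; lra).
      replace ((c - e - c) / e) with (- (1)) by (field; lra).
      rewrite atan_opp, atan_1. unfold minus, plus, opp; simpl; field. }
  apply (is_RInt_derive (fun t => s * atan ((t - c) / e))); intros t _.
  - auto_derive; auto. field. split; [now apply sqr_plus_sqr_neq_0|lra].
  - apply (ex_derive_continuous (fun t => s * e / ((t - c) * (t - c) + e * e))).
    auto_derive. now apply sqr_plus_sqr_neq_0.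
Qed.

(** By symmetry the real parts cancel between opposite sides, and each of the four sides contributes
    pi/2 to the imaginary part. *)
Lemma bd_inv_square (z : C) e : 0 < e ->
  bd (fun lam => Cinv (Cminus lam z)) (fst z - e) (fst z + e) (snd z - e) (snd z + e)
  = (0, 2 * PI).
Proof.
  intros He. destruct z as [a b]; simpl fst; simpl snd.
  unfold bd, HI, VI, CInt, hseg, vseg.
  set (B1 := RInt (fun t => fst (Cinv (Cminus (t, b - e) (a, b)))) (a - e) (a + e)).
  set (B2 := RInt (fun t => snd (Cinv (Cminus (t, b - e) (a, b)))) (a - e) (a + e)).
  set (T1 := RInt (fun t => fst (Cinv (Cminus (t, b + e) (a, b)))) (a - e) (a + e)).
  set (T2 := RInt (fun t => snd (Cinv (Cminus (t, b + e) (a, b)))) (a - e) (a + e)).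
  set (R1 := RInt (fun t => fst (Cinv (Cminus (a + e, t) (a, b)))) (b - e) (b + e)).
  set (R2 := RInt (fun t => snd (Cinv (Cminus (a + e, t) (a, b)))) (b - e) (b + e)).
  set (L1 := RInt (fun t => fst (Cinv (Cminus (a - e, t) (a, b)))) (b - e) (b + e)).
  set (L2 := RInt (fun t => snd (Cinv (Cminus (a - e, t) (a, b)))) (b - e) (b + e)).
  assert (E1 : B1 = T1).
  { apply RInt_ext; intros t _; simpl. f_equal. ring. }
  assert (E2 : R2 = L2).
  { apply RInt_ext; intros t _; simpl. f_equal. ring. }
  assert (F1 : B2 = 1 * (PI / 2)).
  { rewrite <- (RInt_atan_kernel 1 a e He). apply RInt_ext; intros t _; simpl. field.
    now apply sqr_plus_sqr_neq_0. }
  assert (F2 : T2 = -1 * (PI / 2)).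
  { rewrite <- (RInt_atan_kernel (-1) a e He). apply RInt_ext; intros t _; simpl. field.
    now apply sqr_plus_sqr_neq_0. }
  assert (F3 : R1 = 1 * (PI / 2)).
  { rewrite <- (RInt_atan_kernel 1 b e He). apply RInt_ext; intros t _; simpl. field.
    now apply sqr_plus_sqr_neq_0. }
  assert (F4 : L1 = -1 * (PI / 2)).
  { rewrite <- (RInt_atan_kernel (-1) b e He). apply RInt_ext; intros t _; simpl. field.
    now apply sqr_plus_sqr_neq_0. }
  unfold Ci. apply injective_projections; simpl; rewrite ?E1, ?E2, ?F1, ?F2, ?F3, ?F4; field.
Qed.

Lemma pair_neq (x y : R) (z : C) : x <> fst z \/ y <> snd z -> ((x, y) : C) <> z.
Proof. intros H E; subst; simpl in H; tauto. Qed.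

(** The contour is shrunk to a small square around [z]. There the constant part phi(z) gives 2 pi i
    phi(z), and the difference quotient of [phi] is bounded, so that it contributes O(e). *)
Lemma cauchy_inside phi z x0 x1 y0 y1 : x0 < fst z < x1 -> y0 < snd z < y1 ->
  inrect x0 x1 y0 y1 (cdiff phi) ->
  bd (cauchy_kernel phi z) x0 x1 y0 y1 = Cmult (0, 2 * PI) (phi z).
Proof.
  intros Hx Hy Hd. destruct z as [a b]; simpl in Hx, Hy. set (z := (a, b) : C).
  assert (Hk : forall x y, x0 <= x <= x1 -> y0 <= y <= y1 -> x <> a \/ y <> b ->
     cdiff (cauchy_kernel phi z) (x, y)).
  { intros x y H1 H2 Hne. apply cdiff_cauchy_kernel; [now apply Hd|]. now apply pair_neq. }
  assert (Hsmall : forall e, 0 < e -> x0 <= a - e -> a + e <= x1 -> y0 <= b - e -> b + e <= y1 ->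
    bd (cauchy_kernel phi z) x0 x1 y0 y1 = bd (cauchy_kernel phi z) (a - e) (a + e) (b - e) (b + e)).
  { intros e He A1 A2 A3 A4. set (F := cauchy_kernel phi z).
    (* Four rectangles are cut off, left, right, bottom and top; each avoids [z] and contributes
       0. *)
    assert (Z : forall u0 u1 v0 v1, x0 <= u0 -> u0 <= u1 -> u1 <= x1 -> y0 <= v0 -> v0 <= v1 -> v1 <= y1 ->
       (u1 < a \/ a < u0 \/ v1 < b \/ b < v0) -> bd F u0 u1 v0 v1 = 0%C).
    { intros u0 u1 v0 v1 U0 U1 U2 V0 V1 V2 Hout. apply goursat; auto.
      intros x y H1 H2; apply Hk; lra. }
    rewrite (bd_split_x F x0 (a - e) x1); [|lra|intros; split; apply cdiff_ccont, Hk; lra].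
    rewrite (Z x0 (a - e)) by lra.
    rewrite (bd_split_x F (a - e) (a + e) x1); [|lra|intros; split; apply cdiff_ccont, Hk; lra].
    rewrite (Z (a + e) x1) by lra.
    rewrite (bd_split_y F (a - e) (a + e) y0 (b - e) y1);
      [|lra|intros; split; apply cdiff_ccont, Hk; lra].
    rewrite (Z (a - e) (a + e) y0 (b - e)) by lra.
    rewrite (bd_split_y F (a - e) (a + e) (b - e) (b + e) y1);
      [|lra|intros; split; apply cdiff_ccont, Hk; lra].
    rewrite (Z (a - e) (a + e) (b + e) y1) by lra. ring. }
  assert (Hz : cdiff phi z) by (apply Hd; lra).
  destruct Hz as [l Hl]. destruct (cderiv_bound phi z l Hl) as [d [Hdp Hw]].
  generalize (Cmod_ge_0 l); intros Hl0.
  assert (Hgoal : Cminus (bd (cauchy_kernel phi z) x0 x1 y0 y1) (Cmult (0, 2 * PI) (phi z)) = 0%C).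
  2:{ replace (bd (cauchy_kernel phi z) x0 x1 y0 y1) with
       (Cplus (Cminus (bd (cauchy_kernel phi z) x0 x1 y0 y1) (Cmult (0, 2 * PI) (phi z)))
          (Cmult (0, 2 * PI) (phi z))) by ring. rewrite Hgoal; ring. }
  apply Cmod_eq_0, Rle_antisym; [|apply Cmod_ge_0]. apply le_epsilon; intros eps Heps.
  rewrite Rplus_0_l.
  set (e1 := Rmin (Rmin (a - x0) (x1 - a)) (Rmin (b - y0) (y1 - b))).
  (* The points of the square are within 2 e of [z], so d / 3 keeps them in the disc of the
     derivative bound; the second term matches the estimate 4 (2 e + 2 e) (|l| + 1). *)
  set (e2 := Rmin (d / 3) (eps / (16 * (Cmod l + 1)))).
  set (e := Rmin e1 e2).
  assert (He2 : 0 < eps / (16 * (Cmod l + 1))) by (apply Rdiv_lt_0_compat; lra).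
  assert (He : 0 < e) by (repeat apply Rmin_pos; lra).
  assert (Hm := conj (Rmin_l e1 e2) (conj (Rmin_r e1 e2)
     (conj (conj (Rmin_l (Rmin (a - x0) (x1 - a)) (Rmin (b - y0) (y1 - b)))
     (Rmin_r (Rmin (a - x0) (x1 - a)) (Rmin (b - y0) (y1 - b))))
     (conj (conj (Rmin_l (a - x0) (x1 - a)) (Rmin_r (a - x0) (x1 - a)))
     (conj (conj (Rmin_l (b - y0) (y1 - b)) (Rmin_r (b - y0) (y1 - b)))
     (conj (Rmin_l (d / 3) (eps / (16 * (Cmod l + 1)))) (Rmin_r (d / 3) (eps / (16 * (Cmod l + 1)))))))))).
  fold e1 e2 e in Hm.
  rewrite (Hsmall e) by lra.
  set (q1 := fun lam => Cinv (Cminus lam z)).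
  set (G := fun lam => Cmult (Cplus (phi lam) (Copp (phi z))) (q1 lam)).
  assert (Hnz : onbd (a - e) (a + e) (b - e) (b + e) (fun lam => lam <> z)).
  { split; intros; split; apply pair_neq; simpl; lra. }
  assert (Hq1 : onbd (a - e) (a + e) (b - e) (b + e) (cdiff q1)).
  { eapply onbd_impl; [|exact Hnz]. intros w Hwz. now apply cdiff_inv_minus. }
  assert (Hphi : onbd (a - e) (a + e) (b - e) (b + e) (cdiff phi)).
  { apply inrect_onbd; try lra. intros x y H1 H2; apply Hd; lra. }
  assert (HG : onbd (a - e) (a + e) (b - e) (b + e) (ccont G)).
  { destruct Hq1 as [Q1 Q2], Hphi as [P1 P2].
    split; intros t Ht; split; apply cdiff_ccont, cdiff_mult;
      try apply cdiff_plus; try apply cdiff_const;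
      first [apply (P1 t Ht)|apply (P2 t Ht)|apply (Q1 t Ht)|apply (Q2 t Ht)]. }
  rewrite (bd_ext (cauchy_kernel phi z) (fun lam => Cplus (G lam) (Cmult (phi z) (q1 lam)))); try lra.
  2:{ eapply onbd_impl; [|exact Hnz]. intros w _. unfold cauchy_kernel, G, q1. ring. }
  assert (Hq1c : onbd (a - e) (a + e) (b - e) (b + e) (ccont q1))
    by (eapply onbd_impl; [|exact Hq1]; apply cdiff_ccont).
  rewrite bd_plus; try lra; auto.
  2:{ destruct Hq1 as [Q1 Q2]. split; intros t Ht; split; apply cdiff_ccont, cdiff_mult;
      try apply cdiff_const; first [apply (Q1 t Ht)|apply (Q2 t Ht)]. }
  rewrite (bd_scal (phi z) q1); try lra; auto.
  assert (E := bd_inv_square z e He). simpl in E. unfold q1 at 1. rewrite E.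
  match goal with |- Cmod ?x <= _ => replace x with (bd G (a - e) (a + e) (b - e) (b + e)) by ring end.
  assert (B := bd_bound G (a - e) (a + e) (b - e) (b + e) (Cmod l + 1) ltac:(lra) ltac:(lra) HG).
  eapply Rle_trans; [apply B|].
  - assert (HGb : forall x y, a - e <= x <= a + e -> b - e <= y <= b + e ->
      ((x, y) : C) <> z -> Cmod (G (x, y)) <= Cmod l + 1).
    { intros x y H1 H2 Hne.
      assert (Hn0 : Cminus (x, y) z <> 0%C).
      { intros E0; apply Hne. replace ((x, y) : C) with (Cplus (Cminus (x, y) z) z) by ring.
        rewrite E0; ring. }
      assert (Hn1 : 0 < Cmod (Cminus (x, y) z)) by now apply Cmod_gt_0.
      unfold G, q1. rewrite Cmod_mult, Cmod_inv by auto.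
      apply (Rmult_le_reg_r (Cmod (Cminus (x, y) z))); auto.
      rewrite Rmult_assoc, Rinv_l, Rmult_1_r by lra. apply Hw.
      eapply Rle_lt_trans; [apply Cmod_le_abs_sum|]. unfold z; simpl.
      assert (Rabs (x + - a) <= e) by (apply Rabs_le; lra).
      assert (Rabs (y + - b) <= e) by (apply Rabs_le; lra). lra. }
    destruct Hnz as [N1 N2].
    split; intros t Ht; split; apply HGb; try lra; first [apply (N1 t Ht)|apply (N2 t Ht)].
  - apply Rle_trans with (16 * (Cmod l + 1) * e); [right; ring|].
    apply Rle_trans with (16 * (Cmod l + 1) * (eps / (16 * (Cmod l + 1)))).
    + apply Rmult_le_compat_l; lra.
    + right; field; lra.
Qed.

(** * Edge integrals of the Cauchy kernel *)

Lemma cont_on_bounded g a b : a <= b -> cont_on g a b ->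
  exists M, 0 <= M /\ forall t, a <= t <= b -> Cmod (g t) <= M.
Proof.
  intros Hab Hg.
  set (h := fun t => Rabs (fst (g t)) + Rabs (snd (g t))).
  destruct (continuity_ab_maj h a b Hab) as [m [Hm _]].
  - intros t Ht. destruct (Hg t Ht) as [C1 C2].
    apply continuity_pt_filterlim.
    apply (continuous_plus (V := R_NormedModule) (fun t => Rabs (fst (g t))) (fun t => Rabs (snd (g t)))).
    + apply (continuous_comp (fun t => fst (g t)) Rabs); [exact C1|apply continuous_Rabs].
    + apply (continuous_comp (fun t => snd (g t)) Rabs); [exact C2|apply continuous_Rabs].
  - exists (h m); split.
    + unfold h; generalize (Rabs_pos (fst (g m))) (Rabs_pos (snd (g m))); lra.
    + intros t Ht. eapply Rle_trans; [apply Cmod_le_abs_sum|]. now apply Hm.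
Qed.

Definition edge_int (phi : C -> C) (ga : R -> C) (a b : R) (z : C) : C :=
  CInt (fun t => cauchy_kernel phi z (ga t)) a b.

Definition lip1 (ga : R -> C) : Prop := forall t u, Cmod (Cminus (ga u) (ga t)) <= Rabs (u - t).

Lemma far_neq (u v : C) d : 0 < d -> d <= Cmod (Cminus u v) -> u <> v.
Proof.
  intros Hd H ->. replace (Cminus v v) with (RtoC 0) in H by ring. rewrite Cmod_0 in H; lra.
Qed.

(** The kernels at [w] and [z] differ by phi(lam) (w - z) / ((lam - w) (lam - z)), and |lam - w| >=
    d / 2 for [w] close to [z]. *)
Lemma edge_int_ccont phi ga a b z d : a <= b -> lip1 ga -> 0 < d ->
  (forall t, a <= t <= b -> cdiff phi (ga t)) ->
  (forall t, a <= t <= b -> d <= Cmod (Cminus (ga t) z)) ->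
  ccont (edge_int phi ga a b) z.
Proof.
  intros Hab Hlip Hd Hphi Hfar.
  assert (Hcomp : forall F, (forall t, a <= t <= b -> cdiff F (ga t)) -> cont_on (fun t => F (ga t)) a b).
  { intros F HF; apply cont_on_comp; auto. intros t Ht; apply cdiff_ccont, HF, Ht. }
  destruct (cont_on_bounded (fun t => phi (ga t)) a b Hab (Hcomp phi Hphi)) as [M [HM HMb]].
  intros eps Heps.
  set (K := 2 * ((b - a) * (M * (2 / (d * d))))).
  assert (Hdd : 0 < d * d) by nra.
  assert (HK : 0 <= K).
  { apply Rmult_le_pos; [lra|]. apply Rmult_le_pos; [lra|]. apply Rmult_le_pos; auto.
    apply Rdiv_le_0_compat; lra. }
  exists (Rmin (d / 2) (eps / (K + 1))); split.
  { apply Rmin_pos; [lra|]. apply Rdiv_lt_0_compat; lra. }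
  intros w Hw.
  assert (W1 : Cmod (Cminus w z) < d / 2) by (eapply Rlt_le_trans; [exact Hw|apply Rmin_l]).
  assert (W2 : Cmod (Cminus w z) < eps / (K + 1)) by (eapply Rlt_le_trans; [exact Hw|apply Rmin_r]).
  set (h := Cmod (Cminus w z)) in *.
  assert (Hfw : forall t, a <= t <= b -> d / 2 <= Cmod (Cminus (ga t) w)).
  { intros t Ht. specialize (Hfar t Ht).
    generalize (Cmod_triangle (Cminus (ga t) w) (Cminus w z)).
    replace (Cplus (Cminus (ga t) w) (Cminus w z)) with (Cminus (ga t) z) by ring. fold h; lra. }
  set (D := fun lam => Cplus (cauchy_kernel phi w lam) (Cmult (Copp 1) (cauchy_kernel phi z lam))).
  assert (Kw : forall t, a <= t <= b -> cdiff (cauchy_kernel phi w) (ga t)).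
  { intros t Ht; apply cdiff_cauchy_kernel; auto. apply far_neq with (d / 2); [lra|auto]. }
  assert (Kz : forall t, a <= t <= b -> cdiff (cauchy_kernel phi z) (ga t)).
  { intros t Ht; apply cdiff_cauchy_kernel; auto. apply far_neq with d; auto. }
  assert (Kz' : forall t, a <= t <= b -> cdiff (fun lam => Cmult (Copp 1) (cauchy_kernel phi z lam)) (ga t)).
  { intros t Ht; apply cdiff_mult; [apply cdiff_const|auto]. }
  assert (E : Cminus (edge_int phi ga a b w) (edge_int phi ga a b z) = CInt (fun t => D (ga t)) a b).
  { unfold D. rewrite (CInt_plus (fun t => cauchy_kernel phi w (ga t))
      (fun t => Cmult (Copp 1) (cauchy_kernel phi z (ga t)))); auto.
    rewrite (CInt_scal (Copp 1) (fun t => cauchy_kernel phi z (ga t))); auto.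
    unfold edge_int; ring.
    exact (Hcomp _ Kz'). }
  rewrite E.
  apply Rle_trans with (2 * ((b - a) * (M * (h * (2 / (d * d)))))).
  - apply CInt_bound; auto.
    { apply (Hcomp D). intros t Ht; apply cdiff_plus; auto. }
    intros t Ht. specialize (Hfar t Ht). specialize (Hfw t Ht).
    assert (N1 : Cminus (ga t) w <> 0%C) by (apply Cmod_pos_neq_0 with (d / 2); lra).
    assert (N2 : Cminus (ga t) z <> 0%C) by (apply Cmod_pos_neq_0 with d; lra).
    replace (D (ga t)) with (Cmult (phi (ga t)) (Cmult (Cminus w z)
       (Cinv (Cmult (Cminus (ga t) w) (Cminus (ga t) z)))))
      by (unfold D, cauchy_kernel; field; auto).
    rewrite !Cmod_mult. apply Rmult_le_compat; auto using Cmod_ge_0.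
    { apply Rmult_le_pos; apply Cmod_ge_0. }
    fold h. apply Rmult_le_compat_l; [apply Cmod_ge_0|].
    rewrite Cmod_inv by (apply Cmult_neq_0; auto). rewrite Cmod_mult.
    replace (2 / (d * d)) with (/ (d / 2 * d)) by (field; lra).
    apply Rinv_le_contravar; [nra|]. apply Rmult_le_compat; lra.
  - replace (2 * ((b - a) * (M * (h * (2 / (d * d)))))) with (K * h) by (unfold K; ring).
    apply Rle_trans with ((K + 1) * (eps / (K + 1))).
    + apply Rmult_le_compat; try lra. apply Cmod_ge_0.
    + right; field; lra.
Qed.

(* With c the midpoint of the edge, 1 / (lam - z) = sum_k (c - lam)^k / (c - z)^(k+1) uniformly for
   z in the range of f, so the integral is a power series in 1 / (c - f). *)
Lemma edge_int_memA p f phi ga a b d : 0 < p <= 1 -> memA p f -> a <= b -> b - a <= d -> lip1 ga ->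
  0 < d -> (forall t, a <= t <= b -> cdiff phi (ga t)) ->
  (forall t s1 s2, a <= t <= b -> inH s1 -> inH s2 -> d <= Cmod (Cminus (ga t) (f s1 s2))) ->
  memA p (fun s1 s2 => edge_int phi ga a b (f s1 s2)).
Proof.
  intros Hp Hf Hab Hbad Hlip Hd Hphi Hfar.
  assert (Hcomp : forall F, (forall t, a <= t <= b -> cdiff F (ga t)) -> cont_on (fun t => F (ga t)) a b).
  { intros F HF; apply cont_on_comp; auto. intros t Ht; apply cdiff_ccont, HF, Ht. }
  destruct (cont_on_bounded (fun t => phi (ga t)) a b Hab (Hcomp phi Hphi)) as [M [HM HMb]].
  set (m := (a + b) / 2). set (c := ga m).
  assert (Hc : forall t, a <= t <= b -> Cmod (Cminus c (ga t)) <= d / 2).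
  { intros t Ht. eapply Rle_trans; [apply Hlip|]. unfold m; apply Rabs_le; lra. }
  assert (Hm : a <= m <= b) by (unfold m; lra).
  set (h := fun s1 s2 => Cinv (Cminus c (f s1 s2))).
  assert (Hh : memA p h).
  { apply (memA_inv p (fun s1 s2 => Cminus c (f s1 s2)) d); auto.
    - apply (memA_minus p (fun _ _ => c)); auto. apply memA_const.
    - intros s1 s2 H1 H2; now apply (Hfar m). }
  set (al := fun k => CInt (fun t => Cmult (phi (ga t)) (Cpow (Cminus c (ga t)) k)) a b).
  (* Multiplied by c - f, the expansion becomes a power series in [h] starting at exponent 0; the
     factor is removed at the end by multiplying with [h], which lies in the algebra. *)
  assert (Hser : memA p (fun s1 s2 => Cmult (Cminus c (f s1 s2)) (edge_int phi ga a b (f s1 s2)))).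
  { destruct Hh as [Mh Hh].
    apply (inA_power_series p Mh h al _ (rpow (2 * ((b - a) * M)) p) (rpow (d / 2) p) (rpow (/ d) p));
      auto using rpow_ge_0.
    - rewrite <- rpow_mult; [|lra|left; now apply Rinv_0_lt_compat].
      replace (d / 2 * / d) with (/ 2) by (field; lra).
      rewrite <- (rpow_1 p). apply rpow_lt; lra.
    - intros s1 s2 H1 H2. apply rpow_le; [lra|]. specialize (Hfar m s1 s2 Hm H1 H2). fold c in Hfar.
      unfold h. rewrite Cmod_inv by (apply Cmod_pos_neq_0 with d; auto).
      apply Rinv_le_contravar; auto.
    - intros k. rewrite <- rpow_pow by lra.
      assert (0 <= (b - a) * M) by (apply Rmult_le_pos; lra).
      rewrite <- rpow_mult; [|lra|apply pow_le; lra].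
      apply rpow_le; [lra|].
      replace (2 * ((b - a) * M) * (d / 2) ^ k) with (2 * ((b - a) * (M * (d / 2) ^ k))) by ring.
      apply CInt_bound; auto.
      + apply (Hcomp (fun lam => Cmult (phi lam) (Cpow (Cminus c lam) k))).
        intros t Ht; apply cdiff_mult; auto. apply cdiff_pow, cdiff_minus_l.
      + intros t Ht. rewrite Cmod_mult, Cmod_pow.
        apply Rmult_le_compat; auto using Cmod_ge_0; [apply pow_le, Cmod_ge_0|].
        apply pow_incr; split; [apply Cmod_ge_0|auto].
    - intros s1 s2 H1 H2. set (z := f s1 s2).
      assert (Hz : forall t, a <= t <= b -> d <= Cmod (Cminus (ga t) z)) by (intros; apply Hfar; auto).
      assert (Hcz : d <= Cmod (Cminus c z)) by (apply Hz; auto).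
      assert (Hcz0 : Cminus c z <> 0%C) by (apply Cmod_pos_neq_0 with d; auto).
      set (u := Cinv (Cminus c z)). change (h s1 s2) with u.
      (* [G n] is the remainder of the geometric series after [n] terms; the term [G n - G (n + 1)]
         will be [P n]. *)
      set (G := fun n lam => Cmult (Cmult (Cminus c z) (Cpow u n))
          (Cmult (Cpow (Cminus c lam) n) (cauchy_kernel phi z lam))).
      assert (HG : forall n t, a <= t <= b ->
        cdiff (fun lam => Cmult (Cpow (Cminus c lam) n) (cauchy_kernel phi z lam)) (ga t)).
      { intros n t Ht. apply cdiff_mult; [apply cdiff_pow, cdiff_minus_l|].
        apply cdiff_cauchy_kernel; auto. apply far_neq with d; auto. }
      assert (HG' : forall n t, a <= t <= b -> cdiff (G n) (ga t)).
      { intros n t Ht. apply cdiff_mult; [apply cdiff_const|auto]. }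
      set (P := fun n lam => Cmult (Cpow u n) (Cmult (phi lam) (Cpow (Cminus c lam) n))).
      assert (HP : forall n t, a <= t <= b ->
        cdiff (fun lam => Cmult (phi lam) (Cpow (Cminus c lam) n)) (ga t)).
      { intros n t Ht. apply cdiff_mult; auto. apply cdiff_pow, cdiff_minus_l. }
      assert (E : forall n, Cmult (Cminus c z) (edge_int phi ga a b z) =
        Cplus (csum (fun j => Cmult (al j) (Cpow u j)) n) (CInt (fun t => G n (ga t)) a b)).
      { induction n as [|n IH].
        - simpl. unfold G.
          rewrite (CInt_scal _ (fun t => Cmult (Cpow (Cminus c (ga t)) 0) (cauchy_kernel phi z (ga t)))); auto.
          2:{ apply (Hcomp (fun lam => Cmult (Cpow (Cminus c lam) 0) (cauchy_kernel phi z lam))), HG. }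
          unfold edge_int.
          rewrite (CInt_ext (fun t => Cmult (Cpow (Cminus c (ga t)) 0) (cauchy_kernel phi z (ga t)))
            (fun t => cauchy_kernel phi z (ga t)) a b Hab) by (intros; simpl; ring).
          simpl; ring.
        - rewrite IH. cbn [csum]. rewrite <- Cplus_assoc. f_equal.
          assert (Eal : Cmult (al n) (Cpow u n) = CInt (fun t => P n (ga t)) a b).
          { unfold P. rewrite (CInt_scal _ (fun t => Cmult (phi (ga t)) (Cpow (Cminus c (ga t)) n))); auto.
            - unfold al; ring.
            - apply (Hcomp (fun lam => Cmult (phi lam) (Cpow (Cminus c lam) n))), HP. }
          rewrite Eal, <- CInt_plus; auto.
          + apply CInt_ext; auto. intros t Ht.
            assert (Nz : Cminus (ga t) z <> 0%C) by (apply Cmod_pos_neq_0 with d; auto).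
            unfold G, P, cauchy_kernel. cbn [Cpow]. unfold u at 3.
            replace (Cmult (phi (ga t)) (Cpow (Cminus c (ga t)) n)) with
              (Cmult (Cmult (phi (ga t)) (Cinv (Cminus (ga t) z)))
                (Cmult (Cpow (Cminus c (ga t)) n) (Cminus (ga t) z))) by (field; auto).
            field; auto.
          + apply (Hcomp (P n)). intros t Ht; apply cdiff_mult; [apply cdiff_const|auto]. }
      (* The ratio |c - lam| |u| is at most (d / 2) / d, so the remainder decays like 2^(-n). *)
      assert (HR : Ccvg (fun n => CInt (fun t => G n (ga t)) a b) 0%C).
      { set (K := 2 * ((b - a) * (Cmod (Cminus c z) * (M * / d)))).
        assert (HK : 0 <= K).
        { apply Rmult_le_pos; [lra|]. apply Rmult_le_pos; [lra|].
          apply Rmult_le_pos; [apply Cmod_ge_0|]. apply Rmult_le_pos; auto.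
          left; now apply Rinv_0_lt_compat. }
        intros eps Heps.
        destruct (pow_lt_1_zero (/ 2)) with (y := eps / (K + 1)) as [N HN].
        { rewrite Rabs_right; lra. }
        { apply Rdiv_lt_0_compat; lra. }
        exists N; intros n Hn. specialize (HN n Hn).
        rewrite Rabs_right in HN by (apply Rle_ge, pow_le; lra).
        replace (Cminus _ 0) with (CInt (fun t => G n (ga t)) a b) by ring.
        apply Rle_trans with (2 * ((b - a) * ((/ 2) ^ n * (Cmod (Cminus c z) * (M * / d))))).
        - apply CInt_bound; auto.
          intros t Ht.
          assert (Nz : Cminus (ga t) z <> 0%C) by (apply Cmod_pos_neq_0 with d; auto).
          replace (G n (ga t)) with (Cmult (Cpow (Cmult (Cminus c (ga t)) u) n)
            (Cmult (Cminus c z) (Cmult (phi (ga t)) (Cinv (Cminus (ga t) z))))).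
          2:{ unfold G, cauchy_kernel. rewrite Cpow_mult_l. ring. }
          rewrite Cmod_mult, Cmod_pow.
          apply Rmult_le_compat; auto using Cmod_ge_0; [apply pow_le, Cmod_ge_0| |].
          + apply pow_incr; split; [apply Cmod_ge_0|].
            unfold u. rewrite Cmod_mult, Cmod_inv by auto.
            apply Rle_trans with (d / 2 * / d); [|right; field; lra].
            apply Rmult_le_compat; auto using Cmod_ge_0.
            * left; apply Rinv_0_lt_compat; lra.
            * apply Rinv_le_contravar; auto.
          + rewrite Cmod_mult. apply Rmult_le_compat_l; [apply Cmod_ge_0|].
            rewrite Cmod_mult, Cmod_inv by auto.
            apply Rmult_le_compat; auto using Cmod_ge_0.
            * left; apply Rinv_0_lt_compat. specialize (Hz t Ht); lra.
            * apply Rinv_le_contravar; auto.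
        - apply Rle_trans with (K * (/ 2) ^ n); [right; unfold K; ring|].
          apply Rle_trans with ((K + 1) * (eps / (K + 1))); [|right; field; lra].
          apply Rmult_le_compat; try lra. apply pow_le; lra. }
      assert (X := Ccvg_plus _ _ _ _ (Ccvg_const (Cmult (Cminus c z) (edge_int phi ga a b z)))
                    (Ccvg_scal (Copp 1%C) _ _ HR)).
      replace (Cplus (Cmult (Cminus c z) (edge_int phi ga a b z)) (Cmult (Copp 1) 0)) with
        (Cmult (Cminus c z) (edge_int phi ga a b z)) in X by ring.
      revert X; apply Ccvg_ext; intros n. rewrite (E n). ring. }
  eapply memA_ext; [|exact (memA_mult p _ _ Hh Hser)].
  intros s1 s2 H1 H2. unfold h. cbv beta.
  assert (Cminus c (f s1 s2) <> 0%C) by (apply Cmod_pos_neq_0 with d; auto; apply (Hfar m); auto).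
  field; auto.
Qed.

(** * The contour around the range *)

(* The cell [x, x + d] x [y, y + d] has a point of K at sup-distance < d. *)
Definition near (K : C -> Prop) (d x y : R) : Prop :=
  exists z, K z /\ x - d < fst z < x + 2 * d /\ y - d < snd z < y + 2 * d.

Definition ind (P : Prop) : C := if excluded_middle_informative P then 1%C else 0%C.

Lemma ind_true P : P -> ind P = 1%C.
Proof. intros H; unfold ind; destruct excluded_middle_informative; tauto. Qed.

Lemma ind_false P : ~ P -> ind P = 0%C.
Proof. intros H; unfold ind; destruct excluded_middle_informative; tauto. Qed.

(** The horizontal edge starting at (x, y) is the bottom of the cell at (x, y) and, with reversed
    orientation, the top of the cell below. [edge_v] compares the cells to the left and to the right
    in the same way. *)
Definition edge_h (K : C -> Prop) d x y : C := Cminus (ind (near K d x y)) (ind (near K d x (y - d))).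
Definition edge_v (K : C -> Prop) d x y : C := Cminus (ind (near K d (x - d) y)) (ind (near K d x y)).

Lemma ind_minus_neq_0 P Q : Cminus (ind P) (ind Q) <> 0%C -> P /\ ~ Q \/ Q /\ ~ P.
Proof.
  intros H. unfold ind in H; repeat destruct excluded_middle_informative; auto;
    exfalso; apply H; ring.
Qed.

Lemma Cmod_ge_components (w z : C) d :
  ~ (fst w - d < fst z < fst w + d /\ snd w - d < snd z < snd w + d) -> d <= Cmod (Cminus w z).
Proof.
  intros H. apply Rnot_lt_le; intros Hlt. apply H.
  assert (M := Rmax_Cmod (Cminus w z)). simpl in M.
  assert (M1 := Rmax_l (Rabs (fst w + - fst z)) (Rabs (snd w + - snd z))).
  assert (M2 := Rmax_r (Rabs (fst w + - fst z)) (Rabs (snd w + - snd z))).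
  assert (A1 : Rabs (fst w + - fst z) < d) by (eapply Rle_lt_trans; [|exact Hlt]; lra).
  assert (A2 : Rabs (snd w + - snd z) < d) by (eapply Rle_lt_trans; [|exact Hlt]; lra).
  apply Rabs_def2 in A1. apply Rabs_def2 in A2. lra.
Qed.

Lemma not_near_far K d x y (w z : C) : ~ near K d x y -> K z ->
  x <= fst w <= x + d -> y <= snd w <= y + d -> d <= Cmod (Cminus w z).
Proof.
  intros Hn Hz Hx Hy. apply Cmod_ge_components. intros [H1 H2]. apply Hn.
  exists z; repeat split; auto; lra.
Qed.

(** A nonzero coefficient means that exactly one of the two adjacent cells is near K: this one gives
    differentiability of [phi] on the edge, the other one the distance to K. *)
Lemma edge_h_good K phi d x y : 0 < d ->
  (forall x y, near K d x y -> inrect x (x + d) y (y + d) (cdiff phi)) ->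
  edge_h K d x y <> 0%C -> forall t, x <= t <= x + d ->
  cdiff phi (hseg y t) /\ forall z, K z -> d <= Cmod (Cminus (hseg y t) z).
Proof.
  intros Hd HU Hne t Ht. destruct (ind_minus_neq_0 _ _ Hne) as [[H1 H2]|[H1 H2]]; split.
  - apply (HU x y H1); lra.
  - intros z Hz; apply (not_near_far K d x (y - d)); auto; simpl; lra.
  - apply (HU x (y - d) H1); lra.
  - intros z Hz; apply (not_near_far K d x y); auto; simpl; lra.
Qed.

Lemma edge_v_good K phi d x y : 0 < d ->
  (forall x y, near K d x y -> inrect x (x + d) y (y + d) (cdiff phi)) ->
  edge_v K d x y <> 0%C -> forall t, y <= t <= y + d ->
  cdiff phi (vseg x t) /\ forall z, K z -> d <= Cmod (Cminus (vseg x t) z).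
Proof.
  intros Hd HU Hne t Ht. destruct (ind_minus_neq_0 _ _ Hne) as [[H1 H2]|[H1 H2]]; split.
  - apply (HU (x - d) y H1); lra.
  - intros z Hz; apply (not_near_far K d x y); auto; simpl; lra.
  - apply (HU x y H1); lra.
  - intros z Hz; apply (not_near_far K d (x - d) y); auto; simpl; lra.
Qed.

Definition grid (x d : R) (i : nat) : R := x + INR i * d.

Lemma grid_S x d i : grid x d (S i) = grid x d i + d.
Proof. unfold grid; rewrite S_INR; ring. Qed.

Lemma csum_shift (u : nat -> C) n : u 0%nat = u n -> csum (fun j => u (S j)) n = csum u n.
Proof.
  assert (H : Cplus (csum (fun j => u (S j)) n) (u 0%nat) = Cplus (csum u n) (u n)).
  { induction n as [|n IH]; simpl; [ring|]. rewrite <- IH; ring. }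
  intros E. rewrite E in H.
  replace (csum (fun j => u (S j)) n) with (Cminus (Cplus (csum (fun j => u (S j)) n) (u n)) (u n)) by ring.
  rewrite H; ring.
Qed.

Lemma csum_zero n : csum (fun _ => 0%C) n = 0%C.
Proof. induction n as [|n IH]; simpl; [auto|rewrite IH; ring]. Qed.

Lemma csum_swap (u : nat -> nat -> C) n m :
  csum (fun i => csum (fun j => u i j) m) n = csum (fun j => csum (fun i => u i j) n) m.
Proof.
  induction n as [|n IH]; simpl; [symmetry; apply csum_zero|]. rewrite IH, <- csum_plus; auto.
Qed.

Definition contour (K : C -> Prop) (F : C -> C) (d x y : R) (n : nat) : C :=
  csum (fun i => csum (fun j => Cplus
    (Cmult (edge_h K d (grid x d i) (grid y d j)) (HI F (grid y d j) (grid x d i) (grid x d i + d)))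
    (Cmult (edge_v K d (grid x d i) (grid y d j))
       (Cmult Ci (VI F (grid x d i) (grid y d j) (grid y d j + d))))) n) n.

(* Summation by parts: edges shared by two selected cells cancel. *)
Lemma contour_eq K F d x y n :
  (forall i, ~ near K d (grid x d i) (y - d)) -> (forall i, ~ near K d (grid x d i) (grid y d n - d)) ->
  (forall j, ~ near K d (x - d) (grid y d j)) -> (forall j, ~ near K d (grid x d n - d) (grid y d j)) ->
  csum (fun i => csum (fun j => Cmult (ind (near K d (grid x d i) (grid y d j)))
    (bd F (grid x d i) (grid x d i + d) (grid y d j) (grid y d j + d))) n) n
  = contour K F d x y n.
Proof.
  intros Hy0 Hyn Hx0 Hxn.
  set (X := grid x d). set (Y := grid y d).
  set (s := fun u v => ind (near K d u v)).
  set (h := fun i v => HI F v (X i) (X i + d)).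
  set (v := fun u j => Cmult Ci (VI F u (Y j) (Y j + d))).
  assert (E0 : forall t, grid t d 0 = t) by (intros; unfold grid; simpl; ring).
  (* The top edge of a cell is the bottom edge of the next one. Shifting the index leaves no
     boundary terms, because neither the cells just below the grid nor those of its last row are
     near K. *)
  assert (A1 : forall i, csum (fun j => Cmult (s (X i) (Y j)) (h i (Y j + d))) n =
                         csum (fun j => Cmult (s (X i) (Y j - d)) (h i (Y j))) n).
  { intros i. rewrite <- (csum_shift (fun j => Cmult (s (X i) (Y j - d)) (h i (Y j)))).
    - apply csum_ext; intros j _. unfold Y. rewrite grid_S.
      replace (grid y d j + d - d) with (grid y d j) by ring. reflexivity.
    - unfold s. rewrite (ind_false (near K d (X i) (Y n - d))) by apply Hyn.
      rewrite (ind_false (near K d (X i) (Y 0%nat - d))); [ring|]. unfold Y; rewrite E0; apply Hy0. }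
  assert (A2 : forall j, csum (fun i => Cmult (s (X i) (Y j)) (v (X i + d) j)) n =
                         csum (fun i => Cmult (s (X i - d) (Y j)) (v (X i) j)) n).
  { intros j. rewrite <- (csum_shift (fun i => Cmult (s (X i - d) (Y j)) (v (X i) j))).
    - apply csum_ext; intros i _. unfold X. rewrite grid_S.
      replace (grid x d i + d - d) with (grid x d i) by ring. reflexivity.
    - unfold s. rewrite (ind_false (near K d (X n - d) (Y j))) by apply Hxn.
      rewrite (ind_false (near K d (X 0%nat - d) (Y j))); [ring|]. unfold X; rewrite E0; apply Hx0. }
  set (SH := csum (fun i => csum (fun j => Cmult (s (X i) (Y j)) (h i (Y j))) n) n).
  set (SV := csum (fun i => csum (fun j => Cmult (s (X i) (Y j)) (v (X i) j)) n) n).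
  set (SH' := csum (fun i => csum (fun j => Cmult (s (X i) (Y j - d)) (h i (Y j))) n) n).
  set (SV' := csum (fun i => csum (fun j => Cmult (s (X i - d) (Y j)) (v (X i) j)) n) n).
  transitivity (Cplus (Cplus SH (Cmult (Copp 1) SH')) (Cplus SV' (Cmult (Copp 1) SV))).
  - assert (B1 : SH' = csum (fun i => csum (fun j => Cmult (s (X i) (Y j)) (h i (Y j + d))) n) n).
    { apply csum_ext; intros; symmetry; apply A1. }
    assert (B2 : SV' = csum (fun i => csum (fun j => Cmult (s (X i) (Y j)) (v (X i + d) j)) n) n).
    { unfold SV'. rewrite csum_swap. rewrite (csum_swap (fun i j => Cmult (s (X i) (Y j)) (v (X i + d) j))).
      apply csum_ext; intros; symmetry; apply A2. }
    rewrite B1, B2. unfold SH, SV. rewrite <- !csum_scal, <- !csum_plus.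
    apply csum_ext; intros i _. rewrite <- !csum_scal, <- !csum_plus. apply csum_ext; intros j _.
    unfold bd, h, v, s, X, Y. ring.
  - unfold contour, SH, SH', SV, SV'. rewrite <- !csum_scal, <- !csum_plus.
    apply csum_ext; intros i _. rewrite <- !csum_scal, <- !csum_plus. apply csum_ext; intros j _.
    unfold edge_h, edge_v, h, v, s, X, Y. ring.
Qed.

Lemma csum_indicator_eq (u : nat -> C) k v n : (k < n)%nat -> u k = v ->
  (forall i, i <> k -> u i = 0%C) -> csum u n = v.
Proof.
  intros Hk Hv H. rewrite (csum_ext _ (fun i => if Nat.eq_dec i k then v else 0%C)).
  - rewrite csum_indicator. destruct (lt_dec k n); [auto|lia].
  - intros i _. destruct (Nat.eq_dec i k) as [->|Hi]; auto.
Qed.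

Lemma grid_separated x d i k t : 0 < d -> grid x d k < t < grid x d k + d -> i <> k ->
  forall u, grid x d i <= u <= grid x d i + d -> u <> t.
Proof.
  intros Hd Ht Hik u Hu E; subst u.
  assert (Hc : (S i <= k)%nat \/ (S k <= i)%nat) by lia.
  destruct Hc as [Hc|Hc]; apply le_INR in Hc; rewrite S_INR in Hc; unfold grid in *; nra.
Qed.

(** Only the cell containing [z] contributes: the other selected cells give 0 by Goursat's theorem,
    and the unselected ones carry the factor 0. *)
Lemma contour_interior K phi d x y n i0 j0 z : 0 < d ->
  (forall x y, near K d x y -> inrect x (x + d) y (y + d) (cdiff phi)) ->
  (i0 < n)%nat -> (j0 < n)%nat -> near K d (grid x d i0) (grid y d j0) ->
  grid x d i0 < fst z < grid x d i0 + d -> grid y d j0 < snd z < grid y d j0 + d ->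
  csum (fun i => csum (fun j => Cmult (ind (near K d (grid x d i) (grid y d j)))
    (bd (cauchy_kernel phi z) (grid x d i) (grid x d i + d) (grid y d j) (grid y d j + d))) n) n
  = Cmult (0, 2 * PI) (phi z).
Proof.
  intros Hd HU Hi Hj Hn Hx Hy.
  assert (Hout : forall i j, i <> i0 \/ j <> j0 -> Cmult (ind (near K d (grid x d i) (grid y d j)))
    (bd (cauchy_kernel phi z) (grid x d i) (grid x d i + d) (grid y d j) (grid y d j + d)) = 0%C).
  { intros i j Hij. destruct (classic (near K d (grid x d i) (grid y d j))) as [H|H].
    - rewrite cauchy_outside; [ring|lra|lra|now apply HU|].
      intros u v Hu Hv. apply pair_neq. destruct Hij as [Hij|Hij]; [left|right].
      + eapply grid_separated; eauto.
      + eapply (grid_separated y); eauto.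
    - rewrite ind_false by auto; ring. }
  apply csum_indicator_eq with i0; auto.
  - apply csum_indicator_eq with j0; auto.
    rewrite ind_true, cauchy_inside; auto. ring.
  - intros i Hne. rewrite <- (csum_zero n). apply csum_ext; intros j _. auto.
Qed.

Lemma ccont_const c z : ccont (fun _ => c) z.
Proof. apply cdiff_ccont, cdiff_const. Qed.

Lemma ccont_plus F G z : ccont F z -> ccont G z -> ccont (fun w => Cplus (F w) (G w)) z.
Proof.
  intros HF HG e He. destruct (HF (e / 2)) as [d [Hd H1]]; [lra|].
  destruct (HG (e / 2)) as [d' [Hd' H2]]; [lra|].
  exists (Rmin d d'); split; [now apply Rmin_pos|]. intros w Hw.
  specialize (H1 w ltac:(eapply Rlt_le_trans; [exact Hw|apply Rmin_l])).
  specialize (H2 w ltac:(eapply Rlt_le_trans; [exact Hw|apply Rmin_r])).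
  replace (Cminus (Cplus (F w) (G w)) (Cplus (F z) (G z))) with
    (Cplus (Cminus (F w) (F z)) (Cminus (G w) (G z))) by ring.
  eapply Rle_trans; [apply Cmod_triangle|lra].
Qed.

Lemma ccont_scal c F z : ccont F z -> ccont (fun w => Cmult c (F w)) z.
Proof.
  intros HF e He. generalize (Cmod_ge_0 c); intros Hc.
  destruct (HF (e / (Cmod c + 1))) as [d [Hd H]]; [apply Rdiv_lt_0_compat; lra|].
  exists d; split; auto. intros w Hw.
  replace (Cminus (Cmult c (F w)) (Cmult c (F z))) with (Cmult c (Cminus (F w) (F z))) by ring.
  rewrite Cmod_mult. apply Rle_trans with ((Cmod c + 1) * (e / (Cmod c + 1))).
  - apply Rmult_le_compat; auto using Cmod_ge_0; lra.
  - right; field; lra.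
Qed.

Lemma ccont_csum (Fs : nat -> C -> C) n z : (forall j, (j < n)%nat -> ccont (Fs j) z) ->
  ccont (fun w => csum (fun j => Fs j w) n) z.
Proof.
  induction n as [|n IH]; intros H; simpl; [apply ccont_const|].
  apply (ccont_plus (fun w => csum (fun j => Fs j w) n) (Fs n)); auto.
Qed.

(** Edges with coefficient 0 are treated apart: on them [phi] need not be differentiable, and K may
    come close. [contour_memA] makes the same distinction. *)
Lemma contour_ccont K phi d x y n z : 0 < d ->
  (forall x y, near K d x y -> inrect x (x + d) y (y + d) (cdiff phi)) -> K z ->
  ccont (fun w => contour K (cauchy_kernel phi w) d x y n) z.
Proof.
  intros Hd HU Hz. unfold contour.
  apply ccont_csum; intros i _. apply ccont_csum; intros j _. apply ccont_plus.
  - destruct (classic (edge_h K d (grid x d i) (grid y d j) = 0%C)) as [E|E].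
    + rewrite E.
      intros e He; exists 1; split; [lra|]; intros w _.
      match goal with |- Cmod ?u <= _ => replace u with (RtoC 0) by ring end. rewrite Cmod_0; lra.
    + apply ccont_scal. apply (edge_int_ccont phi (hseg (grid y d j)) _ _ z d); auto; try lra.
      * intros t u; apply hseg_lip.
      * intros t Ht; apply (edge_h_good K phi d _ _ Hd HU E t Ht).
      * intros t Ht; apply (edge_h_good K phi d _ _ Hd HU E t Ht); auto.
  - destruct (classic (edge_v K d (grid x d i) (grid y d j) = 0%C)) as [E|E].
    + rewrite E.
      intros e He; exists 1; split; [lra|]; intros w _.
      match goal with |- Cmod ?u <= _ => replace u with (RtoC 0) by ring end. rewrite Cmod_0; lra.
    + apply ccont_scal, ccont_scal. apply (edge_int_ccont phi (vseg (grid x d i)) _ _ z d); auto; try lra.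
      * intros t u; apply vseg_lip.
      * intros t Ht; apply (edge_v_good K phi d _ _ Hd HU E t Ht).
      * intros t Ht; apply (edge_v_good K phi d _ _ Hd HU E t Ht); auto.
Qed.

Lemma contour_memA K p f phi d x y n : 0 < p <= 1 -> memA p f -> 0 < d ->
  (forall x y, near K d x y -> inrect x (x + d) y (y + d) (cdiff phi)) ->
  (forall s1 s2, inH s1 -> inH s2 -> K (f s1 s2)) ->
  memA p (fun s1 s2 => contour K (cauchy_kernel phi (f s1 s2)) d x y n).
Proof.
  intros Hp Hf Hd HU Hz. unfold contour.
  apply (memA_csum p (fun i s1 s2 => csum _ n)); intros i _.
  apply (memA_csum p (fun j s1 s2 => Cplus _ _)); intros j _. apply memA_plus.
  - destruct (classic (edge_h K d (grid x d i) (grid y d j) = 0%C)) as [E|E].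
    + rewrite E. apply memA_ext with (fun _ _ => 0%C); [intros; ring|apply memA_const].
    + apply memA_scal.
      apply (edge_int_memA p f phi (hseg (grid y d j)) _ _ d); auto; try lra.
      * intros t u; apply hseg_lip.
      * intros t Ht; apply (edge_h_good K phi d _ _ Hd HU E t Ht).
      * intros t s1 s2 Ht H1 H2; apply (edge_h_good K phi d _ _ Hd HU E t Ht); auto.
  - destruct (classic (edge_v K d (grid x d i) (grid y d j) = 0%C)) as [E|E].
    + rewrite E. apply memA_ext with (fun _ _ => 0%C); [intros; ring|apply memA_const].
    + apply memA_scal, memA_scal.
      apply (edge_int_memA p f phi (vseg (grid x d i)) _ _ d); auto; try lra.
      * intros t u; apply vseg_lip.
      * intros t Ht; apply (edge_v_good K phi d _ _ Hd HU E t Ht).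
      * intros t s1 s2 Ht H1 H2; apply (edge_v_good K phi d _ _ Hd HU E t Ht); auto.
Qed.

Lemma grid_cell x d n t : 0 < d -> x <= t < grid x d n ->
  exists i, (i < n)%nat /\ grid x d i <= t < grid x d i + d.
Proof.
  intros Hd; induction n as [|n IH]; intros Ht; [unfold grid in Ht; simpl in Ht; lra|].
  destruct (Rlt_dec t (grid x d n)) as [H|H].
  - destruct IH as [i [Hi Hc]]; [lra|]. exists i; split; auto.
  - exists n; split; auto. rewrite grid_S in Ht. lra.
Qed.

(* The interior formula extends to points of K on the grid lines by continuity. *)
Lemma contour_formula K phi d R0 n z : 0 < d ->
  (forall x y, near K d x y -> inrect x (x + d) y (y + d) (cdiff phi)) ->
  (forall w, K w -> - R0 <= fst w <= R0 /\ - R0 <= snd w <= R0) ->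
  2 * R0 + 3 * d <= INR n * d -> K z ->
  contour K (cauchy_kernel phi z) d (- R0 - d) (- R0 - d) n = Cmult (0, 2 * PI) (phi z).
Proof.
  (* This origin and the bound on [n] leave a margin [d] below and to the left of the square
     containing K, and [2 d] above and to the right. So the cells just below and left of the grid,
     and those of its last row and column, are not near K. *)
  intros Hd HU HK Hn Hz. set (x := - R0 - d).
  assert (HxN : R0 + 2 * d <= grid x d n) by (unfold grid, x; lra).
  destruct (HK z Hz) as [Z1 Z2].
  destruct (grid_cell x d n (fst z) Hd) as [i0 [Hi0 Ci0]]; [unfold x at 1; lra|].
  destruct (grid_cell x d n (snd z) Hd) as [j0 [Hj0 Cj0]]; [unfold x at 1; lra|].
  assert (Hnear : near K d (grid x d i0) (grid x d j0)) by (exists z; repeat split; auto; lra).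
  set (T := fun w => Cplus (contour K (cauchy_kernel phi w) d x x n)
                           (Cmult (Copp (0, 2 * PI)) (phi w))).
  assert (HT : ccont T z).
  { apply ccont_plus; [now apply contour_ccont|]. apply ccont_scal, cdiff_ccont.
    destruct z as [a b]; simpl in *. apply (HU _ _ Hnear); lra. }
  (* The cell of [z] is closed on the left and below only, so moving from [z] diagonally up and to
     the right enters its interior. *)
  assert (Hzero : forall t, 0 < t -> fst z + t < grid x d i0 + d -> snd z + t < grid x d j0 + d ->
     T (fst z + t, snd z + t) = 0%C).
  { intros t Ht T1 T2. unfold T.
    rewrite <- contour_eq.
    - rewrite (contour_interior K phi d x x n i0 j0); auto; simpl; try lra. ring.
    - intros i [w [Hw [_ W]]]. destruct (HK w Hw). unfold x in W; lra.
    - intros i [w [Hw [_ W]]]. destruct (HK w Hw). lra.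
    - intros i [w [Hw [W _]]]. destruct (HK w Hw). unfold x in W; lra.
    - intros i [w [Hw [W _]]]. destruct (HK w Hw). lra. }
  assert (T z = 0%C).
  { apply Cmod_eq_0, Rle_antisym; [|apply Cmod_ge_0]. apply le_epsilon; intros e He.
    rewrite Rplus_0_l. destruct (HT e He) as [r [Hr HTr]].
    set (t := Rmin (r / 3) (Rmin ((grid x d i0 + d - fst z) / 2) ((grid x d j0 + d - snd z) / 2))).
    assert (Ht : 0 < t) by (repeat apply Rmin_pos; lra).
    assert (M1 := Rmin_l (r / 3) (Rmin ((grid x d i0 + d - fst z) / 2) ((grid x d j0 + d - snd z) / 2))).
    assert (M2 := Rmin_r (r / 3) (Rmin ((grid x d i0 + d - fst z) / 2) ((grid x d j0 + d - snd z) / 2))).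
    assert (M3 := Rmin_l ((grid x d i0 + d - fst z) / 2) ((grid x d j0 + d - snd z) / 2)).
    assert (M4 := Rmin_r ((grid x d i0 + d - fst z) / 2) ((grid x d j0 + d - snd z) / 2)).
    fold t in M1, M2.
    specialize (HTr (fst z + t, snd z + t)). rewrite Hzero in HTr by lra.
    rewrite <- Cmod_opp. replace (Copp (T z)) with (Cminus 0 (T z)) by ring. apply HTr.
    eapply Rle_lt_trans; [apply Cmod_le_abs_sum|]. simpl.
    replace (fst z + t + - fst z) with t by ring. replace (snd z + t + - snd z) with t by ring.
    rewrite Rabs_right by lra. lra. }
  unfold T in H.
  replace (contour K (cauchy_kernel phi z) d x x n) with
    (Cplus (Cplus (contour K (cauchy_kernel phi z) d x x n) (Cmult (Copp (0, 2 * PI)) (phi z)))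
       (Cmult (0, 2 * PI) (phi z))) by ring.
  rewrite H; ring.
Qed.

(** * Functional calculus, and the conclusion *)

Lemma ex_derive_cdiff phi z :
  ex_derive (K := C_AbsRing) (V := C_NormedModule) phi z -> cdiff phi z.
Proof.
  intros [l [_ H]]. exists l. intros e He.
  specialize (H z (fun P HP => HP) (mkposreal e He)).
  destruct H as [d Hd]. exists d; split; [apply cond_pos|]. intros w Hw.
  specialize (Hd w Hw). rewrite Cmult_comm. exact Hd.
Qed.

Lemma lebesgue_number (K U : C -> Prop) R0 :
  open U -> (forall z, K z -> U z) ->
  (forall z, (forall e, 0 < e -> exists w, K w /\ Cmod (Cminus w z) < e) -> K z) ->
  (forall w, K w -> - R0 <= fst w <= R0 /\ - R0 <= snd w <= R0) ->
  exists d, 0 < d /\ forall z w, K z -> Rabs (fst w - fst z) < d -> Rabs (snd w - snd z) < d -> U w.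
Proof.
  intros HU HKU Hcl HK.
  assert (Hg : forall x y : R, exists r : posreal,
    (forall w : C, Rabs (fst w - x) < 2 * r -> Rabs (snd w - y) < 2 * r -> U w) \/
    (forall w : C, Rabs (fst w - x) < 2 * r -> Rabs (snd w - y) < 2 * r -> ~ K w)).
  { intros x y. destruct (classic (U (x, y))) as [Hu|Hu].
    - destruct (HU (x, y) Hu) as [r Hr].
      assert (Hr2 : 0 < r / 2) by (generalize (cond_pos r); lra).
      exists (mkposreal _ Hr2); left; simpl. intros w W1 W2. apply Hr.
      split; simpl; unfold ball; simpl; unfold AbsRing_ball, abs, minus, plus, opp; simpl;
        unfold Rminus in *; lra.
    - assert (Hn : exists e, 0 < e /\ forall w, K w -> e <= Cmod (Cminus w (x, y))).
      { apply NNPP; intros Hno. apply Hu, HKU, Hcl. intros e He. apply NNPP; intros Hno2.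
        apply Hno; exists e; split; auto. intros w Hw. apply Rnot_lt_le; intros Hlt.
        apply Hno2; exists w; auto. }
      destruct Hn as [e [He Hw]].
      assert (He4 : 0 < e / 4) by lra.
      exists (mkposreal _ He4); right; simpl. intros w W1 W2 Kw.
      specialize (Hw w Kw). generalize (Cmod_le_abs_sum (Cminus w (x, y))). simpl.
      unfold Rminus in *; lra. }
  destruct (functional_choice (fun (q : R * R) (r : posreal) =>
    (forall w : C, Rabs (fst w - fst q) < 2 * r -> Rabs (snd w - snd q) < 2 * r -> U w) \/
    (forall w : C, Rabs (fst w - fst q) < 2 * r -> Rabs (snd w - snd q) < 2 * r -> ~ K w)))
    as [g Hgg]; [intros [x y]; apply Hg|].
  destruct (compactness_value_2d (- R0) R0 (- R0) R0 (fun x y => g (x, y))) as [d Hd].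
  exists d; split; [apply cond_pos|]. intros z w Kz W1 W2.
  destruct (HK z Kz) as [Z1 Z2].
  apply NNPP; intros HnU. apply (Hd (fst z) (snd z) Z1 Z2).
  intros [u [v [_ [_ [D1 [D2 D3]]]]]]. apply HnU.
  generalize (cond_pos (g (u, v))); intros Hp.
  destruct (Hgg (u, v)) as [H|H].
  - apply H; simpl.
    + replace (fst w - u) with ((fst w - fst z) + (fst z - u)) by ring.
      eapply Rle_lt_trans; [apply Rabs_triang|]. lra.
    + replace (snd w - v) with ((snd w - snd z) + (snd z - v)) by ring.
      eapply Rle_lt_trans; [apply Rabs_triang|]. lra.
  - exfalso. apply (H z); auto; simpl; lra.
Qed.

Lemma memA_bounded p f : 0 < p <= 1 -> memA p f ->
  exists B, forall s1 s2, inH s1 -> inH s2 -> Cmod (f s1 s2) <= B.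
Proof.
  intros Hp [M HM]. exists (rpow M (/ p)). intros s1 s2 H1 H2.
  apply rpow_le_inv with p; [lra|apply rpow_ge_0|].
  rewrite rpow_inv_r; [|lra|eapply inA_M_ge_0; eauto]. eapply inA_sup; eauto.
Qed.

Lemma memA_holomorphic p f phi : 0 < p <= 1 -> memA p f -> holomorphic_near_closure_range phi f ->
  memA p (fun s1 s2 => phi (f s1 s2)).
Proof.
  intros Hp Hf [U [HU [HKU Hder]]]. set (K := closure_range f).
  (* Points of the closure lie within distance 1 of the range, hence the added 1. *)
  destruct (memA_bounded p f Hp Hf) as [B HB]. set (R0 := B + 1).
  assert (HK : forall w, K w -> - R0 <= fst w <= R0 /\ - R0 <= snd w <= R0).
  { intros w Hw. destruct (Hw 1 ltac:(lra)) as [s1 [s2 [H1 [H2 Hd]]]].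
    assert (Cmod w <= R0).
    { replace w with (Cplus (f s1 s2) (Copp (Cminus (f s1 s2) w))) by ring.
      eapply Rle_trans; [apply Cmod_triangle|]. rewrite Cmod_opp. unfold R0.
      specialize (HB s1 s2 H1 H2). lra. }
    assert (M := Rmax_Cmod w).
    assert (A1 : Rabs (fst w) <= R0) by (generalize (Rmax_l (Rabs (fst w)) (Rabs (snd w))); lra).
    assert (A2 : Rabs (snd w) <= R0) by (generalize (Rmax_r (Rabs (fst w)) (Rabs (snd w))); lra).
    apply Rabs_le_between in A1. apply Rabs_le_between in A2. split; auto. }
  assert (Hcl : forall z, (forall e, 0 < e -> exists w, K w /\ Cmod (Cminus w z) < e) -> K z).
  { intros z Hz e He. destruct (Hz (e / 2)) as [w [Hw Hwz]]; [lra|].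
    destruct (Hw (e / 2)) as [s1 [s2 [H1 [H2 Hd]]]]; [lra|]. exists s1, s2; repeat split; auto.
    replace (Cminus (f s1 s2) z) with (Cplus (Cminus (f s1 s2) w) (Cminus w z)) by ring.
    eapply Rle_lt_trans; [apply Cmod_triangle|]. lra. }
  destruct (lebesgue_number K U R0 HU HKU Hcl HK) as [r [Hr HL]].
  (* A near cell has a point of K whose coordinates differ by less than 2 d from those of every
     point of the cell, so 2 d = r puts the cell inside [U]. *)
  set (d := r / 2). assert (Hd : 0 < d) by (unfold d; lra).
  assert (Hcell : forall x y, near K d x y -> inrect x (x + d) y (y + d) (cdiff phi)).
  { intros x y [z [Kz [Z1 Z2]]] u v Hu Hv. apply ex_derive_cdiff, Hder.
    apply (HL z); auto; simpl; apply Rabs_def1; unfold d in *; lra. }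
  destruct (INR_unbounded ((2 * R0 + 3 * d) / d)) as [n Hn].
  assert (Hn' : 2 * R0 + 3 * d <= INR n * d).
  { replace (2 * R0 + 3 * d) with ((2 * R0 + 3 * d) / d * d) by (field; lra).
    apply Rmult_le_compat_r; lra. }
  assert (Hrange : forall s1 s2, inH s1 -> inH s2 -> K (f s1 s2)).
  { intros s1 s2 H1 H2 e He. exists s1, s2; repeat split; auto.
    replace (Cminus (f s1 s2) (f s1 s2)) with (RtoC 0) by ring. rewrite Cmod_0; lra. }
  apply memA_ext with (fun s1 s2 => Cmult (Cinv (0, 2 * PI))
    (contour K (cauchy_kernel phi (f s1 s2)) d (- R0 - d) (- R0 - d) n)).
  - intros s1 s2 H1 H2. rewrite (contour_formula K phi d R0 n (f s1 s2)); auto.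
    field. intros [= E]. generalize PI_RGT_0; lra.
  - apply memA_scal, contour_memA; auto.
Qed.

Theorem theorem2 (p : R) (w : nat -> nat -> R) (f : C -> C -> C) :
  0 < p <= 1 -> almost_monotone w -> has_pDS p w f ->
  (bounded_away_from_zero f ->
     exists nu : nat -> nat -> R,
       almost_monotone nu /\
       (const_weight nu <-> const_weight w) /\
       (admissible nu <-> admissible w) /\
       (forall m n, (1 <= m)%nat -> (1 <= n)%nat -> 1 <= nu m n <= w m n) /\
       has_pDS p nu (fun s1 s2 => Cinv (f s1 s2))) /\
  (forall phi : C -> C, holomorphic_near_closure_range phi f ->
     exists xi : nat -> nat -> R,
       almost_monotone xi /\
       (const_weight xi <-> const_weight w) /\
       (admissible xi <-> admissible w) /\
       (forall m n, (1 <= m)%nat -> (1 <= n)%nat -> 1 <= xi m n <= w m n) /\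
       has_pDS p xi (fun s1 s2 => phi (f s1 s2))).
Proof.
  intros Hp Hw Hf.
  assert (Hm : memA p f) by (apply has_pDS_memA with w; auto; apply Hw).
  (* One truncated weight serves both parts: bounded above and at least 1, it makes weighted and
     unweighted summability equivalent. *)
  destruct (truncated_weight w Hw) as [nu [B [H1 [H2 [H3 [H4 H5]]]]]].
  split.
  - intros [k [Hk Hb]]. exists nu. split; [|split; [|split; [|split]]]; auto.
    apply memA_has_pDS with B; auto. now apply memA_inv with k.
  - intros phi Hphi. exists nu. split; [|split; [|split; [|split]]]; auto.
    apply memA_has_pDS with B; auto. now apply memA_holomorphic.
Qed.
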